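(* Let $\$(\nu)=O(e^{\sigma\nu})$ for some $\sigma\in(0,\infty)$. Let $\gamma$ be product weights with $\mathrm{decay}_\gamma>1$. If the quadrature assumption (Q) of the context is satisfied with exponent $\tau$, then for all $\delta>0$ $$e(N,B(K))^2=O\left(N^{-\min\{\tau,\ \mathrm{decay}_\gamma-1\}+\delta}\right),$$ or, equivalently, $$p^{\rm res}\le\max\left\{\frac2\tau,\ \frac{2}{\mathrm{decay}_\gamma-1}\right\}.$$ Assume additionally that $e(N,B(K))=\Omega(N^{-\alpha/2})$ for $\alpha=\tau$ and that $\$(\nu)=\Omega(\nu)$. Then $$p^{\rm res}=\max\left\{\frac2\alpha,\ \frac{2}{\mathrm{decay}_\gamma-1}\right\}.$$
   Context: Notation: $\mathbb N=\{1,2,\dots\}$, $\mathcal U$ is the set of all finite subsets of $\mathbb N$. $f=\Omega(g)$ means $g=O(f)$. For a reproducing kernel $L$, $H(L)$ is the reproducing kernel Hilbert space with norm $\|\cdot\|_L$, and $B(L)$ its norm unit ball. Setting: $D\subseteq\mathbb R$, $\rho$ is a probability measure on $D$, $\mu=\otimes_{n\in\mathbb N}\rho$ on $D^{\mathbb N}$. $k\ne0$ is a measurable reproducing kernel on $D\times D$ such that $H(k)$ contains no nonzero constant function, $M:=\int_D k(x,x)\,\rho(dx)<\infty$, $\int_D k(x,y)\,\rho(dx)=0$ for all $y\in D$, and $k(a,a)>0$ for all $a\in D$. The weights $\gamma=(\gamma_u)_{u\in\mathcal U}$ are non-negative with $\gamma_\emptyset=1$, $\sum_{u}\gamma_uM^{|u|}<\infty$,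 and $\gamma_v>0$ implies $\gamma_u>0$ for all $u\subseteq v$. Put $k_u(x,y)=\prod_{j\in u}k(x_j,y_j)$ ($k_\emptyset=1$), $H_u=H(k_u)$ (functions depending only on $x_u=(x_j)_{j\in u}$, identified with functions on $D^u$), $\mathfrak X=\{x\in D^{\mathbb N}:\sum_{u\in\mathcal U}\gamma_uk_u(x,x)<\infty\}$ (one has $\mu(\mathfrak X)=1$), $K(x,y)=\sum_{u\in\mathcal U}\gamma_uk_u(x,y)$ for $x,y\in\mathfrak X$, and $I(f)=\int_{\mathfrak X}f\,d\mu$ for $f\in H(K)$. Product weights: $\gamma_u=\prod_{j\in u}\gamma_j$ for all $u\in\mathcal U$ (empty product $=1$), where $\gamma_1\ge\gamma_2\ge\cdots\ge0$. Anchor: $a=(a,a,\dots)$ where $a\in D$ satisfies $\sum_{u\in\mathcal U}\gamma_uk(a,a)^{|u|}<\infty$. Cost and algorithms: $\$:\mathbb N_0\to[1,\infty]$ is monotone increasing. For $v\in\mathcal U$ let $\mathfrak X_{v,a}=\{x\in D^{\mathbb N}: x_j=a\ \forall j\notin v\}$. Evaluating $f$ at $x$ costs $c_a(x)=\inf\{\$(|u|): x\in\mathfrak X_{u,a},\,u\in\mathcal U\}$. A randomized algorithm $Q$ yields for each $f\in H(K)$ a square-integrable random variable $Q(f)$, computed from (possibly adaptively and randomly chosen) function values of $f$; its cost $\mathrm{cost}_{c_a}(Q,f)$ is the sum of the costs of all function evaluations. $\mathcal A^{\rm res}$ is the class of all randomized algorithms for which there exist $n\in\mathbb N_0$ and $v_1,\dots,v_n\in\mathcal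 U$ such that for every $f\in H(K)$ exactly $n$ function evaluations are performed, the $i$th sample point is taken from $\mathfrak X_{v_i,a}$, and $\mathbb E(\mathrm{cost}_{c_a}(Q,f))=\sum_{i=1}^n\$(|v_i|)$. For $F\subseteq H(K)$: $\mathrm{cost}(Q,F)=\sup_{f\in F}\mathbb E(\mathrm{cost}_{c_a}(Q,f))$, $e(Q,F)=(\sup_{f\in F}\mathbb E((I(f)-Q(f))^2))^{1/2}$, $e(N,F)=\inf\{e(Q,F): Q\in\mathcal A^{\rm res},\ \mathrm{cost}(Q,F)\le N\}$. Further, $\mathrm{comp}(\varepsilon,B(K))=\inf\{\mathrm{cost}(Q,B(K)): Q\in\mathcal A^{\rm res},\ e(Q,B(K))\le\varepsilon\}$, and $p^{\rm res}$ is the infimum of all $p\ge0$ for which there is $C\ge0$ with $\mathrm{comp}(\varepsilon,B(K))\le C\varepsilon^{-p}$ for all $\varepsilon>0$. Decay: with $\widehat\gamma_u=\gamma_uk_u(a,a)$, $\mathrm{decay}_\gamma=\sup\{p\in\mathbb R:\sum_{u\in\mathcal U}\widehat\gamma_u^{1/p}<\infty\}$. Quadrature assumption (Q): there are $c,C,\tau>0$, $\alpha_1\ge0$, $\alpha_2\in[0,1]$ such that for every nonempty $u\in\mathcal U$ with $\gamma_u>0$ and every $n\in\mathbb N$ there is an unbiased randomized quadrature $Q_{u,n}(\omega,f)=\sum_{i=1}^nt_if(x^{(i)}(\omega))$, $f\in L^2(D^u,\rho^u)$, with deterministic real $t_i$ satisfying $\sum_it_i=1$, with $\omega=(\omega_j)_{j\in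 u}$ in a product probability space $(\Omega^u,\mathbb P^u)$, and random points $x^{(i)}=(x^{(i)}_j)_{j\in u}\in D^u$ such that $x^{(i)}_j$ depends on $\omega$ only through $\omega_j$ and has distribution $\rho$, and such that for all $w\subseteq u$ with $\gamma_w>0$ and all $f_w\in H_w$ $$\mathrm{Var}(Q_{u,n}(f_w))\le c\,C^{|u|}(n+1)^{-\tau}F_w(n)\|f_w\|_{k_w}^2,$$ where $F_w(n)=1$ if $|w|\le1$ and $F_w(n)=\left(1+\frac{\ln(n+1)}{(|w|-1)^{\alpha_2}}\right)^{\alpha_1(|w|-1)^{\alpha_2}}$ if $|w|\ge2$. *)

(* Defs.v *)
From HB Require Import structures.
From mathcomp Require Import all_boot all_order all_algebra finmap.
From mathcomp Require Import all_classical all_reals all_analysis measurable_realfun.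

Set Implicit Arguments.
Unset Strict Implicit.
Unset Printing Implicit Defensive.

Import Order.TTheory GRing.Theory Num.Theory.
Import numFieldNormedType.Exports.

Local Open Scope fset_scope.
Local Open Scope classical_set_scope.
Local Open Scope ring_scope.

(* The subset D of R as a measurable space with the trace of the Borel
   sigma-algebra.  The proof D0 only serves to provide the default point that
   MathComp-Analysis requires of a measurable space. *)
Definition dom_points (R : realType) (D : set R) (D0 : D !=set0) : Type :=
  set_type D.

Section dom_points_pointed.
Context (R : realType) (D : set R) (D0 : D !=set0).
HB.instance Definition _ := Choice.copy (dom_points D0) (set_type D).
HB.instance Definition _ := isPointed.Build (dom_points D0)
  (exist (fun x => x \in D) (projT1 (cid D0)) (mem_set (projT2 (cid D0)))).
End dom_points_pointed.

Definition dom (R : realType) (D : set R) (D0 : D !=set0) :=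
  g_sigma_algebraType
    (preimage_set_system setT (fun x : dom_points D0 => \val x : R) measurable).

(* I -> T with the product sigma-algebra, for an arbitrary index set I. *)
Definition cylinders (I : Type) d (T : measurableType d) : set (set (I -> T)) :=
  \bigcup_(i : I) preimage_set_system setT (fun x : I -> T => x i) measurable.

Definition prod_space (I : Type) d (T : measurableType d) :=
  g_sigma_algebraType (@cylinders I d T).

(* PI is the product measure of copies of P indexed by I; this determines PI. *)
Definition is_product_measure (R : realType) (I : choiceType) d
    (T : measurableType d) (P : probability T R)
    (PI : probability (prod_space I T) R) : Prop :=
  forall (J : {fset I}) (A : I -> set T),
    (forall j, j \in J -> measurable (A j)) ->
    PI [set x | forall j, j \in J -> A j (x j)] = (\prod_(j <- J) P (A j))%E.

(* A Hilbert space of functions on E with reproducing kernel L.  By the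
   Moore-Aronszajn theorem every symmetric positive semidefinite L has exactly
   one: carrier and inner product (on the carrier) are determined by L. *)
Record rkhs (R : realType) (E : Type) (L : E -> E -> R) := Rkhs {
  rkhs_carrier :> (E -> R) -> Prop ;
  rkhs_ip : (E -> R) -> (E -> R) -> R ;
  rkhs_zero : rkhs_carrier (fun=> 0) ;
  rkhs_lin : forall c f g, rkhs_carrier f -> rkhs_carrier g ->
    rkhs_carrier (fun x => c * f x + g x) ;
  rkhs_ip_sym : forall f g, rkhs_carrier f -> rkhs_carrier g ->
    rkhs_ip f g = rkhs_ip g f ;
  rkhs_ip_lin : forall c f g h,
    rkhs_carrier f -> rkhs_carrier g -> rkhs_carrier h ->
    rkhs_ip (fun x => c * f x + g x) h = c * rkhs_ip f h + rkhs_ip g h ;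
  rkhs_ip_ge0 : forall f, rkhs_carrier f -> 0 <= rkhs_ip f f ;
  rkhs_ip_eq0 : forall f, rkhs_carrier f -> rkhs_ip f f = 0 -> f = (fun=> 0) ;
  rkhs_complete : forall u : nat -> E -> R, (forall n, rkhs_carrier (u n)) ->
    (forall e : R, 0 < e -> exists N, forall m n, (N <= m)%N -> (N <= n)%N ->
       Num.sqrt (rkhs_ip (u m \- u n) (u m \- u n)) < e) ->
    exists2 f, rkhs_carrier f &
      (fun n => Num.sqrt (rkhs_ip (u n \- f) (u n \- f))) @ \oo --> (0 : R) ;
  rkhs_kernel : forall y, rkhs_carrier (L ^~ y) ;
  rkhs_repr : forall f y, rkhs_carrier f -> rkhs_ip f (L ^~ y) = f y
}.

Definition rkhs_norm (R : realType) (E : Type) (L : E -> E -> R) (H : rkhs L)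
  (f : E -> R) : R := Num.sqrt (rkhs_ip H f f).

Definition rkhs_ball (R : realType) (E : Type) (L : E -> E -> R) (H : rkhs L) :
  set (E -> R) := [set f | H f /\ rkhs_norm H f <= 1].

(* Value of an absolutely convergent series over an arbitrary index set. *)
Definition asum (R : realType) (T : choiceType) (g : T -> R) : R :=
  fine (\esum_(u in [set: T]) (g^\+ u)%:E)%E -
  fine (\esum_(u in [set: T]) (g^\- u)%:E)%E.

Section kernels.
Context (R : realType) (D : Type) (k : D -> D -> R) (gamma : {fset nat} -> R).

Definition kern (u : {fset nat}) (x y : nat -> D) : R :=
  \prod_(j <- u) k (x j) (y j).

Definition frakX : set (nat -> D) :=
  [set x | (\esum_(u in [set: {fset nat}]) (gamma u * kern u x x)%:E < +oo)%E].

Definition Kkern (x y : frakX) : R :=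
  asum (fun u => gamma u * kern u (\val x) (\val y)).

Definition hat_gamma (a : D) (u : {fset nat}) : R :=
  gamma u * kern u (fun=> a) (fun=> a).

(* For p <= 0 the real power below takes conventional values; this does not
   matter, as p = 1 always belongs to the set when gamma is summable at a. *)
Definition decay (a : D) : \bar R :=
  ereal_sup [set p%:E | p in [set p : R |
    (\esum_(u in [set: {fset nat}]) (hat_gamma a u `^ (1 / p))%:E < +oo)%E]].

End kernels.

(* The index j : nat stands for the coordinate j + 1 of the mathematical text. *)
Definition product_weights (R : realType) (gamma : {fset nat} -> R) : Prop :=
  exists g : nat -> R,
    [/\ (forall j, 0 <= g j), (forall i j, (i <= j)%N -> g j <= g i) &
        forall u : {fset nat}, gamma u = \prod_(j <- u) g j].

Definition ebigO (R : realType) (f g : nat -> \bar R) : Prop :=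
  exists2 C : R, 0 <= C & \forall n \near \oo, (f n <= C%:E * g n)%E.

Definition ebigOmega (R : realType) (f g : nat -> \bar R) : Prop := ebigO g f.

(* A deterministic algorithm that evaluates its input f : E -> R at adaptively
   chosen points: either stop with an output, or query a point of E and continue
   depending on the value found there. *)
Inductive strategy (R E : Type) : Type :=
| Output of R
| Query of E & (R -> strategy R E).

Fixpoint run (R E : Type) (s : strategy R E) (f : E -> R) : R :=
  match s with Output r => r | Query x s' => run (s' (f x)) f end.

Fixpoint sample_points (R E : Type) (s : strategy R E) (f : E -> R) : seq E :=
  match s with
  | Output _ => [::]
  | Query x s' => x :: sample_points (s' (f x)) f
  end.

Record randomized_algorithm (R : realType) (E : Type) := RandomizedAlgorithm {
  ra_disp : measure_display ;
  ra_space : measurableType ra_disp ;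
  ra_prob : probability ra_space R ;
  ra_strategy : ra_space -> strategy R E
}.

Section complexity.
Context (R : realType) (d : measure_display) (D : measurableType d).
Context (k : D -> D -> R) (gamma : {fset nat} -> R).
Context (mu : probability (prod_space nat D) R).
Context (HK : rkhs (@Kkern R D k gamma)) (a : D) (cost : nat -> \bar R).
Let X := frakX k gamma.
Implicit Types (Q : randomized_algorithm R X) (F : set (X -> R)).

Definition I_mu (f : X -> R) : R := \int[mu]_(x in X) ('valL_ 0 f) x.

Definition anchored (v : {fset nat}) : set (nat -> D) :=
  [set x | forall j, j \notin v -> x j = a].

Definition point_cost (x : nat -> D) : \bar R :=
  ereal_inf [set cost #|` u| | u in [set u | anchored u x]].

Definition run_cost Q (f : X -> R) (w : ra_space Q) : \bar R :=
  (\sum_(x <- sample_points (ra_strategy w) f) point_cost (\val x))%E.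

Definition expected_cost Q (f : X -> R) : \bar R :=
  (\int[ra_prob Q]_w run_cost f w)%E.

(* Only Q(f) and the cost are required to be measurable, not the sample points
   themselves. *)
Definition admissible Q : Prop :=
  forall f, HK f ->
    (fun w => run (@ra_strategy _ _ Q w) f) \in Lfun (ra_prob Q) 2%:E /\
    measurable_fun setT (@run_cost Q f).

(* vs lists v_1, ..., v_n. *)
Definition A_res Q : Prop :=
  admissible Q /\
  exists vs : seq {fset nat}, forall f, HK f ->
    (forall w : ra_space Q,
       let xs := [seq \val x | x <- sample_points (ra_strategy w) f] in
       size xs = size vs /\
       forall i, (i < size vs)%N ->
         anchored (nth fset0 vs i) (nth (fun=> a) xs i)) /\
    expected_cost Q f = (\sum_(v <- vs) cost #|` v|)%E.

Definition cost_on Q F : \bar R := ereal_sup [set expected_cost Q f | f in F].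

Definition error_on Q F : \bar R :=
  ((ereal_sup [set (\int[ra_prob Q]_w
      ((I_mu f - run (ra_strategy w) f) ^+ 2)%:E) | f in F]) `^ 2^-1)%E.

Definition min_error (N : nat) F : \bar R :=
  ereal_inf [set y | exists Q,
    [/\ A_res Q, (cost_on Q F <= N%:R%:E)%E & y = error_on Q F]].

Definition comp_res (eps : R) : \bar R :=
  ereal_inf [set y | exists Q,
    [/\ A_res Q, (error_on Q (rkhs_ball HK) <= eps%:E)%E &
        y = cost_on Q (rkhs_ball HK)]].

Definition p_res : \bar R :=
  ereal_inf [set p%:E | p in [set p : R | 0 <= p /\
    exists2 C : R, 0 <= C & forall eps : R, 0 < eps ->
      (comp_res eps <= (C * eps `^ (- p))%:E)%E]].

End complexity.

Section quadrature.
Context (R : realType) (d : measure_display) (D : measurableType d).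
Context (rho : probability D R) (k : D -> D -> R) (gamma : {fset nat} -> R).
Context (H : forall u : {fset nat}, rkhs (@kern R D k u)) (a : D).

(* Extends z in D^u to D^N.  It is only composed with functions that depend on
   coordinates in u alone, so the value used outside u is irrelevant. *)
Definition extend (u : {fset nat}) (z : u -> D) : nat -> D :=
  fun j => if insub j is Some i then z i else a.

(* F_w(n) as a function of m = |w|. *)
Definition Ffactor (alpha1 alpha2 : R) (m n : nat) : R :=
  if (m <= 1)%N then 1
  else (1 + ln n.+1%:R / (m.-1)%:R `^ alpha2) `^ (alpha1 * (m.-1)%:R `^ alpha2).

(* xi i j : Omega -> D gives the j-th coordinate of the i-th point as a function
   of the j-th coordinate of w. *)
Definition quad d' (Omega : measurableType d') (u : {fset nat}) (n : nat)
    (t : 'I_n -> R) (xi : 'I_n -> u -> Omega -> D) (f : (u -> D) -> R)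
    (w : prod_space u Omega) : R :=
  \sum_(i < n) t i * f (fun j : u => xi i j (w j)).

Definition quadrature_assumption (tau : R) : Prop :=
  exists c C alpha1 alpha2 : R,
  [/\ 0 < c, 0 < C, 0 < tau, 0 <= alpha1 & 0 <= alpha2 <= 1] /\
  forall (u : {fset nat}) (n : nat), u != fset0 -> 0 < gamma u -> (0 < n)%N ->
  exists d' (Omega : measurableType d') (P : probability Omega R)
    (Pu : probability (prod_space u Omega) R)
    (t : 'I_n -> R) (xi : 'I_n -> u -> Omega -> D),
  [/\ is_product_measure P Pu,
      \sum_(i < n) t i = 1,
      forall i j, measurable_fun setT (xi i j) /\
        forall A, measurable A -> P (xi i j @^-1` A) = rho A,
      forall rhou : probability (prod_space u D) R,
        is_product_measure rho rhou ->
        forall f : prod_space u D -> R, f \in Lfun rhou 2%:E ->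
        ('E_Pu[quad t xi f] = \int[rhou]_z (f z)%:E)%E &
      forall w : {fset nat}, (w `<=` u)%fset -> 0 < gamma w ->
        forall f, H w f ->
        ('V_Pu[quad t xi (fun z => f (extend z))] <=
         (c * C ^+ #|` u| * n.+1%:R `^ (- tau) * Ffactor alpha1 alpha2 #|` w| n
          * rkhs_norm (H w) f ^+ 2)%:E)%E].

End quadrature.

(* Main.v *)
(** Upper bound.  For product weights the kernel is the product of the factors
    1 + g_j k(x_j, y_j), so the functional L_v that integrates out the coordinates
    in v and sets the others to the anchor is represented by the product of the
    1 + g_j k(a, y_j) over j outside v.  The anchored component f_u is an
    alternating sum of values of f, hence can be estimated by Q_(u,n) at cost
    n 2^|u| $(|u|).  Summing independent estimators over a finite downward closed
    family A of sets u leaves a squared bias of at most the sum over w outside A of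
    4^|w| times the weights at the anchor.  With q = 1/p for some p < decay, A is
    the family of all u with X gamma_u^q >= 1 (up to constants in the factors), and
    f_u gets about X gamma_u^q points, so that the cost is O(X) and the squared
    error is O(X^-beta) for every beta < min(tau, decay - 1).

    Lower bound.  An algorithm of cost at most N samples points anchored outside a
    set V of O(N) coordinates.  For J disjoint from V the function
    P - prod_(j in J) (1 + g_j k(a, x_j)), where P is the value of the product at
    the anchor, vanishes at these points; it has squared norm P (P - 1) and
    integral P - 1, so the squared error is at least 1 - 1/P.  Monotonicity of the
    weights turns this into a polynomial bound on g_j. *)

From HB Require Import structures.
Require Import Defs.
From mathcomp Require Import all_boot all_order all_algebra finmap ring lra.
From mathcomp Require Import all_classical all_reals all_analysis measurable_realfun.

Set Implicit Arguments.
Unset Strict Implicit.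
Unset Printing Implicit Defensive.

Import Order.TTheory GRing.Theory Num.Theory.
Import numFieldNormedType.Exports.

Local Open Scope fset_scope.
Local Open Scope classical_set_scope.
Local Open Scope ring_scope.

(** * Reproducing kernel Hilbert spaces *)

(** The component [f_u] need not lie in [H_u]: for one coordinate it has the form [F(x) - F(a)] with
    [F] in [H(k)], and [H(k)] contains no nonzero constant. It is therefore written as the
    alternating sum of the truncations of a single [F] in [H_u]; the truncation to [v] lies in
    [H_v], so (Q) applies to each of the [2^|u|] terms with its own [w = v]. These terms share their
    random nodes and cost a factor [2^|u|] by Cauchy-Schwarz, whereas different [u] use independent
    nodes, so that their variances add. Factors exponential in [|u|] (from (Q), from the number of
    terms, from the cost) are harmless: they rescale each factor of a product weight by a constant,
    and summable factors stay summable. The bias is explicit linear algebra: the Gram matrix of the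
    representers is known, and expanding it over sets [w] turns the squared norm of the bias
    functional into a weighted sum of squares, one for each [w]. In the lower bound the fooling
    function and its negative produce the same run, so even a randomized algorithm cannot separate
    their integrals. *)

Section rkhs_theory.
Context (R : realType) (E : Type) (L : E -> E -> R) (H : rkhs L).
Local Notation ip := (rkhs_ip H).
Implicit Types (f g h : E -> R).

Lemma rkhs_scale c f : H f -> H (fun x => c * f x).
Proof.
move=> Hf; rewrite (_ : (fun x => c * f x) = fun x => c * f x + (fun=> 0) x).
  exact: rkhs_lin Hf (rkhs_zero H).
by apply/funext => x /=; rewrite addr0.
Qed.

Lemma rkhs_sub f g : H f -> H g -> H (f \- g).
Proof.
move=> Hf Hg; rewrite (_ : f \- g = fun x => -1 * g x + f x); first exact: rkhs_lin.
by apply/funext => x /=; rewrite mulN1r addrC.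
Qed.

Lemma rkhs_sum (I : Type) (s : seq I) (c : I -> R) (F : I -> E -> R) :
  (forall i, H (F i)) -> H (fun x => \sum_(i <- s) c i * F i x).
Proof.
move=> HF; elim: s => [|i s IHs].
  rewrite (_ : (fun x => _) = (fun=> 0)); first exact: rkhs_zero.
  by apply/funext => x; rewrite big_nil.
rewrite (_ : (fun x => _) = fun x => c i * F i x + \sum_(i <- s) c i * F i x).
  exact: rkhs_lin.
by apply/funext => x; rewrite big_cons.
Qed.

Lemma rkhs_ip0l f : H f -> ip (fun=> 0) f = 0.
Proof.
move=> Hf; have := rkhs_ip_lin (-1) (rkhs_zero H) (rkhs_zero H) Hf.
have -> : (fun x : E => -1 * 0 + 0) = (fun=> 0) :> (E -> R).
  by apply/funext => x; rewrite mulr0 addr0.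
by rewrite mulN1r addNr.
Qed.

Lemma rkhs_ipZl c f g : H f -> H g -> ip (fun x => c * f x) g = c * ip f g.
Proof.
move=> Hf Hg; have := rkhs_ip_lin c Hf (rkhs_zero H) Hg.
rewrite rkhs_ip0l// addr0 => <-; congr (ip _ g).
by apply/funext => x; rewrite addr0.
Qed.

Lemma rkhs_ip_linr c f g h : H f -> H g -> H h ->
  ip h (fun x => c * f x + g x) = c * ip h f + ip h g.
Proof.
move=> Hf Hg Hh.
rewrite rkhs_ip_sym ?rkhs_ip_lin//; last exact: rkhs_lin.
by rewrite (rkhs_ip_sym Hf)// (rkhs_ip_sym Hg).
Qed.

Lemma rkhs_ipBl f g h : H f -> H g -> H h -> ip (f \- g) h = ip f h - ip g h.
Proof.
move=> Hf Hg Hh.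
rewrite (_ : f \- g = fun x => -1 * g x + f x).
  by rewrite rkhs_ip_lin// mulN1r addrC.
by apply/funext => x; rewrite mulN1r addrC.
Qed.

Lemma rkhs_sq_lin c f g : H f -> H g ->
  ip (fun x => c * f x + g x) (fun x => c * f x + g x) =
  c ^+ 2 * ip f f + 2 * c * ip f g + ip g g.
Proof.
move=> Hf Hg; have Hl := rkhs_lin c Hf Hg.
rewrite rkhs_ip_lin// !rkhs_ip_linr// (rkhs_ip_sym Hg Hf); ring.
Qed.

Lemma rkhs_sq_sub f g : H f -> H g ->
  ip (f \- g) (f \- g) = ip f f - 2 * ip f g + ip g g.
Proof.
move=> Hf Hg; rewrite (_ : f \- g = fun x => -1 * g x + f x); last first.
  by apply/funext => x; rewrite mulN1r addrC.
by rewrite rkhs_sq_lin// (rkhs_ip_sym Hg Hf); ring.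
Qed.

Lemma rkhs_ip_suml (I : Type) (s : seq I) (c : I -> R) (F : I -> E -> R) h :
  (forall i, H (F i)) -> H h ->
  ip (fun x => \sum_(i <- s) c i * F i x) h = \sum_(i <- s) c i * ip (F i) h.
Proof.
move=> HF Hh; elim: s => [|i s IHs].
  rewrite big_nil (_ : (fun x => _) = (fun=> 0)) ?rkhs_ip0l//.
  by apply/funext => x; rewrite big_nil.
rewrite big_cons -IHs -rkhs_ip_lin//; last exact: rkhs_sum.
by congr (ip _ h); apply/funext => x; rewrite big_cons.
Qed.

Lemma rkhs_CS f g : H f -> H g -> ip f g ^+ 2 <= ip f f * ip g g.
Proof.
move=> Hf Hg; set x := ip f f; set y := ip f g; set z := ip g g.
have x0 : 0 <= x by exact: rkhs_ip_ge0.
have z0 : 0 <= z by exact: rkhs_ip_ge0.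
have key c : 0 <= c ^+ 2 * x + 2 * c * y + z.
  by rewrite -rkhs_sq_lin//; apply: rkhs_ip_ge0; exact: rkhs_lin.
move: x0; rewrite le_eqVlt => /predU1P[x0|x0]; last first.
  have := key (- y / x).
  have -> : (- y / x) ^+ 2 * x + 2 * (- y / x) * y + z = (x * z - y ^+ 2) / x.
    by field; rewrite gt_eqF.
  by rewrite pmulr_lge0 ?invr_gt0// subr_ge0.
rewrite -x0 mul0r; have [->|y0] := eqVneq y 0; first by rewrite expr0n.
have := key (- (z + 1) / (2 * y)); rewrite -x0 mulr0 add0r.
have -> : 2 * (- (z + 1) / (2 * y)) * y + z = -1 by field.
by rewrite ler0N1.
Qed.

Lemma kernel_ip x y : ip (L ^~ y) (L ^~ x) = L x y.
Proof. by rewrite rkhs_repr//; exact: rkhs_kernel. Qed.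

Lemma kernel_sym x y : L x y = L y x.
Proof.
by rewrite -[LHS]kernel_ip -[RHS]kernel_ip rkhs_ip_sym//; exact: rkhs_kernel.
Qed.

Lemma kernel_ge0 x : 0 <= L x x.
Proof. by rewrite -kernel_ip; apply: rkhs_ip_ge0; exact: rkhs_kernel. Qed.

Lemma kernel_CS x y : L x y ^+ 2 <= L x x * L y y.
Proof.
rewrite -(kernel_ip x x) -(kernel_ip y y) -(kernel_ip x y) mulrC.
by apply: rkhs_CS; exact: rkhs_kernel.
Qed.

Lemma rkhs_eval_bound f y : H f -> f y ^+ 2 <= ip f f * L y y.
Proof.
move=> Hf; rewrite -(rkhs_repr y Hf) -(kernel_ip y y).
by apply: rkhs_CS => //; exact: rkhs_kernel.
Qed.

(** Cauchy-Schwarz followed by the arithmetic-geometric mean inequality; convergence and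
    integrability of off-diagonal kernel values are thus reduced to the diagonal. *)
Lemma kernel_le_half x y : `|L x y| <= (L x x + L y y) / 2.
Proof.
have x0 := kernel_ge0 x; have y0 := kernel_ge0 y.
rewrite -(@ler_pXn2r _ 2)// ?nnegrE ?divr_ge0 ?addr_ge0//.
rewrite real_normK ?num_real//; apply: le_trans (kernel_CS x y) _.
by have := sqr_ge0 (L x x - L y y); nra.
Qed.

Definition kernel_span (s : seq (R * E)) : E -> R :=
  fun x => \sum_(p <- s) p.1 * L x p.2.

Lemma kernel_span_mem s : H (kernel_span s).
Proof.
apply: (@rkhs_sum _ s fst (fun p : R * E => L ^~ p.2)) => p; exact: rkhs_kernel.
Qed.

Lemma ip_kernel_span s f : H f -> ip (kernel_span s) f = \sum_(p <- s) p.1 * f p.2.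
Proof.
move=> Hf; rewrite (@rkhs_ip_suml _ s fst (fun p : R * E => L ^~ p.2))//; last first.
  by move=> p; exact: rkhs_kernel.
apply: eq_bigr => p _; rewrite rkhs_ip_sym ?rkhs_repr//; exact: rkhs_kernel.
Qed.

Lemma ip_kernel_span2 s t : ip (kernel_span s) (kernel_span t) =
  \sum_(p <- s) \sum_(q <- t) p.1 * q.1 * L p.2 q.2.
Proof.
rewrite ip_kernel_span; last exact: kernel_span_mem.
apply: eq_bigr => p _; rewrite mulr_sumr; apply: eq_bigr => q _.
by rewrite mulrA.
Qed.

(** First-order condition at a near-maximum: for small [t] the quadratic term cannot compensate a
    nonzero linear one. The value [t = x / (c + 1)] leads to the contradiction. *)
Lemma le_lin_eq0 (x c : R) : 0 <= c ->
  (forall e t, 0 < e -> 2 * t * x <= e + t ^+ 2 * c) -> x = 0.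
Proof.
move=> c0 key; apply/eqP/negPn/negP => x0.
have x2 : 0 < x ^+ 2 by rewrite exprn_even_gt0.
have := key (x ^+ 2 / (c + 1) / 2) (x / (c + 1)).
have c1 : 0 < c + 1 by lra.
have /[swap]/[apply] : 0 < x ^+ 2 / (c + 1) / 2 by rewrite !divr_gt0.
have -> : 2 * (x / (c + 1)) * x = 2 * (x ^+ 2 / (c + 1)).
  by field; rewrite gt_eqF.
have -> : (x / (c + 1)) ^+ 2 * c = (x ^+ 2 / (c + 1)) * (c / (c + 1)).
  by field; rewrite gt_eqF.
have y0 : 0 < x ^+ 2 / (c + 1) by rewrite divr_gt0.
have : c / (c + 1) <= 1 by rewrite ler_pdivrMr//; lra.
by move: y0; set y := x ^+ 2 / _; set z := c / _; nra.
Qed.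

(* The graph [G] of a bounded linear functional on a subspace that need not be
   closed; the representer is the limit of a sequence maximizing
   [2 r - |g|^2] over [G]. *)
Lemma riesz (G : (E -> R) -> R -> Prop) (c : R) :
  0 <= c -> G (fun=> 0) 0 ->
  (forall b g r g' r', G g r -> G g' r' ->
    G (fun x => b * g x + g' x) (b * r + r')) ->
  (forall g r, G g r -> H g /\ r ^+ 2 <= c * ip g g) ->
  exists h, [/\ H h, ip h h <= c, forall g r, G g r -> ip h g = r &
    exists gs : nat -> E -> R, (forall n, exists r, G (gs n) r) /\
      forall e, 0 < e -> exists N, forall n, (N <= n)%N ->
        ip (gs n \- h) (gs n \- h) < e].
Proof.
move=> c0 G0 Glin Gb.
pose J g (r : R) : R := 2 * r - ip g g.
pose S : set R := [set j | exists g r, G g r /\ j = J g r].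
have J0 : S 0.
  exists (fun=> 0), 0; split => //; rewrite /J mulr0 rkhs_ip0l ?subr0//.
  exact: rkhs_zero.
have Jc g r : G g r -> J g r <= c.
  move=> /Gb[Hg r2]; rewrite /J; have g0 := rkhs_ip_ge0 Hg.
  rewrite lerBlDr leNgt; apply/negP => lt_r.
  have : (c + ip g g) ^+ 2 < (2 * r) ^+ 2.
    by rewrite ltr_pXn2r// nnegrE; lra.
  by have := sqr_ge0 (c - ip g g); nra.
have supS : has_sup S.
  by split; [exists 0 | exists c => j [g [r [/Jc ? ->]]]].
pose s := sup S.
have Js g r : G g r -> J g r <= s.
  by move=> Ggr; apply: ub_le_sup; [exact: supS.2 | exists g, r].
have exn (n : nat) : exists gr : (E -> R) * R,
    G gr.1 gr.2 /\ s - n.+1%:R^-1 < J gr.1 gr.2.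
  have n0 : 0 < n.+1%:R^-1 :> R by rewrite invr_gt0.
  have [_ [g [r [Ggr ->]]] ltJ] := sup_adherent n0 supS.
  by exists (g, r).
have [gr /all_and2[Ggr ltJ]] := choice exn.
pose gs n := (gr n).1; pose rs n := (gr n).2.
have Hgs n : H (gs n) by case: (Gb _ _ (Ggr n)).
(* Parallelogram law: [J] at the midpoint of [gs m] and [gs n] exceeds the mean of the two values by
   a quarter of this squared distance, and it cannot exceed [s]. *)
have sub_le m n : ip (gs m \- gs n) (gs m \- gs n) <=
    2 * (m.+1%:R^-1 + n.+1%:R^-1).
  have := Js _ _ (Glin (1/2) _ _ _ _ (Ggr m) (Glin (-(1/2)) _ _ _ _ (Ggr n) (Ggr n))).
  have := ltJ m; have := ltJ n; rewrite /J -/(gs m) -/(gs n) -/(rs m) -/(rs n).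
  have -> : (fun x => 1 / 2 * gs m x + (- (1 / 2) * gs n x + gs n x)) =
            (fun x => 1/2 * gs m x + (fun y => 1/2 * gs n y) x).
    by apply/funext => x /=; field.
  have Hn2 : H (fun y => 1/2 * gs n y) by exact: rkhs_scale.
  rewrite rkhs_sq_lin// (rkhs_ip_sym (Hgs m) Hn2) !rkhs_ipZl//.
  rewrite (rkhs_ip_sym (Hgs n) Hn2) rkhs_ipZl// rkhs_sq_sub//.
  rewrite (rkhs_ip_sym (Hgs n) (Hgs m)).
  move: (m.+1%:R^-1) (n.+1%:R^-1) => x y; lra.
have small (e : R) : 0 < e -> exists N, forall n, (N <= n)%N -> n.+1%:R^-1 < e.
  move=> e0; have [N _ Ne] := near_infty_natSinv_lt (PosNum e0).
  by exists N => n Nn; exact: Ne.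
have cau : forall e : R, 0 < e -> exists N, forall m n, (N <= m)%N -> (N <= n)%N ->
    Num.sqrt (ip (gs m \- gs n) (gs m \- gs n)) < e.
  move=> e e0; have [|N Ne] := small (e ^+ 2 / 4); first by rewrite divr_gt0 ?exprn_gt0.
  exists N => m n /Ne lm /Ne ln.
  rewrite -(@ltr_pXn2r _ 2) ?nnegrE ?sqrtr_ge0 ?(ltW e0)//.
  rewrite sqr_sqrtr; last by apply: rkhs_ip_ge0; exact: rkhs_sub.
  apply: le_lt_trans (sub_le m n) _; move: lm ln.
  by move: (m.+1%:R^-1) (n.+1%:R^-1) => x y; lra.
have [h Hh cvh] := rkhs_complete Hgs cau.
have gsh (e : R) : 0 < e -> exists N, forall n, (N <= n)%N -> ip (gs n \- h) (gs n \- h) < e.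
  move=> e0; have se0 : 0 < Num.sqrt e by rewrite sqrtr_gt0.
  have /cvgrPdist_lt/(_ _ se0)[N _ Ne] := cvh.
  exists N => n /Ne; rewrite /= sub0r normrN ger0_norm ?sqrtr_ge0// ltr_sqrt//.
(* Perturbing the near-maximizer [gs n] by [t * g] cannot raise [J] above [s]; in the limit the
   linear term in [t] has to vanish. *)
have ipg g r : G g r -> ip h g = r.
  move=> Gg; have [Hg _] := Gb _ _ Gg.
  apply/eqP; rewrite eq_sym -subr_eq0; apply/eqP.
  apply: (@le_lin_eq0 _ (ip g g + 1)) => [|e t e0].
    by have := rkhs_ip_ge0 Hg; lra.
  have e2 : 0 < e / 2 by lra.
  have [N1 HN1] := small _ e2.
  have [N2 HN2] := gsh (e / 2 / (ip g g + 1)) ltac:(by rewrite divr_gt0//; have := rkhs_ip_ge0 Hg; lra).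
  pose n := maxn N1 N2.
  have ln := HN1 n (leq_maxl _ _); have lh := HN2 n (leq_maxr _ _).
  have := Js _ _ (Glin t _ _ _ _ Gg (Ggr n)); have := ltJ n.
  rewrite /J -/(gs n) -/(rs n) rkhs_sq_lin//.
  have CS := rkhs_CS (rkhs_sub (Hgs n) Hh) Hg.
  move: CS lh; rewrite (rkhs_ipBl (Hgs n) Hh Hg) (rkhs_ip_sym Hg (Hgs n)).
  have := rkhs_ip_ge0 (rkhs_sub (Hgs n) Hh).
  set d := ip (gs n \- h) _; set y := ip (gs n) g; set z := ip h g; set w := ip g g.
  have w0 : 0 <= w by exact: rkhs_ip_ge0.
  move=> d0 CS lh lJ ub.
  have {}lh : d * (w + 1) < e / 2 by rewrite -ltr_pdivlMr//; lra.
  have yz : (y - z) ^+ 2 <= e / 2 by nra.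
  have : 2 * t * (y - z) <= t ^+ 2 + e / 2.
    have := sqr_ge0 (t - (y - z)); nra.
  move: ln; move: (n.+1%:R^-1) lJ => x; nra.
exists h; split => //.
  (* Since [ip h (gs N) = rs N], the value of [J] at [gs N] is [ip h h] minus the squared distance
     of [gs N] to [h], and it is at most [c]. *)
  apply/ler_addgt0Pr => e e0; have [N HN] := gsh e e0.
  have := HN N (leqnn _); have := Jc _ _ (Ggr N); have := ipg _ _ (Ggr N).
  rewrite /J -/(gs N) -/(rs N) rkhs_sq_sub// (rkhs_ip_sym Hh (Hgs N)) => ->.
  lra.
by exists gs; split => // n; exists (rs n); exact: Ggr.
Qed.

Lemma kernel_span_lin b s t : (fun x => b * kernel_span s x + kernel_span t x) =
  kernel_span ([seq (b * p.1, p.2) | p <- s] ++ t).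
Proof.
apply/funext => x; rewrite /kernel_span big_cat big_map mulr_sumr.
by congr (_ + _); apply: eq_bigr => p _; rewrite mulrA.
Qed.

(* [f] belongs to the space as soon as [c L - f f^T] is positive semidefinite. *)
Lemma rkhs_mem f (c : R) : 0 <= c ->
  (forall s : seq (R * E), (\sum_(p <- s) p.1 * f p.2) ^+ 2 <=
     c * \sum_(p <- s) \sum_(q <- s) p.1 * q.1 * L p.2 q.2) ->
  H f /\ ip f f <= c.
Proof.
move=> c0 fb.
pose G g r := exists s, g = kernel_span s /\ r = \sum_(p <- s) p.1 * f p.2.
have [|||h [Hh hc hG _]] := @riesz G c c0.
- by exists [::]; split; [apply/funext => x|]; rewrite /kernel_span !big_nil.
- move=> b _ _ _ _ [s [-> ->]] [t [-> ->]]; rewrite kernel_span_lin; eexists.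
  split; first by reflexivity.
  rewrite big_cat big_map mulr_sumr.
  by congr (_ + _); apply: eq_bigr => p _; rewrite mulrA.
- move=> _ _ [s [-> ->]]; split; first exact: kernel_span_mem.
  by rewrite ip_kernel_span2.
suff -> : f = h by [].
apply/funext => x; rewrite -(rkhs_repr x Hh).
rewrite -[LHS]mul1r; apply/esym/hG; exists [:: (1, x)].
rewrite big_seq1; split => //; apply/funext => y.
by rewrite /kernel_span big_seq1 mul1r.
Qed.

Lemma rkhs_functional (l : (E -> R) -> R) (c : R) : 0 <= c ->
  (forall b f g, H f -> H g -> l (fun x => b * f x + g x) = b * l f + l g) ->
  (forall f, H f -> l f ^+ 2 <= c * ip f f) ->
  exists h, [/\ H h, ip h h <= c & forall f, H f -> ip f h = l f].
Proof.
move=> c0 llin lb.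
pose G g r := H g /\ r = l g.
have [|||h [Hh hc hG _]] := @riesz G c c0.
- split; first exact: rkhs_zero.
  have z : (fun x : E => -1 * (fun=> 0) x + (fun=> 0) x) = (fun=> 0) :> (E -> R).
    by apply/funext => x; rewrite mulr0 addr0.
  by have := llin (-1) _ _ (rkhs_zero H) (rkhs_zero H); rewrite z => ->; ring.
- move=> b f _ g _ [Hf ->] [Hg ->]; split; first exact: rkhs_lin.
  by rewrite llin.
- by move=> f _ [Hf ->]; split => //; exact: lb.
by exists h; split => // f Hf; rewrite (rkhs_ip_sym Hf Hh); exact: hG.
Qed.

(** [riesz] is applied to the pairing with [f] restricted to kernel combinations. Its representer
    has the same values as [f], hence equals [f], and it comes with approximants from the span. *)
Lemma kernel_span_dense f : H f -> exists ss : nat -> seq (R * E),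
  forall e, 0 < e -> exists N, forall n, (N <= n)%N ->
    ip (kernel_span (ss n) \- f) (kernel_span (ss n) \- f) < e.
Proof.
move=> Hf; pose G g r := (exists s, g = kernel_span s) /\ r = ip f g.
have f0 := rkhs_ip_ge0 Hf.
have [|||h [Hh _ hG [gs [Ggs cv]]]] := @riesz G (ip f f) f0.
- split; last by rewrite rkhs_ip_sym ?rkhs_ip0l//; exact: (rkhs_zero H).
  by exists [::]; apply/funext => x; rewrite /kernel_span big_nil.
- move=> b _ _ _ _ [[s ->] ->] [[t ->] ->]; split; last first.
    by rewrite rkhs_ip_linr//; exact: kernel_span_mem.
  by rewrite kernel_span_lin; eexists.
- move=> _ _ [[s ->] ->]; have Hs := kernel_span_mem s.
  by split => //; exact: rkhs_CS.
have fh : f = h.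
  apply/funext => x; rewrite -(rkhs_repr x Hh) -(rkhs_repr x Hf).
  apply/esym/hG; split => //; exists [:: (1, x)]; apply/funext => y.
  by rewrite /kernel_span big_seq1 mul1r.
have /choice[ss gsE] n : exists s, gs n = kernel_span s by have [r [[s ->] _]] := Ggs n; exists s.
exists ss => e e0; have [N HN] := cv e e0.
by exists N => n /HN; rewrite gsE fh.
Qed.

Lemma kernel_span_cvg f : H f -> exists ss : nat -> seq (R * E),
  forall x, (fun n => kernel_span (ss n) x) @ \oo --> f x.
Proof.
move=> Hf; have [ss cv] := kernel_span_dense Hf; exists ss => x.
apply/cvgrPdist_lt => e e0.
have Lx := kernel_ge0 x; have d0 : 0 < L x x + 1 by lra.
have [|N HN] := cv (e ^+ 2 / (L x x + 1)); first by rewrite divr_gt0 ?exprn_gt0.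
exists N => // n /HN; rewrite /= ltr_pdivlMr// => lt.
have Hd := rkhs_sub (kernel_span_mem (ss n)) Hf.
have := rkhs_eval_bound x Hd; have := rkhs_ip_ge0 Hd; move: lt.
set d := ip _ _ => lt d0' eb.
rewrite -(@ltr_pXn2r _ 2) ?nnegrE ?normr_ge0 ?(ltW e0)//.
rewrite real_normK ?num_real// -sqrrN opprB; apply: le_lt_trans eb _; nra.
Qed.

(** Every element is a pointwise limit of finite kernel combinations, so measurability is inherited
    from the kernel sections although the carrier is only given abstractly. *)
Lemma rkhs_measurable d (T : measurableType d) (phi : T -> E) f :
  (forall y, measurable_fun setT (fun x => L (phi x) y)) -> H f ->
  measurable_fun setT (f \o phi).
Proof.
move=> mL Hf; have [ss cv] := kernel_span_cvg Hf.
apply: (@measurable_fun_cvg _ _ _ _ (fun n x => kernel_span (ss n) (phi x))).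
  move=> n; apply: measurable_sum => p; exact: measurable_funM.
by move=> x _; exact: cv.
Qed.

End rkhs_theory.

(** * Integrals with respect to a product measure *)

Import HBNNSimple.

Section indep_integral.
Local Open Scope ereal_scope.
Context d d' (T : measurableType d) (T' : measurableType d') (R : realType).
Context (P : {measure set T -> \bar R}) (rho : {measure set T' -> \bar R}).
Context (X : T -> T') (mX : measurable_fun setT X).
Context (y : T -> R) (my : measurable_fun setT y) (y0 : forall x, (0 <= y x)%R).
Let Y x := (y x)%:E.
Let mY : measurable_fun setT Y. Proof. exact/measurable_EFinP. Qed.
Let Y0 x : 0 <= Y x. Proof. by rewrite lee_fin. Qed.
Hypothesis IY : \int[P]_x Y x < +oo.
Hypothesis XY : forall B, measurable B ->
  \int[P]_x ((\1_B (X x))%:E * Y x) = rho B * \int[P]_x Y x.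

Let indep_nnsfun (h : {nnsfun T' >-> R}) :
  \int[P]_x ((h (X x))%:E * Y x) = (\int[rho]_z (h z)%:E) * \int[P]_x Y x.
Proof.
have mh r : measurable (h @^-1` [set r]) by exact: measurable_sfunP.
under eq_integral => x _.
  rewrite fimfunE -fsumEFin// ge0_mule_fsuml; last first.
    by move=> r; rewrite EFinM nnfun_muleindic_ge0.
  over.
rewrite ge0_integral_fsum//; last 2 first.
- move=> r; apply: emeasurable_funM => //; apply/measurable_EFinP.
  apply: measurable_funM => //; apply: measurableT_comp mX.
  exact: measurable_indic.
- by move=> r x _; rewrite mule_ge0// EFinM nnfun_muleindic_ge0.
rewrite integralT_nnsfun sintegralE ge0_mule_fsuml; last first.
  by move=> r; exact: nnsfun_mulemu_ge0.
apply: eq_fsbigr => r _; rewrite -muleA -XY//.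
have [r0|r0] := ltP r 0%R.
  rewrite (_ : h @^-1` [set r] = set0); last by rewrite preimage_nnfun0.
  rewrite [X in r%:E * X]integral0_eq; last first.
    by move=> x _; rewrite indic0 mul0e.
  by rewrite mule0 integral0_eq// => x _; rewrite indic0 mulr0 mul0e.
rewrite -ge0_integralZl//.
- by apply: eq_integral => x _; rewrite EFinM muleA.
- apply: emeasurable_funM => //; apply/measurable_EFinP.
  by apply: measurableT_comp mX; exact: measurable_indic.
- by move=> x _; rewrite mule_ge0.
Qed.

(** The factorization is assumed for indicators only; simple functions and monotone convergence
    extend it. This splits one coordinate off a product. *)
Lemma ge0_integral_indepM (g : T' -> \bar R) : measurable_fun setT g ->
  (forall z, 0 <= g z) ->
  \int[P]_x (g (X x) * Y x) = (\int[rho]_z g z) * \int[P]_x Y x.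
Proof.
move=> mg g0; pose f_ := nnsfun_approx measurableT mg.
have f_g z : (fun n => (f_ n z)%:E) @ \oo --> g z by exact: cvg_nnsfun_approx.
have ndf z : {homo (fun n => (f_ n z)%:E) : a b / (a <= b)%N >-> a <= b}.
  by move=> a b ab; rewrite lee_fin; exact/lefP/nd_nnsfun_approx.
have IYf : \int[P]_x Y x \is a fin_num.
  by rewrite ge0_fin_numE//; apply: integral_ge0 => x _; exact: Y0.
transitivity (limn (fun n => \int[P]_x ((f_ n (X x))%:E * Y x))).
  rewrite -monotone_convergence//.
  - by apply: eq_integral => x _; apply/esym/cvg_lim => //; exact: cvgeZr.
  - move=> n; apply: emeasurable_funM => //; apply/measurable_EFinP.
    exact: measurableT_comp.
  - by move=> n x _; rewrite mule_ge0// lee_fin.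
  - by move=> x _ a b ab; rewrite lee_wpmul2r//; exact: ndf.
apply/cvg_lim => //; under eq_fun do rewrite indep_nnsfun.
apply: cvgeZr => //.
rewrite (_ : \int[rho]_z g z = \int[rho]_z limn (fun n => (f_ n z)%:E)); last first.
  by apply: eq_integral => z _; apply/esym/cvg_lim.
apply: cvg_monotone_convergence => //.
- by move=> n; exact/measurable_EFinP.
- by move=> n z _; rewrite lee_fin.
Qed.

End indep_integral.

Lemma measurable_coord (I : Type) d (T : measurableType d) (i : I) :
  measurable_fun setT (fun x : prod_space I T => x i).
Proof.
move=> _ A mA; rewrite setTI; apply: sub_sigma_algebra.
by exists i => //; exists A => //; rewrite setTI.
Qed.

Lemma measurable_prod_space (I : Type) d d' (T : measurableType d)
    (T' : measurableType d') (phi : T' -> prod_space I T) :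
  (forall i, measurable_fun setT (fun x => phi x i)) -> measurable_fun setT phi.
Proof.
move=> mphi.
apply: (@measurability _ _ T' (g_sigma_algebraType (@cylinders I d T)) setT phi
  (@cylinders I d T) erefl).
move=> _ [_ [i _ [A mA <-]] <-].
by rewrite [X in _ @^-1` X]setTI; exact: mphi.
Qed.

Section product_measure.
Context (R : realType) (I : choiceType) d (T : measurableType d).
Context (P : probability T R) (PI : probability (prod_space I T) R).
Hypothesis PIP : is_product_measure P PI.

Lemma integral_cylinder (J : seq I) (A : I -> set T) : uniq J ->
  (forall j, measurable (A j)) ->
  (\int[PI]_x (\prod_(j <- J) \1_(A j) (x j))%:E = \prod_(j <- J) P (A j))%E.
Proof.
move=> uJ mA; have JE j : (j \in [fset i in J]) = (j \in J) by rewrite !inE.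
have := @PIP [fset j in J] A; rewrite (perm_big J) /=; last first.
  by apply: uniq_perm => // j; rewrite JE.
move=> <-; last by move=> j _; exact: mA.
have -> : [set x | forall j, j \in [fset i in J] -> A j (x j)] =
          \big[setI/setT]_(j <- J) ((fun x : prod_space I T => x j) @^-1` A j).
  rewrite -bigcap_seq; apply/seteqP; split => x /= xA j.
    by move=> jJ; apply: xA; rewrite JE.
  by rewrite JE => jJ; exact: xA.
rewrite -[X in PI X]setIT -integral_indic//; last first.
  rewrite big_seq; apply: big_ind => // [B C mB mC|j jJ]; first exact: measurableI.
  by rewrite -[X in measurable X]setTI; exact: measurable_coord.
apply: eq_integral => x _; congr (_%:E).
elim: {uJ mA JE} J => [|j J IHJ]; first by rewrite !big_nil indicT.
by rewrite !big_cons indicI IHJ.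
Qed.

Lemma measurable_prod_coord (l : seq I) (g : I -> T -> R) :
  (forall j, measurable_fun setT (g j)) ->
  measurable_fun setT (fun x : prod_space I T => \prod_(j <- l) g j (x j)).
Proof.
move=> mg; elim: l => [|j l IHl].
  rewrite (_ : (fun x => _) = cst 1); first exact: measurable_cst.
  by apply/funext => x; rewrite big_nil.
rewrite (_ : (fun x => _) =
    ((g j \o (fun x : prod_space I T => x j)) \* (fun x => \prod_(i <- l) g i (x i)))); last first.
  by apply/funext => x; rewrite big_cons.
apply: measurable_funM => //.
by apply: measurableT_comp (mg j) _; exact: measurable_coord.
Qed.

(** The indicators over [J] make the induction on [l] work: the independence of coordinate [i] from
    the remaining factors is the induction hypothesis with one more indicator, at [i]. *)
Lemma ge0_integral_prod_indic (l J : seq I) (g : I -> T -> R) (A : I -> set T) :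
  uniq (l ++ J) -> (forall j, measurable (A j)) ->
  (forall j, measurable_fun setT (g j)) ->
  (forall j x, 0 <= g j x) ->
  (forall j, (\int[P]_x (g j x)%:E < +oo)%E) ->
  (\int[PI]_x ((\prod_(j <- l) g j (x j)) * \prod_(j <- J) \1_(A j) (x j))%:E =
   (\prod_(j <- l) \int[P]_x (g j x)%:E) * \prod_(j <- J) P (A j))%E.
Proof.
move=> + + mg g0 goo; elim: l J A => [|i l IHl] J A.
  move=> uJ mA; rewrite big_nil mul1e -integral_cylinder//.
  by apply: eq_integral => x _; rewrite big_nil mul1r.
rewrite cons_uniq mem_cat negb_or => /andP[/andP[il iJ] ulJ] mA.
have IH := IHl J A ulJ mA.
pose y (x : prod_space I T) := (\prod_(j <- l) g j (x j)) * \prod_(j <- J) \1_(A j) (x j) : R.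
have y0 x : 0 <= y x by rewrite mulr_ge0//; apply: prodr_ge0.
have my : measurable_fun setT y.
  apply: measurable_funM; first exact: measurable_prod_coord.
  apply: (@measurable_prod_coord J (fun j => \1_(A j))) => j.
  exact: measurable_indic.
have IYE : (\int[PI]_x (y x)%:E < +oo)%E.
  rewrite IH; rewrite -ge0_fin_numE; last first.
    by rewrite mule_ge0// prode_ge0// => j _; apply: integral_ge0 => x _; rewrite lee_fin.
  rewrite fin_numM//; apply: prode_fin_num => j _; last exact: fin_num_measure.
  by rewrite ge0_fin_numE//; apply: integral_ge0 => x _; rewrite lee_fin.
under eq_integral do rewrite big_cons -mulrA EFinM.
have gi0 x : (0 <= (g i x)%:E)%E by rewrite lee_fin g0.
rewrite (@ge0_integral_indepM _ _ _ _ _ PI P (fun x => x i) _ y my y0 IYE _ (EFin \o g i))//.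
- by rewrite IH big_cons muleA.
- exact: measurable_coord.
- move=> B mB; rewrite IH.
  pose A' j := if j == i then B else A j.
  have A'i : A' i = B by rewrite /A' eqxx.
  have A'E j : j \in J -> A' j = A j.
    by rewrite /A'; case: (j =P i) => // -> ; rewrite (negbTE iJ).
  have mA' j : measurable (A' j) by rewrite /A'; case: ifP.
  have uiJ : uniq (l ++ i :: J).
    by rewrite -cat1s uniq_catCA /= mem_cat negb_or il iJ.
  transitivity (\int[PI]_x ((\prod_(j <- l) g j (x j)) *
      \prod_(j <- i :: J) \1_(A' j) (x j))%:E)%E.
    apply: eq_integral => x _; rewrite -EFinM big_cons A'i mulrCA.
    by congr (_ * (_ * _))%:E; apply: eq_big_seq => j /A'E ->.
  rewrite IHl// big_cons A'i muleCA.
  by congr (_ * (_ * _))%E; apply: eq_big_seq => j /A'E ->.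
- exact/measurable_EFinP.
Qed.

Lemma ge0_integral_prod (l : seq I) (g : I -> T -> R) : uniq l ->
  (forall j, measurable_fun setT (g j)) -> (forall j x, 0 <= g j x) ->
  (forall j, (\int[P]_x (g j x)%:E < +oo)%E) ->
  (\int[PI]_x (\prod_(j <- l) g j (x j))%:E = \prod_(j <- l) \int[P]_x (g j x)%:E)%E.
Proof.
move=> ul mg g0 goo.
have := @ge0_integral_prod_indic l [::] g (fun=> setT).
rewrite cats0 big_nil mule1 => <-//.
by apply: eq_integral => x _; rewrite big_nil mulr1.
Qed.

Lemma integrable_prod (l : seq I) (g : I -> T -> R) : uniq l ->
  (forall j, P.-integrable setT (EFin \o g j)) ->
  PI.-integrable setT (fun x => (\prod_(j <- l) g j (x j))%:E).
Proof.
move=> ul ig; have mg j : measurable_fun setT (g j).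
  by apply/measurable_EFinP; apply: measurable_int (ig j).
apply/integrableP; split.
  by apply/measurable_EFinP; exact: measurable_prod_coord.
under eq_integral do rewrite abse_EFin normr_prod.
have igoo j : (\int[P]_x (`|g j x|)%:E < +oo)%E by have /integrableP[] := ig j.
rewrite (ge0_integral_prod (g := fun j x => `|g j x|))//; last first.
  by move=> j; apply: measurableT_comp (mg j); exact: normr_measurable.
rewrite -ge0_fin_numE; last by apply: prode_ge0 => j _; apply: integral_ge0.
by apply: prode_fin_num => j _; rewrite ge0_fin_numE//; exact: integral_ge0.
Qed.

Lemma integral_prod (l : seq I) (g : I -> T -> R) : uniq l ->
  (forall j, P.-integrable setT (EFin \o g j)) ->
  (\int[PI]_x (\prod_(j <- l) g j (x j))%:E = \prod_(j <- l) \int[P]_x (g j x)%:E)%E.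
Proof.
(* The factors in [l'] are already nonnegative. Each step splits the next factor of [l] into its
   positive and negative parts and moves each part to [l']. *)
suff gen (l' : seq I) : uniq (l ++ l') ->
  (forall j, P.-integrable setT (EFin \o g j)) ->
  (forall j, j \in l' -> forall x, 0 <= g j x) ->
  (\int[PI]_x (\prod_(j <- l ++ l') g j (x j))%:E =
   \prod_(j <- l ++ l') \int[P]_x (g j x)%:E)%E.
  by move=> ul ig; have := gen [::]; rewrite cats0; exact.
elim: l l' g => [|i l IHl] l' g ul ig g0.
  rewrite [LHS](_ : _ =
      (\int[PI]_x (\prod_(j <- l') `|g j (x j)|)%:E)%E); last first.
    apply: eq_integral => x _; congr (_%:E); apply: eq_big_seq => j jl.
    by rewrite ger0_norm// g0.
  rewrite (@ge0_integral_prod l' (fun j x => `|g j x|))//.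
  - apply: eq_big_seq => j jl; apply: eq_integral => x _.
    by rewrite ger0_norm// g0.
  - move=> j; apply: measurableT_comp => //.
    by apply/measurable_EFinP; apply: measurable_int (ig j).
  - by move=> j; have /integrableP[] := ig j.
have uil : uniq (l ++ i :: l').
  by rewrite uniq_catC cons_uniq mem_cat orbC -mem_cat uniq_catC.
have perm : perm_eq (l ++ i :: l') (i :: l ++ l').
  by rewrite -cat1s perm_catCA.
have il : i \notin l ++ l' by move: ul; rewrite cat_cons cons_uniq => /andP[].
pose upd (h : T -> R) j := if j == i then h else g j.
have updE h (F : (T -> R) -> I -> R) :
    \prod_(j <- l ++ i :: l') F (upd h j) j =
    F h i * \prod_(j <- l ++ l') F (g j) j.
  rewrite (perm_big _ perm) big_cons /upd eqxx; congr (_ * _).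
  by apply: eq_big_seq => j jl; case: (j =P i) jl il => // -> ->.
have updEe h (F : (T -> R) -> \bar R) :
    (\prod_(j <- l ++ i :: l') F (upd h j) =
    F h * \prod_(j <- l ++ l') F (g j))%E.
  rewrite (perm_big _ perm) big_cons /upd eqxx; congr (_ * _)%E.
  by apply: eq_big_seq => j jl; case: (j =P i) jl il => // -> ->.
have iupd h : P.-integrable setT (EFin \o h) -> forall j, P.-integrable setT (EFin \o upd h j).
  by move=> ih j; rewrite /upd; case: ifP.
have updg0 h : (forall x, 0 <= h x) -> forall j, j \in i :: l' -> forall x, 0 <= upd h j x.
  by move=> h0 j; rewrite inE /upd; case: (j =P i) => //= _ jl' x; exact: g0.
have ip : P.-integrable setT (EFin \o (g i)^\+).
  by apply: integrable_funrpos => //; exact: ig.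
have inn : P.-integrable setT (EFin \o (g i)^\-).
  by apply: integrable_funrneg => //; exact: ig.
pose c (x : prod_space I T) := \prod_(j <- l ++ l') g j (x j).
have IH h : P.-integrable setT (EFin \o h) -> (forall x, 0 <= h x) ->
    PI.-integrable setT (fun x => (h (x i) * c x)%:E) /\
    (\int[PI]_x (h (x i) * c x)%:E =
      \int[P]_x (h x)%:E * \prod_(j <- l ++ l') \int[P]_x (g j x)%:E)%E.
  move=> ih h0; split.
    apply: eq_integrable (integrable_prod uil (iupd _ ih)) => // x _ /=.
    by rewrite (updE h (fun f j => f (x j))).
  have := IHl (i :: l') (upd h) uil (iupd _ ih) (updg0 _ h0).
  rewrite (updEe h (fun f => \int[P]_x (f x)%:E)%E) => <-.
  by apply: eq_integral => x _; rewrite (updE h (fun f j => f (x j))).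
rewrite cat_cons big_cons.
transitivity (\int[PI]_x (((g i)^\+ (x i) * c x)%:E - ((g i)^\- (x i) * c x)%:E))%E.
  apply: eq_integral => x _.
  by rewrite big_cons -EFinB -mulrBl -[g i in LHS](funrposBneg (g i)).
have [ipc IHp] := IH _ ip (fun x => funrpos_ge0 (g i) x).
have [inc IHn] := IH _ inn (fun x => funrneg_ge0 (g i) x).
rewrite integralB// IHp IHn.
rewrite -muleBl; first last.
- by rewrite fin_num_adde_defr// integrable_fin_num.
- apply: prode_fin_num => j _. apply: integrable_fin_num => //; exact: ig.
congr (_ * _)%E; rewrite -integralB//; apply: eq_integral => x _.
by rewrite -EFinB -[g i in RHS](funrposBneg (g i)).
Qed.
End product_measure.

(** * Sums over finite sets and infinite products *)

Section fpowerset_sums.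
Local Open Scope fset_scope.
Local Open Scope ring_scope.
Context (R : comNzRingType) (K : choiceType).
Implicit Types (A u v : {fset K}).

Lemma fset1U_ind (P : {fset K} -> Prop) : P fset0 ->
  (forall x A, x \notin A -> P A -> P (x |` A)) -> forall A, P A.
Proof.
move=> P0 PS; elim/finSet_rect => A IH.
have [->//|[x xA]] := fset_0Vmem A.
rewrite -(fsetD1K xA); apply: PS; first by rewrite !inE eqxx.
by apply: IH; exact: fproperD1.
Qed.

Lemma sum_fpowerset1U (V : nmodType) x A (F : {fset K} -> V) : x \notin A ->
  \sum_(u <- fpowerset (x |` A)) F u =
  \sum_(u <- fpowerset A) F u + \sum_(u <- fpowerset A) F (x |` u).
Proof.
move=> xA; rewrite (big_fsetID _ (fun u => x \notin u)) /=; congr (_ + _).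
  apply: eq_fbigl => u; rewrite !inE !fpowersetE /=.
  apply/andP/idP => [[uA xu]|uA].
    apply/fsubsetP => y yu; move/fsubsetP: uA => /(_ _ yu).
    by rewrite !inE => /orP[/eqP yx|//]; rewrite -yx yu in xu.
  split; last by apply: contra xA => xu; exact: (fsubsetP uA).
  by apply: fsubset_trans uA _; exact: fsubsetUr.
transitivity (\sum_(u <- [fset x |` u | u in fpowerset A]) F u).
  apply: eq_fbigl => u; rewrite !inE negbK.
  apply/andP/imfsetP => /= [[]|[v + ->]]; rewrite !fpowersetE.
    move=> uA xu; exists (u `\ x); last by rewrite fsetD1K.
    by rewrite fpowersetE fsubDset.
  by move=> vA; rewrite fsetUS//= !inE eqxx.
rewrite big_imfset//= => u v; rewrite !fpowersetE => uA vA uv.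
have xu : x \notin u by apply: contra xA; exact: (fsubsetP uA).
have xv : x \notin v by apply: contra xA; exact: (fsubsetP vA).
by rewrite -(fsetU1K xu) uv fsetU1K.
Qed.

Lemma prod_fpowerset A (a b : K -> R) :
  \sum_(u <- fpowerset A) \prod_(j <- A) (if j \in u then a j else b j) =
  \prod_(j <- A) (a j + b j).
Proof.
elim/fset1U_ind: A => [|x A xA IH].
  by rewrite fpowerset0 !big_seq_fset1 !big_seq_fset0.
rewrite sum_fpowerset1U// big_fsetU1//= -IH mulrDl addrC; congr (_ + _).
  rewrite big_distrr/=; apply: eq_big_seq => u; rewrite fpowersetE => uA.
  rewrite big_fsetU1//= !inE eqxx; congr (_ * _); apply: eq_big_seq => j jA.
  by rewrite !inE; case: eqP jA xA => [->->|].
rewrite big_distrr/=; apply: eq_big_seq => u; rewrite fpowersetE => uA.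
rewrite big_fsetU1//=; case: ifPn => // xu.
by move: xA; rewrite (fsubsetP uA).
Qed.

Lemma prod_fsubset A u (c : K -> R) : u `<=` A ->
  \prod_(j <- A) (if j \in u then c j else 1) = \prod_(j <- u) c j.
Proof.
move=> uA; rewrite -(big_fset_incl _ uA) /=.
  by apply: eq_big_seq => j ->.
by move=> j _ /negbTE ->.
Qed.

Lemma sum_fpowerset_prod A (c : K -> R) :
  \sum_(u <- fpowerset A) \prod_(j <- u) c j = \prod_(j <- A) (1 + c j).
Proof.
under [RHS]eq_bigr do rewrite addrC; rewrite -prod_fpowerset.
by apply: eq_big_seq => u; rewrite fpowersetE => uA; rewrite prod_fsubset.
Qed.

End fpowerset_sums.

Definition fiota (n : nat) : {fset nat} := [fset i in iota 0 n].

Lemma in_fiota n i : (i \in fiota n) = (i < n)%N.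
Proof. by rewrite !inE mem_iota add0n. Qed.

Lemma big_fiota (S : Type) (idx : S) (op : Monoid.com_law idx) n (F : nat -> S) :
  \big[op/idx]_(j <- fiota n) F j = \big[op/idx]_(0 <= j < n) F j.
Proof.
apply: perm_big; apply: uniq_perm => // [|j]; first exact: iota_uniq.
by rewrite in_fiota mem_index_iota.
Qed.

Lemma fiotaS n m : (n <= m)%N -> (fiota n `<=` fiota m)%fset.
Proof.
by move=> nm; apply/fsubsetP => j; rewrite !in_fiota => /leq_trans; apply.
Qed.

Lemma fset_sub_fiota (u : {fset nat}) : exists n, (u `<=` fiota n)%fset.
Proof.
exists (\max_(j <- u) j).+1; apply/fsubsetP => j ju; rewrite in_fiota ltnS.
by rewrite (big_rem j ju) /= leq_maxl.
Qed.

Section subset_sums.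
Context (R : realType).
Implicit Types (h : {fset nat} -> R).

(** The powersets of initial segments exhaust the finite sets. Along them a sum of product weights
    is a finite product, so unordered sums become limits of ordinary products. *)
Definition subset_sum h n := \sum_(u <- fpowerset (fiota n)) h u.

Lemma finite_fsetsE (F : set {fset nat}) : finite_set F ->
  exists n, F `<=` [set` fpowerset (fiota n)].
Proof.
move=> finF; have [n Fn] := fset_sub_fiota (\bigcup_(u <- fset_set F) u)%fset.
exists n => u Fu /=; rewrite fpowersetE; apply: fsubset_trans Fn.
by apply: bigfcup_sup; rewrite // in_fset_set// inE.
Qed.

Lemma subset_sum_le_esum h n : (forall u, 0 <= h u) ->
  ((subset_sum h n)%:E <= \esum_(u in [set: {fset nat}]) (h u)%:E)%E.
Proof.
move=> h0; apply: esum_ge; exists [set` fpowerset (fiota n)].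
  by split => //; exact: finite_fset.
by rewrite -fsbig_seq// -sumEFin.
Qed.

Lemma esum_le_subset_sum h (c : \bar R) :
  (forall n, (subset_sum h n)%:E <= c)%E -> (forall u, 0 <= h u) ->
  (\esum_(u in [set: {fset nat}]) (h u)%:E <= c)%E.
Proof.
move=> hc h0; apply: ge_ereal_sup => _ [F [finF _] <-].
have [n Fn] := finite_fsetsE finF; apply: le_trans (hc n).
rewrite /subset_sum -sumEFin [leRHS]fsbig_seq//.
apply: lee_fsum_nneg_subset => //; first exact/subsetP.
by move=> u _; rewrite lee_fin.
Qed.

Lemma nd_subset_sum h : (forall u, 0 <= h u) -> nondecreasing_seq (subset_sum h).
Proof.
move=> h0 n m nm; rewrite -lee_fin /subset_sum -!sumEFin.
apply: lee_sum_nneg_subfset => u; last by rewrite lee_fin.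
by rewrite !fpowersetE => /fsubset_trans; apply; exact: fiotaS.
Qed.

Lemma cvg_subset_sum_ge0 h : (forall u, 0 <= h u) ->
  (\esum_(u in [set: {fset nat}]) (h u)%:E < +oo)%E ->
  subset_sum h @ \oo --> fine (\esum_(u in [set: {fset nat}]) (h u)%:E)%E.
Proof.
move=> h0 hoo; set e := esum _ _.
have e0 : (0 <= e)%E by apply: esum_ge0 => u _; rewrite lee_fin.
have ef : e \is a fin_num by rewrite ge0_fin_numE.
have ub : ubound (range (subset_sum h)) (fine e).
  by move=> _ [n _ <-]; rewrite -lee_fin fineK//; exact: subset_sum_le_esum.
have sup_e : fine e = sup (range (subset_sum h)).
  apply/eqP; rewrite eq_le; apply/andP; split; last first.
    by apply: ge_sup => //; exists (subset_sum h 0), 0.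
  rewrite -lee_fin fineK//; apply: esum_le_subset_sum => // n.
  by rewrite lee_fin; apply: ub_le_sup; [exists (fine e)|exists n].
rewrite sup_e; apply: nondecreasing_cvgn; first exact: nd_subset_sum.
by exists (fine e).
Qed.

Lemma cvg_subset_sum h :
  (\esum_(u in [set: {fset nat}]) (`|h u|)%:E < +oo)%E ->
  subset_sum h @ \oo --> asum h.
Proof.
move=> hoo; rewrite /asum.
have sumE n : subset_sum h n = subset_sum h^\+ n - subset_sum h^\- n.
  rewrite /subset_sum -sumrB; apply: eq_bigr => u _.
  by rewrite -[h in LHS](funrposBneg h).
rewrite (_ : subset_sum h = subset_sum h^\+ \- subset_sum h^\-); last first.
  by apply/funext => n; rewrite sumE.
apply: cvgB; apply: cvg_subset_sum_ge0.
- exact: funrpos_ge0.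
- apply: le_lt_trans hoo; apply: le_esum => u _; rewrite lee_fin.
  by rewrite /funrpos ge_max ler_norm normr_ge0.
- exact: funrneg_ge0.
- apply: le_lt_trans hoo; apply: le_esum => u _; rewrite lee_fin.
  by rewrite /funrneg ge_max ler_normr lexx orbT normr_ge0.
Qed.

Definition nprod (c : nat -> R) n := \prod_(0 <= j < n) (1 + c j).

Lemma subset_sum_prod (c : nat -> R) n :
  subset_sum (fun u => \prod_(j <- u) c j) n = nprod c n.
Proof. by rewrite /subset_sum sum_fpowerset_prod big_fiota. Qed.

Lemma nprod_ge1 c n : (forall j, 0 <= c j) -> 1 <= nprod c n.
Proof.
move=> c0; rewrite /nprod; elim: n => [|n IH]; first by rewrite big_nil.
rewrite big_nat_recr//=; move: IH; rewrite -/(nprod c n); have := c0 n; nra.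
Qed.

Lemma nd_nprod c : (forall j, 0 <= c j) -> nondecreasing_seq (nprod c).
Proof.
move=> c0; apply/nondecreasing_seqP => n; rewrite /nprod big_nat_recr//= -/(nprod c n).
by have := nprod_ge1 n c0; have := c0 n; nra.
Qed.

Lemma normr_nprod c n : `|nprod c n| <= nprod (fun j => `|c j|) n.
Proof.
rewrite normr_prod; apply: ler_prod => j _; rewrite normr_ge0/=.
by apply: le_trans (ler_normD _ _) _; rewrite normr1.
Qed.

Lemma le_nprod c c' n : (forall j, 0 <= c j <= c' j) -> nprod c n <= nprod c' n.
Proof.
move=> cc'; apply: ler_prod => j _; have /andP[c0 le] := cc' j.
by rewrite addr_ge0//= lerD2l.
Qed.

Lemma nprodM c c' n : (forall j, 0 <= c j) -> (forall j, 0 <= c' j) ->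
  nprod (fun j => c j + c' j) n <= nprod c n * nprod c' n.
Proof.
move=> c0 c'0; rewrite /nprod -big_split/=; apply: ler_prod => j _.
have := c0 j; have := c'0 j; have := mulr_ge0 (c0 j) (c'0 j); nra.
Qed.

Lemma nprod_expR c n : (forall j, 0 <= c j) ->
  nprod c n <= expR (\sum_(0 <= j < n) c j).
Proof.
move=> c0; rewrite expR_sum; apply: ler_prod => j _.
by rewrite addr_ge0//= expR_ge1Dx.
Qed.

Lemma sum_le_nprod c n : (forall j, 0 <= c j) ->
  1 + \sum_(0 <= j < n) c j <= nprod c n.
Proof.
move=> c0; elim: n => [|n IH]; first by rewrite /nprod !big_nil addr0.
rewrite /nprod !big_nat_recr//= -/(nprod c n).
have := nprod_ge1 n c0; have := c0 n; nra.
Qed.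

Definition iprod (c : nat -> R) : R := limn (nprod c).

(** The summability hypotheses on the weights are used in the form on the right. *)
Lemma esum_prod_lty c : (forall j, 0 <= c j) ->
  (\esum_(u in [set: {fset nat}]) (\prod_(j <- u) c j)%:E < +oo)%E <->
  exists C, forall n, nprod c n <= C.
Proof.
move=> c0; have p0 (u : {fset nat}) : 0 <= \prod_(j <- u) c j by exact: prodr_ge0.
split=> [hoo|[C nC]].
  exists (fine (\esum_(u in [set: {fset nat}]) (\prod_(j <- u) c j)%:E)%E) => n.
  rewrite -lee_fin fineK; last first.
    by rewrite ge0_fin_numE//; apply: esum_ge0 => u _; rewrite lee_fin.
  by rewrite -subset_sum_prod; exact: subset_sum_le_esum.
apply: (@le_lt_trans _ _ C%:E); last exact: ltry.
by apply: esum_le_subset_sum => // n; rewrite subset_sum_prod lee_fin.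
Qed.

Lemma cvg_nprod c C : (forall n, nprod (fun j => `|c j|) n <= C) ->
  nprod c @ \oo --> asum (fun u : {fset nat} => \prod_(j <- u) c j).
Proof.
move=> nC; rewrite (_ : nprod c = subset_sum (fun u => \prod_(j <- u) c j)).
  apply: cvg_subset_sum.
  under eq_esum do rewrite normr_prod.
  by apply/esum_prod_lty => //; exists C.
by apply/funext => n; rewrite subset_sum_prod.
Qed.

Lemma asum_prod c C : (forall n, nprod (fun j => `|c j|) n <= C) ->
  asum (fun u : {fset nat} => \prod_(j <- u) c j) = iprod c.
Proof. by move=> /cvg_nprod/cvg_lim <-. Qed.

Lemma cvg_iprod c C : (forall n, nprod (fun j => `|c j|) n <= C) ->
  nprod c @ \oo --> iprod c.
Proof. by move=> nC; rewrite -(asum_prod nC); exact: cvg_nprod nC. Qed.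

Lemma iprod_ge c C n : (forall j, 0 <= c j) -> (forall n, nprod c n <= C) ->
  nprod c n <= iprod c.
Proof.
move=> c0 nC; apply: nondecreasing_cvgn_le; first exact: nd_nprod.
apply/cvg_ex; exists (iprod c); apply: cvg_iprod (C) _ => m.
by rewrite (_ : (fun j => `|c j|) = c)//; apply/funext => j; rewrite ger0_norm.
Qed.

End subset_sums.

(** * The tensor product space *)

(* The weights enter through the factors [g] of their product form. *)
Record setting (R : realType) d (D : measurableType d) := Setting {
  rho : probability D R ;
  mu : probability (prod_space nat D) R ;
  mu_prod : is_product_measure rho mu ;
  k : D -> D -> R ;
  Hk : rkhs k ;
  k_meas : measurable_fun setT (fun p : D * D => k p.1 p.2) ;
  k_int : (\int[rho]_x (k x x)%:E < +oo)%E ;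
  k_mean0 : forall y, (\int[rho]_x (k x y)%:E = 0)%E ;
  k_diag : forall x, 0 < k x x ;
  g : nat -> R ;
  g_ge0 : forall j, 0 <= g j ;
  gamma_sum : (\esum_(u in [set: {fset nat}])
     ((\prod_(j <- u) g j)%:E * (\int[rho]_x (k x x)%:E) ^+ #|` u|) < +oo)%E ;
  a : D ;
  a_sum : (\esum_(u in [set: {fset nat}])
     ((\prod_(j <- u) g j) * k a a ^+ #|` u|)%:E < +oo)%E ;
  H : forall u : {fset nat}, rkhs (kern k u) ;
  HK : rkhs (@Kkern R D k (fun u => \prod_(j <- u) g j)) }.

Section setting_theory.
Context (R : realType) d (D : measurableType d) (S : setting R D).
Local Notation rho := (rho S).
Local Notation k := (k S).
Local Notation g := (g S).
Local Notation a := (a S).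

Definition gam (u : {fset nat}) : R := \prod_(j <- u) g j.
Definition XX : set (nat -> D) := frakX k gam.
Definition kap : R := k a a.
Definition kint : R := \int[rho]_x k x x.

Lemma kap_gt0 : 0 < kap. Proof. exact: k_diag. Qed.

Lemma k_sym x y : k x y = k y x. Proof. exact: (kernel_sym (Hk S)). Qed.

Lemma k_ge0 x : 0 <= k x x. Proof. exact/ltW/k_diag. Qed.

Lemma measurable_ksec y : measurable_fun setT (fun x => k x y).
Proof.
by apply: (measurableT_comp (@k_meas _ _ _ S) (f := fun p => _) (g := fun x => (x, y))); exact: measurable_fun_pair.
Qed.

Lemma measurable_kdiag : measurable_fun setT (fun x => k x x).
Proof.
by apply: (measurableT_comp (@k_meas _ _ _ S) (f := fun p => _) (g := fun x => (x, x))); exact: measurable_fun_pair.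
Qed.

Lemma integrable_kdiag : rho.-integrable setT (fun x => (k x x)%:E).
Proof.
apply/integrableP; split; first by apply/measurable_EFinP; exact: measurable_kdiag.
under eq_integral => x _ do rewrite gee0_abs ?lee_fin ?k_ge0//.
exact: k_int.
Qed.

Lemma kintE : (\int[rho]_x (k x x)%:E = kint%:E)%E.
Proof. by rewrite /kint /Rintegral fineK// integrable_fin_num// integrable_kdiag. Qed.

Lemma kint_ge0 : 0 <= kint.
Proof. by apply: Rintegral_ge0 => x _; exact: k_ge0. Qed.

Lemma integrable_ksec y : rho.-integrable setT (fun x => (k x y)%:E).
Proof.
apply: (@le_integrable _ _ _ _ _ _ _ (fun x => ((k x x)%:E + (k y y)%:E)%E)) => //.
- by apply/measurable_EFinP; exact: measurable_ksec.
- move=> x _ /=; rewrite lee_fin.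
  apply: le_trans (kernel_le_half (Hk S) x y) _.
  apply: le_trans (ler_norm _); have := k_ge0 x; have := k_ge0 y; lra.
- apply: integrableD => //; first exact: integrable_kdiag.
  exact: finite_measure_integrable_cst.
Qed.

(** If [D] were the single point [a], the mean of [k(., a)] would be [k(a, a) > 0]. Such a point
    replaces sampled coordinates that hit the anchor. *)
Lemma exists_neq_a : exists b : D, b <> a.
Proof.
apply: contrapT => /forallNP na; have {}na x : x = a by apply: contrapT; exact: na.
have := k_mean0 S a; rewrite (eq_integral (cst (k a a)%:E)); last first.
  by move=> x _; rewrite (na x).
rewrite integral_cst// [X in (_ * X)%E](_ : _ = 1%E) ?mule1; last exact: probability_setT.
case.
by apply/eqP; rewrite gt_eqF//; exact: k_diag.
Qed.

Definition diag_seq (x : nat -> D) j : R := g j * k (x j) (x j).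

Lemma diag_seq_ge0 x j : 0 <= diag_seq x j.
Proof. by rewrite mulr_ge0 ?g_ge0 ?k_ge0. Qed.

Lemma gam_kern u x y : gam u * kern k u x y = \prod_(j <- u) (g j * k (x j) (y j)).
Proof. by rewrite /gam /kern -big_split. Qed.

Lemma XXP x : XX x <-> exists C, forall n, nprod (diag_seq x) n <= C.
Proof.
rewrite -esum_prod_lty; last exact: diag_seq_ge0.
by rewrite /XX /frakX /=; under eq_esum do rewrite gam_kern.
Qed.

Lemma aXX : XX (fun=> a).
Proof.
rewrite /XX /frakX /=; apply: le_lt_trans (a_sum S); apply: le_esum => u _.
rewrite lee_fin /kern big_const_seq count_predT iter_mulr_1; exact: lexx.
Qed.

Lemma kint_bound : exists C, forall n, nprod (fun j => g j * kint) n <= C.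
Proof.
apply/esum_prod_lty => [j|]; first by rewrite mulr_ge0 ?g_ge0 ?kint_ge0.
apply: le_lt_trans (gamma_sum S); apply: le_esum => u _.
rewrite kintE -EFin_expe -EFinM lee_fin big_split /=.
by rewrite [X in _ * X <= _]big_const_seq count_predT iter_mulr_1.
Qed.

(** A predicate instead of a finite set, so that [predT], and with it the integral, is covered by
    the same theory as the finite truncations. *)
Definition trunc (v : pred nat) (x : nat -> D) : nat -> D :=
  fun j => if v j then x j else a.

Lemma XX_trunc v x : XX x -> XX (trunc v x).
Proof.
move=> /XXP[C xC]; have /XXP[C' aC'] := aXX; apply/XXP; exists (C * C') => n.
have x0 := diag_seq_ge0 x; have a0 := diag_seq_ge0 (fun=> a).
apply: (@le_trans _ _ (nprod (fun j => diag_seq x j + diag_seq (fun=> a) j) n)).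
  apply: le_nprod => j; rewrite diag_seq_ge0 /=.
  rewrite {1}/diag_seq /trunc; case: ifP => _.
    by rewrite -/(diag_seq x j) lerDl.
  by rewrite -/(diag_seq (fun=> a) j) lerDr.
apply: le_trans (nprodM _ x0 a0) _.
by apply: ler_pM => //; apply: le_trans (nprod_ge1 _ _).
Qed.

(** Here [x] is arbitrary: only finitely many of its coordinates survive, and the anchor controls
    the others. *)
Lemma XX_trunc_fin (u : {fset nat}) x : XX (trunc (fun j => j \in u) x).
Proof.
have [N uN] := fset_sub_fiota u.
have /XXP[C aC] := aXX; pose c j := if j \in u then diag_seq x j else 0.
have c0 j : 0 <= c j by rewrite /c; case: ifP => // _; exact: diag_seq_ge0.
have a0 := diag_seq_ge0 (fun=> a).
have cN n : nprod c n <= nprod c N.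
  have [nN|/ltnW Nn] := leqP n N; first exact: nd_nprod.
  rewrite -(subnKC Nn); elim: (n - N)%N => [|m IH]; first by rewrite addn0.
  rewrite addnS /nprod big_nat_recr//= -/(nprod _ _) /c ifN ?addr0 ?mulr1//.
  by apply: contraTN (leq_addr m N) => /(fsubsetP uN); rewrite in_fiota -ltnNge.
apply/XXP; exists (nprod c N * C) => n.
apply: (@le_trans _ _ (nprod (fun j => c j + diag_seq (fun=> a) j) n)).
  apply: le_nprod => j; rewrite diag_seq_ge0 /=.
  rewrite {1}/diag_seq /trunc /c; case: ifP => ju; last by rewrite add0r.
  by rewrite -/(diag_seq x j) lerDl.
apply: le_trans (nprodM _ c0 a0) _.
by apply: ler_pM => //; apply: le_trans (nprod_ge1 _ _).
Qed.

(** The selection [w] is present because the representer of [L v] is a partial kernel product, over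
    the coordinates outside [v], and has to be integrated in its turn. *)
Definition kseq (w : pred nat) (x y : nat -> D) j : R :=
  if w j then g j * k (x j) (y j) else 0.

Lemma kseq_bound w x y : XX x -> XX y ->
  exists C, forall n, nprod (fun j => `|kseq w x y j|) n <= C.
Proof.
move=> /XXP[C xC] /XXP[C' yC']; exists (C * C') => n.
have x0 := diag_seq_ge0 x; have y0 := diag_seq_ge0 y.
apply: (@le_trans _ _ (nprod (fun j => diag_seq x j + diag_seq y j) n)).
  apply: le_nprod => j; rewrite normr_ge0 /= /kseq; case: ifP => _; last first.
    by rewrite normr0 addr_ge0.
  rewrite normrM (ger0_norm (g_ge0 S j)) -mulrDr ler_wpM2l ?g_ge0//.
  apply: le_trans (kernel_le_half (Hk S) _ _) _.
  have := k_ge0 (x j); have := k_ge0 (y j); lra.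
apply: le_trans (nprodM _ x0 y0) _.
by apply: ler_pM => //; apply: le_trans (nprod_ge1 _ _).
Qed.

Definition kprod w x y : R := iprod (kseq w x y).

Lemma cvg_kprod w x y : XX x -> XX y -> nprod (kseq w x y) @ \oo --> kprod w x y.
Proof. by move=> xX yX; have [C] := kseq_bound w xX yX; exact: cvg_iprod. Qed.

Lemma KkernE (x y : XX) : Kkern x y = kprod predT (\val x) (\val y).
Proof.
have xX : XX (\val x) by apply: set_mem (valP x).
have yX : XX (\val y) by apply: set_mem (valP y).
have -> : Kkern x y = asum (fun u : {fset nat} => \prod_(j <- u) kseq predT (\val x) (\val y) j).
  by congr asum; apply/funext => u; rewrite gam_kern.
by have [C] := kseq_bound predT xX yX; exact: asum_prod.
Qed.

End setting_theory.

(** * Measurability on the sequence space and integrability of the kernel diagonal *)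

Section functionals.
Context (R : realType) d (D : measurableType d) (S : setting R D).
Local Notation rho := (rho S).
Local Notation mu := (mu S).
Local Notation k := (k S).
Local Notation g := (g S).
Local Notation a := (a S).
Local Notation XX := (XX S).
Local Notation Omega := (prod_space nat D).

Lemma measurable_nprod d' (T : measurableType d') (c : T -> nat -> R) n :
  (forall j, measurable_fun setT (c ^~ j)) ->
  measurable_fun setT (fun x => nprod (c x) n).
Proof.
move=> mc; rewrite /nprod; elim: n => [|n IH].
  by under eq_fun do rewrite big_nil; exact: measurable_cst.
under eq_fun do rewrite big_nat_recr//=.
by apply: measurable_funM => //; apply: measurable_funD => //; exact: measurable_cst.
Qed.

Lemma measurable_diag_seq j : measurable_fun setT (fun x : Omega => diag_seq S x j).
Proof.
apply: measurable_funM; first exact: measurable_cst.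
by apply: measurableT_comp (measurable_kdiag S) _; exact: measurable_coord.
Qed.

Lemma measurable_XX : measurable (XX : set Omega).
Proof.
rewrite (_ : XX = \bigcup_(C : nat) \bigcap_(n : nat)
    [set x : Omega | nprod (diag_seq S x) n <= C%:R]); last first.
  apply/seteqP; split => x /=; rewrite (XXP S).
    move=> [C xC]; exists (Num.truncn C).+1 => // n _ /=.
    by apply: le_trans (xC n) _; exact/ltW/truncnS_gt.
  by move=> [C _ xC]; exists C%:R => n; exact: xC.
apply: bigcup_measurable => C _; apply: bigcap_measurable => // n _.
rewrite -[X in measurable X]setTI; apply: measurable_fun_le => //.
apply: measurable_nprod; exact: measurable_diag_seq.
Qed.

Lemma integral_nprod (c : nat -> D -> R) n :
  (forall j, rho.-integrable setT (EFin \o c j)) ->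
  mu.-integrable setT (fun x : Omega => (nprod (fun j => c j (x j)) n)%:E) /\
  (\int[mu]_x (nprod (fun j => c j (x j)) n)%:E =
   (nprod (fun j => \int[rho]_x c j x) n)%:E)%E.
Proof.
move=> ic; have i1 j : rho.-integrable setT (EFin \o (fun x => 1 + c j x)).
  rewrite (_ : _ \o _ = (EFin \o cst 1) \+ (EFin \o c j)); last first.
    by apply/funext.
  by apply: integrableD => //; exact: finite_measure_integrable_cst.
have un : uniq (index_iota 0 n) by exact: iota_uniq.
split; first exact: (integrable_prod (mu_prod S) (g := fun j x => 1 + c j x) un i1).
rewrite (integral_prod (mu_prod S) (g := fun j x => 1 + c j x) un i1).
rewrite /nprod -prodEFin; apply: eq_bigr => j _.
under eq_integral do rewrite EFinD.
rewrite integralD//.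
rewrite integral_cst// [X in (_ * X + _)%E](_ : _ = 1%E); last exact: probability_setT.
by rewrite mule1 /Rintegral EFinD fineK//; apply: integrable_fin_num => //; exact: ic.
exact: (@finite_measure_integrable_cst _ _ _ rho setT 1).
exact: ic.
Qed.

Lemma integrable_diag c : rho.-integrable setT (EFin \o (fun x => c * k x x)).
Proof.
rewrite (_ : _ \o _ = (fun x => c%:E * (k x x)%:E)%E); last by apply/funext.
by apply: integrableZl => //; exact: integrable_kdiag.
Qed.

(** Extended-valued, hence a monotone limit on the whole sequence space. [XX] is the set where it is
    finite, and its integrability gives [XX] full measure and supplies the dominating functions. *)
Definition Kdiag (x : nat -> D) : \bar R := limn (fun n => (nprod (diag_seq S x) n)%:E).

Lemma Kdiag_cvg x : (fun n => (nprod (diag_seq S x) n)%:E) @ \oo --> Kdiag x.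
Proof.
apply: ereal_nondecreasing_is_cvgn => n m nm; rewrite lee_fin.
by apply: nd_nprod => // j; exact: diag_seq_ge0.
Qed.

Lemma nprod_le_Kdiag x n : ((nprod (diag_seq S x) n)%:E <= Kdiag x)%E.
Proof.
apply: lime_ge; first exact: Kdiag_cvg.
exists n => // m nm; rewrite /= lee_fin.
by apply: nd_nprod => // j; exact: diag_seq_ge0.
Qed.

Lemma measurable_Kdiag : measurable_fun setT (Kdiag : Omega -> \bar R).
Proof.
apply: (emeasurable_fun_cvg (fun n (x : Omega) => (nprod (diag_seq S x) n)%:E)).
  move=> n; apply/measurable_EFinP; apply: measurable_nprod.
  exact: measurable_diag_seq.
by move=> x _; exact: Kdiag_cvg.
Qed.

Lemma integral_Kdiag : (\int[mu]_x Kdiag x < +oo)%E.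
Proof.
rewrite monotone_convergence//.
- have [C kC] := kint_bound S.
  apply: (@le_lt_trans _ _ C%:E); last exact: ltry.
  apply: lime_le.
    apply: ereal_nondecreasing_is_cvgn => n m nm; apply: ge0_le_integral => //.
    + by move=> x _; rewrite lee_fin (le_trans _ (nprod_ge1 _ _))// => j; exact: diag_seq_ge0.
    + by apply/measurable_EFinP; apply: measurable_nprod; exact: measurable_diag_seq.
    + by apply/measurable_EFinP; apply: measurable_nprod; exact: measurable_diag_seq.
    + by move=> x _; rewrite lee_fin nd_nprod// => j; exact: diag_seq_ge0.
  apply: nearW => n.
  have [_ ->] := @integral_nprod (fun j x => g j * k x x) n (fun j => integrable_diag (g j)).
  rewrite lee_fin; apply: le_trans (kC n); rewrite le_eqVlt; apply/orP; left; apply/eqP.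
  by apply: eq_bigr => j _; rewrite RintegralZl//; exact: integrable_kdiag.
- by move=> n; apply/measurable_EFinP; apply: measurable_nprod; exact: measurable_diag_seq.
- by move=> n x _; rewrite lee_fin (le_trans _ (nprod_ge1 _ _))// => j; exact: diag_seq_ge0.
- by move=> x _ n m nm; rewrite lee_fin nd_nprod// => j; exact: diag_seq_ge0.
Qed.

Lemma Kdiag_ge0 x : (0 <= Kdiag x)%E.
Proof.
apply: le_trans (nprod_le_Kdiag x 0); rewrite lee_fin.
by apply: le_trans (nprod_ge1 _ _) => // j; exact: diag_seq_ge0.
Qed.

Lemma integrable_Kdiag : mu.-integrable setT (Kdiag : Omega -> \bar R).
Proof.
apply/integrableP; split; first exact: measurable_Kdiag.
by under eq_integral => x _ do rewrite gee0_abs ?Kdiag_ge0//; exact: integral_Kdiag.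
Qed.

Lemma XX_Kdiag x : XX x <-> Kdiag x \is a fin_num.
Proof.
rewrite (XXP S); split=> [[C xC]|xf].
  rewrite ge0_fin_numE ?Kdiag_ge0//; apply: (@le_lt_trans _ _ C%:E); last exact: ltry.
  by apply: lime_le; [exact: Kdiag_cvg|apply: nearW => n; rewrite lee_fin].
by exists (fine (Kdiag x)) => n; rewrite -lee_fin fineK//; exact: nprod_le_Kdiag.
Qed.

Lemma mu_setC_XX : mu (~` XX) = 0%E.
Proof.
have [A [mA A0 sA]] := integrable_ae measurableT integrable_Kdiag.
apply/eqP; rewrite eq_le measure_ge0 andbT -A0; apply: le_measure; rewrite ?inE//.
  by apply: measurableC; exact: measurable_XX.
move=> x /= nX; apply: sA => xf; apply: nX; apply/XX_Kdiag; exact: xf.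
Qed.

Lemma integral_XX (f : Omega -> \bar R) : mu.-integrable setT f ->
  (\int[mu]_(x in XX) f x = \int[mu]_x f x)%E.
Proof.
move=> f_int; rewrite [RHS](negligible_integral _ measurableT _ mu_setC_XX)//.
- by rewrite setTD setCK.
- by apply: measurableC; exact: measurable_XX.
Qed.

Lemma mu_XX : mu XX = 1%E.
Proof.
have := integral_XX (finite_measure_integrable_cst mu 1 measurableT).
rewrite /= (integral_cst mu measurable_XX) (integral_cst mu measurableT) !mul1e => ->.
exact: probability_setT.
Qed.

Lemma KdiagE x : XX x -> Kdiag x = (kprod S predT x x)%:E.
Proof.
move=> xX; apply/cvg_lim => //; apply: cvg_EFin; first exact: nearW.
exact: (cvg_kprod (w := predT) xX xX).
Qed.

Lemma Kdiag_trunc v : exists2 C, 0 <= C & forall x, XX x ->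
  kprod S predT (trunc S v x) (trunc S v x) <= C * kprod S predT x x.
Proof.
have a0 := diag_seq_ge0 S (fun=> a).
have aX := aXX S; have /XXP[C aC] := aX; exists C.
  by apply: le_trans (aC 0); apply: le_trans (nprod_ge1 _ _).
move=> x xX; have x0 := diag_seq_ge0 S x.
apply: limr_le; first by apply/cvg_ex; eexists; apply: cvg_kprod; exact: XX_trunc.
apply: nearW => n.
apply: (@le_trans _ _ (nprod (fun j => diag_seq S (fun=> a) j + diag_seq S x j) n)).
  apply: le_nprod => j; rewrite [kseq _ _ _ _ _]/(diag_seq S (trunc S v x) j).
  rewrite diag_seq_ge0 /= {1}/diag_seq /trunc; case: ifP => _.
    by rewrite -/(diag_seq S x j) lerDr mulr_ge0 ?g_ge0 ?k_ge0.
  by rewrite lerDl diag_seq_ge0.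
apply: le_trans (nprodM _ a0 x0) _; apply: ler_pM => //.
- by apply: le_trans (nprod_ge1 _ _).
- by apply: le_trans (nprod_ge1 _ _).
- rewrite -lee_fin -KdiagE//; exact: nprod_le_Kdiag.
Qed.

End functionals.

Section representers.
Context (R : realType) d (D : measurableType d) (S : setting R D).
Local Notation rho := (rho S).
Local Notation mu := (mu S).
Local Notation k := (k S).
Local Notation g := (g S).
Local Notation a := (a S).
Local Notation HK := (HK S).
Local Notation XX := (XX S).
Local Notation ip := (rkhs_ip HK).
Local Notation Omega := (prod_space nat D).

Definition apt : XX := exist _ (fun=> a) (mem_set (aXX S)).

(* A point outside [XX] becomes the anchor. *)
Definition pt (x : nat -> D) : XX := insubd apt x.

Lemma val_pt x : \val (pt x) = if x \in XX then x else (fun=> a).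
Proof. exact: val_insubd. Qed.

Lemma pt_id x : XX x -> \val (pt x) = x.
Proof. by move=> xX; rewrite val_pt mem_set. Qed.

Lemma XX_val (x : XX) : XX (\val x). Proof. exact: set_mem (valP x). Qed.

Lemma measurable_trunc v : measurable_fun setT (trunc S v : Omega -> Omega).
Proof.
apply: measurable_prod_space => j; rewrite /trunc; case: (v j) => /=.
  exact: measurable_coord.
exact: measurable_cst.
Qed.

Lemma measurable_val_pt : measurable_fun setT (fun x : Omega => \val (pt x) : Omega).
Proof.
apply: measurable_prod_space => j.
rewrite (_ : (fun x => _) = (fun x : Omega => if x \in XX then x j else a)); last first.
  by apply/funext => x; rewrite val_pt; case: ifP.
apply: measurable_fun_if => //.
- apply: (@measurable_fun_bool _ _ _ _ true).
  rewrite setTI (_ : _ @^-1` _ = XX); first exact: measurable_XX.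
  by apply/seteqP; split => x /=; [exact: set_mem|exact: mem_set].
- by apply: measurable_funTS; exact: measurable_coord.
Qed.

Lemma measurable_kseq w (phi : Omega -> Omega) z j : measurable_fun setT phi ->
  measurable_fun setT (fun x => kseq S w (phi x) z j).
Proof.
move=> mphi; rewrite /kseq; case: (w j); last exact: measurable_cst.
apply: measurable_funM; first exact: measurable_cst.
apply: measurableT_comp (measurable_ksec S (z j)) _.
exact: (measurableT_comp (measurable_coord j) mphi).
Qed.

Lemma measurable_HK v f : HK f ->
  measurable_fun setT (fun x : Omega => f (pt (trunc S v x))).
Proof.
move=> Hf; apply: (@rkhs_measurable _ _ _ HK _ _ (fun x : Omega => pt (trunc S v x))) => // y.
rewrite (_ : (fun x => _) =
    (fun x : Omega => kprod S predT (\val (pt (trunc S v x))) (\val y))); last first.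
  by apply/funext => x; exact: KkernE.
apply: (measurable_fun_cvg (h := fun n (x : Omega) =>
  nprod (kseq S predT (\val (pt (trunc S v x))) (\val y)) n)).
  move=> n; apply: measurable_nprod => j.
  apply: (@measurable_kseq predT (fun x => \val (pt (trunc S v x)))).
  exact: measurableT_comp measurable_val_pt (measurable_trunc v).
by move=> x _; apply: cvg_kprod; exact: XX_val.
Qed.

Lemma kprod_ge1 x : XX x -> 1 <= kprod S predT x x.
Proof.
move=> xX; rewrite -lee_fin -KdiagE//; apply: le_trans (nprod_le_Kdiag S x 0).
by rewrite lee_fin nprod_ge1// => j; exact: diag_seq_ge0.
Qed.

(** The reproducing property bounds [|f x|] with the square root of [K(x, x)]. As [K(x, x) >= 1],
    the diagonal itself may stand there, and its integrability is known. *)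
Lemma HK_bound f x : HK f ->
  `|f x| <= Num.sqrt (ip f f) * kprod S predT (\val x) (\val x).
Proof.
move=> Hf; have f0 := rkhs_ip_ge0 Hf; have K1 := kprod_ge1 (XX_val x).
rewrite -(@ler_pXn2r _ 2)// ?nnegrE ?mulr_ge0 ?sqrtr_ge0 ?(le_trans ler01)//.
rewrite exprMn sqr_sqrtr// real_normK ?num_real//.
apply: le_trans (rkhs_eval_bound x Hf) _; rewrite KkernE.
by apply: ler_wpM2l => //; rewrite expr2 ler_peMl// (le_trans ler01).
Qed.

Definition Kint : R := \int[mu]_(x in XX) kprod S predT x x.

Lemma integrable_kprod : mu.-integrable XX (fun x : Omega => (kprod S predT x x)%:E).
Proof.
apply: (@eq_integrable _ _ _ _ _ (measurable_XX S) (Kdiag S)) => [x|].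
  by rewrite inE => /KdiagE.
by apply: integrableS (integrable_Kdiag S) => //; exact: measurable_XX.
Qed.

Lemma HK_trunc_bound v : exists2 C, 0 <= C & forall f, HK f -> forall x, XX x ->
  `|f (pt (trunc S v x))| <= Num.sqrt (ip f f) * C * kprod S predT x x.
Proof.
have [C C0 tC] := Kdiag_trunc S v; exists C => // f Hf x xX.
apply: le_trans (HK_bound _ Hf) _; rewrite -mulrA ler_wpM2l ?sqrtr_ge0//.
by rewrite pt_id; [exact: tC|exact: XX_trunc].
Qed.

Lemma integrable_HK v f : HK f ->
  mu.-integrable XX (fun x : Omega => (f (pt (trunc S v x)))%:E).
Proof.
move=> Hf; have [C C0 fC] := HK_trunc_bound v.
apply: (le_integrable (measurable_XX S) (g := fun x : Omega =>
  ((Num.sqrt (ip f f) * C)%:E * (kprod S predT x x)%:E)%E)).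
- by apply/measurable_EFinP; apply: measurable_funTS; exact: measurable_HK.
- move=> x xX /=; rewrite lee_fin; apply: le_trans (fC f Hf x xX) _.
  exact: ler_norm.
- by apply: integrableZl; [exact: measurable_XX|exact: integrable_kprod].
Qed.

(* The coordinates in [v] are integrated out, the others are set to the anchor;
   [v = predT] gives the integral itself. *)
Definition L (v : pred nat) (f : XX -> R) : R :=
  \int[mu]_(x in XX) f (pt (trunc S v x)).

Lemma L_lin v b f h : HK f -> HK h -> L v (fun x => b * f x + h x) = b * L v f + L v h.
Proof.
move=> Hf Hh; have mX := measurable_XX S; rewrite /L RintegralD//; first last.
- exact: integrable_HK.
- rewrite (_ : _ \o _ = (fun x => b%:E * (f (pt (trunc S v x)))%:E)%E)//.
  by apply: integrableZl => //; exact: integrable_HK.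
by rewrite RintegralZl//; exact: integrable_HK.
Qed.

Lemma L_bound v : exists2 c, 0 <= c & forall f, HK f -> L v f ^+ 2 <= c * ip f f.
Proof.
have [C C0 fC] := HK_trunc_bound v; exists ((C * Kint) ^+ 2); first exact: sqr_ge0.
have mX := measurable_XX S.
have K0 : 0 <= Kint.
  by apply: Rintegral_ge0 => x xX; apply: le_trans (kprod_ge1 xX).
move=> f Hf; rewrite -(sqr_sqrtr (rkhs_ip_ge0 Hf)) -exprMn -real_normK ?num_real//.
rewrite ler_pXn2r ?nnegrE ?mulr_ge0 ?sqrtr_ge0//.
apply: le_trans (le_normr_Rintegral mX (integrable_HK v Hf)) _.
rewrite mulrC mulrA /Kint -RintegralZl//; last exact: integrable_kprod.
apply: le_Rintegral => //.
- by apply: integrable_norm; exact: integrable_HK.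
- rewrite (_ : _ \o _ = (fun x : Omega => (Num.sqrt (ip f f) * C)%:E * (kprod S predT x x)%:E)%E)//.
  by apply: integrableZl => //; exact: integrable_kprod.
- by move=> x xX; exact: fC.
Qed.

Lemma I_muE f : I_mu mu f = L predT f.
Proof.
rewrite /I_mu /L; apply: eq_Rintegral => x; rewrite inE => xX.
rewrite (_ : trunc S predT x = x); last exact/funext.
rewrite -[x in LHS](pt_id xX); exact: (congr1 (fun h : XX -> R => h (pt x)) (valLK 0 f)).
Qed.

Definition tprod (w : pred nat) (z : nat -> D) : R :=
  iprod (fun j => if w j then g j * k a (z j) else 0).

(** A coordinate in [v] is integrated and contributes [1] because [k] has mean zero; a coordinate of
    [w] outside [v] is frozen at the anchor. The passage from finite products is by dominated
    convergence. *)
Lemma integral_kprod v w z : XX z ->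
  \int[mu]_(x in XX) kprod S w (trunc S v x) z = tprod [pred j | w j & ~~ v j] z.
Proof.
move=> zX; have mX := measurable_XX S.
have /XXP[Ca aC] := aXX S; have /XXP[Cz zC] := zX.
have a0 := diag_seq_ge0 S (fun=> a); have z0 := diag_seq_ge0 S z.
pose f_ n (x : Omega) := nprod (kseq S w (trunc S v x) z) n.
(* Each factor is at most [1] plus the sum of the diagonal terms of the anchor, of [z] and of [x],
   whichever argument the truncation selects. *)
have fb n x : XX x -> `|f_ n x| <= Ca * Cz * kprod S predT x x.
  move=> xX; have x0 := diag_seq_ge0 S x; apply: le_trans (normr_nprod _ _) _.
  apply: (@le_trans _ _ (nprod (fun j => (diag_seq S (fun=> a) j + diag_seq S z j) + diag_seq S x j) n)).
    apply: le_nprod => j; rewrite normr_ge0 /= /kseq; case: ifP => _; last first.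
      by rewrite normr0 !addr_ge0.
    rewrite normrM (ger0_norm (g_ge0 S j)) -!mulrDr ler_wpM2l ?g_ge0//.
    apply: le_trans (kernel_le_half (Hk S) _ _) _; rewrite /trunc.
    have := k_ge0 S (x j); have := k_ge0 S (z j); have := k_ge0 S a.
    by case: ifP => _; lra.
  have az0 j : 0 <= diag_seq S (fun=> a) j + diag_seq S z j by rewrite addr_ge0.
  apply: le_trans (nprodM _ az0 x0) _; apply: ler_pM.
  - by apply: le_trans (nprod_ge1 _ _).
  - by apply: le_trans (nprod_ge1 _ _).
  - apply: le_trans (nprodM _ a0 z0) _; apply: ler_pM => //.
      by apply: le_trans (nprod_ge1 _ _).
    by apply: le_trans (nprod_ge1 _ _).
  - rewrite -lee_fin -KdiagE//; exact: nprod_le_Kdiag.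
pose c j x := if w j then g j * k (if v j then x else a) (z j) else 0.
have ic j : rho.-integrable setT (EFin \o c j).
  rewrite /c; case: (w j); last exact: finite_measure_integrable_cst.
  case: (v j); last exact: finite_measure_integrable_cst.
  rewrite (_ : _ \o _ = (fun x => (g j)%:E * (k x (z j))%:E)%E)//.
  by apply: integrableZl => //; exact: integrable_ksec.
have intc j : \int[rho]_x c j x = if w j && ~~ v j then g j * k a (z j) else 0.
  rewrite /c; case: (w j) => /=; last by rewrite Rintegral_cst// mul0r.
  case: (v j) => /=; last first.
    rewrite Rintegral_cst// [X in fine X](_ : _ = 1%E) ?mulr1//.
    exact: probability_setT.
  rewrite RintegralZl//; last exact: integrable_ksec.
  by rewrite /Rintegral (k_mean0 S) mulr0.
have fE n (x : Omega) : f_ n x = nprod (fun j => c j (x j)) n by [].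
have intf n : (\int[mu]_(x in XX) (f_ n x)%:E =
    (nprod (fun j => if w j && ~~ v j then g j * k a (z j) else 0) n)%:E)%E.
  have [i_f int_f] := integral_nprod n ic.
  rewrite (integral_XX i_f) int_f; congr (nprod _ _)%:E; exact/funext.
pose fb_ (x : Omega) := ((Ca * Cz)%:E * (kprod S predT x x)%:E)%E.
have mf n : measurable_fun (XX : set Omega) (fun x : Omega => (f_ n x)%:E).
  apply/measurable_EFinP; apply: measurable_funTS.
  by apply: measurable_nprod => j; apply: measurable_kseq; exact: measurable_trunc.
have f_f x : XX x -> f_ ^~ x @ \oo --> kprod S w (trunc S v x) z.
  by move=> xX; apply: cvg_kprod => //; exact: XX_trunc.
have mK : measurable_fun (XX : set Omega) (fun x : Omega => (kprod S w (trunc S v x) z)%:E).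
  apply/measurable_EFinP; apply: (measurable_fun_cvg (h := f_)) => // n.
  by move/measurable_EFinP: (mf n).
have [|||iK _ f_cvg] := @dominated_convergence _ _ _ mu XX mX
    (fun n x => (f_ n x)%:E) _ fb_ mf mK.
- apply: aeW => x xX; apply: cvg_EFin; first exact: nearW.
  exact: f_f.
- by apply: integrableZl => //; exact: integrable_kprod.
- by apply: aeW => x xX n; rewrite /fb_ -EFinM lee_fin; exact: fb.
rewrite /tprod /iprod /Rintegral; apply/esym/cvg_lim => //.
have iKf := integrable_fin_num mX iK.
set l := fine _; have lE : (\int[mu]_(x in XX) (kprod S w (trunc S v x) z)%:E)%E = l%:E.
  by rewrite /l fineK.
rewrite lE in f_cvg; have {}f_cvg := fine_cvg f_cvg.
have e : nprod (fun j => if w j && ~~ v j then g j * k a (z j) else 0) =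
    fine \o (fun n => \int[mu]_(x in XX) (f_ n x)%:E)%E.
  by apply/funext => n /=; rewrite intf.
rewrite (_ : nprod _ = fine \o (fun n => \int[mu]_(x in XX) (f_ n x)%:E)%E).
  exact: f_cvg.
exact: e.
Qed.

End representers.

(** * Representers and the bias of linear algorithms *)

Lemma cvg_sumr (R : realType) (I : Type) (s : seq I) (F : I -> nat -> R) (l : I -> R) :
  (forall i, F i @ \oo --> l i) ->
  (fun n => \sum_(i <- s) F i n) @ \oo --> \sum_(i <- s) l i.
Proof.
move=> Fl; elim: s => [|i s IHs].
  by rewrite big_nil; under eq_fun do rewrite big_nil; exact: cvg_cst.
by rewrite big_cons; under eq_fun do rewrite big_cons; exact: cvgD.
Qed.

Section bias.
Context (R : realType) d (D : measurableType d) (S : setting R D).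
Local Notation mu := (mu S).
Local Notation k := (k S).
Local Notation g := (g S).
Local Notation a := (a S).
Local Notation HK := (HK S).
Local Notation XX := (XX S).
Local Notation ip := (rkhs_ip HK).

Definition ghat j := g j * k a a.

Lemma ghat_ge0 j : 0 <= ghat j.
Proof. by rewrite mulr_ge0 ?g_ge0// k_ge0. Qed.

Lemma ghat_bound : exists C, forall n, nprod ghat n <= C.
Proof. by have /XXP := aXX S. Qed.

Definition tail (w : pred nat) : R := iprod (fun j => if w j then ghat j else 0).

Lemma cvg_tail w : nprod (fun j => if w j then ghat j else 0) @ \oo --> tail w.
Proof.
have [C aC] := ghat_bound; apply: (@cvg_iprod _ _ C) => n.
apply: le_trans (aC n); apply: le_nprod => j.
by rewrite normr_ge0/=; case: ifP; rewrite ?normr0 ?ghat_ge0// ger0_norm// ghat_ge0.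
Qed.

Lemma eq_tail w w' : w =1 w' -> tail w = tail w'.
Proof. by move=> ww'; congr tail; apply/funext. Qed.

Lemma tail_pred0 : tail pred0 = 1.
Proof.
apply/cvg_lim => //; apply: cvg_near_cst; apply: nearW => n.
by rewrite /nprod big1// => j _; rewrite addr0.
Qed.

Lemma rep_exists v : exists r, HK r /\ forall f, HK f -> ip f r = L v f.
Proof.
have [c c0 Lc] := L_bound S v.
have [r [Hr _ rE]] := rkhs_functional c0 (L_lin v) Lc.
by exists r.
Qed.

Definition rep v : XX -> R := sval (cid (rep_exists v)).

Lemma HK_rep v : HK (rep v). Proof. exact: (svalP (cid (rep_exists v))).1. Qed.

Lemma ip_rep v f : HK f -> ip f (rep v) = L v f.
Proof. exact: (svalP (cid (rep_exists v))).2. Qed.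

Lemma repE v z : rep v z = tprod S [pred j | ~~ v j] (\val z).
Proof.
have Hz := rkhs_kernel HK z.
rewrite -(rkhs_repr z (HK_rep v)) rkhs_ip_sym//; last exact: HK_rep.
rewrite ip_rep// /L -(integral_kprod v predT (XX_val z)).
apply: eq_Rintegral => x; rewrite inE => xX.
by rewrite KkernE pt_id//; exact: XX_trunc.
Qed.

(** [rep v] is a product over the coordinates outside [v]; applying [L v'] removes those in [v'] and
    puts the others at the anchor. *)
Lemma ip_rep2 v v' : ip (rep v) (rep v') = tail [pred j | ~~ v j & ~~ v' j].
Proof.
rewrite ip_rep; last exact: HK_rep.
rewrite -[RHS]/(tprod S _ (fun=> a)) -(integral_kprod v' [pred j | ~~ v j] (aXX S)).
apply: eq_Rintegral => x; rewrite inE => xX.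
rewrite repE pt_id; last exact: XX_trunc.
rewrite /tprod /kprod; congr iprod; apply/funext => j; rewrite /kseq.
by case: ifP => // _; rewrite k_sym.
Qed.

Definition comb (s : seq (R * pred nat)) : XX -> R :=
  fun x => \sum_(p <- s) p.1 * rep p.2 x.

Lemma HK_comb s : HK (comb s).
Proof.
by apply: (@rkhs_sum _ _ _ HK _ s fst (fun p => rep p.2)) => p; exact: HK_rep.
Qed.

Lemma ip_comb s f : HK f -> ip (comb s) f = \sum_(p <- s) p.1 * L p.2 f.
Proof.
move=> Hf; rewrite (@rkhs_ip_suml _ _ _ HK _ s fst (fun p => rep p.2))//; last first.
  by move=> p; exact: HK_rep.
apply: eq_bigr => p _; rewrite rkhs_ip_sym ?ip_rep//; exact: HK_rep.
Qed.

Lemma nprod_tail (w : pred nat) n : nprod (fun j => if w j then ghat j else 0) n =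
  \sum_(u <- fpowerset (fiota n)) (\prod_(j <- u) ghat j) * \prod_(j <- u) (w j)%:R.
Proof.
rewrite -subset_sum_prod; apply: eq_bigr => u _; rewrite -big_split /=.
by apply: eq_bigr => j _; case: (w j); rewrite ?mulr1 ?mulr0.
Qed.

(* [s] lists weights with the (finite) sets of active coordinates. *)
Lemma bias_bound (s : seq (R * {fset nat})) (b : R) :
  \sum_(p <- s) p.1 = 1 ->
  (forall n, \sum_(w <- fpowerset (fiota n) | w != fset0)
     (\prod_(j <- w) ghat j) *
     (\sum_(p <- s) p.1 * \prod_(j <- w) (j \notin p.2)%:R) ^+ 2 <= b) ->
  forall f, HK f ->
    (I_mu mu f - \sum_(p <- s) p.1 * L (fun j => j \in p.2) f) ^+ 2 <= b * ip f f.
Proof.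
move=> s1 sb f Hf.
pose s' : seq (R * pred nat) :=
    (1, predT : pred nat) :: [seq (- p.1, (fun j => j \in p.2) : pred nat) | p <- s].
have -> : I_mu mu f - \sum_(p <- s) p.1 * L (fun j => j \in p.2) f = ip (comb s') f.
  rewrite ip_comb// /s' big_cons /= mul1r I_muE; congr (_ + _).
  by rewrite big_map -sumrN; apply: eq_bigr => p _; rewrite mulNr.
apply: le_trans (rkhs_CS (HK_comb s') Hf) _; rewrite ler_wpM2r ?rkhs_ip_ge0//.
(* No coordinate lies outside [predT], so the product is empty. As the coefficients sum to [1], the
   squared norm becomes [1 - 2 + ip (comb t) (comb t)]. *)
have rT p : ip (rep predT) (rep p) = 1.
  by rewrite ip_rep2 -[RHS]tail_pred0; apply: eq_tail.
pose t : seq (R * pred nat) := [seq (p.1, (fun j => j \in p.2) : pred nat) | p <- s].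
have Ht := HK_comb t; have HT := HK_rep predT.
have -> : comb s' = rep predT \- comb t.
  apply/funext => x; rewrite /comb /s' /t big_cons /= mul1r !big_map -sumrN.
  by congr (_ + _); apply: eq_bigr => p _; rewrite mulNr.
rewrite rkhs_sq_sub// rT (rkhs_ip_sym HT Ht) ip_comb//.
have -> : \sum_(p <- t) p.1 * L p.2 (rep predT) = 1.
  rewrite -s1 big_map; apply: eq_bigr => p _ /=.
  by rewrite -ip_rep// rT mulr1.
have tt : ip (comb t) (comb t) = \sum_(p <- s) \sum_(q <- s) p.1 * q.1 *
    tail (fun j => (j \notin p.2) && (j \notin q.2)).
  rewrite ip_comb// big_map; apply: eq_bigr => p _ /=.
  rewrite -ip_rep// ip_comb; last exact: HK_rep.
  rewrite big_map mulr_sumr; apply: eq_bigr => q _ /=.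
  rewrite -ip_rep; last exact: HK_rep.
  by rewrite ip_rep2 mulrA.
have cvt : (fun n => \sum_(p <- s) \sum_(q <- s) p.1 * q.1 *
      nprod (fun j => if (j \notin p.2) && (j \notin q.2) then ghat j else 0) n)
    @ \oo --> ip (comb t) (comb t).
  rewrite tt; apply: cvg_sumr => p; apply: cvg_sumr => q.
  apply: cvgM; first exact: cvg_cst.
  exact: (@cvg_tail (fun j => (j \notin p.2) && (j \notin q.2))).
suff : ip (comb t) (comb t) <= 1 + b by lra.
move/cvg_lim : (cvt) => <-//; apply: limr_le; first by apply/cvg_ex; eexists; exact: cvt.
apply: nearW => n.
(* Expand each product over sets [w]. That [w] misses both [p.2] and [q.2] is a product of two
   conditions, so for fixed [w] the double sum is a square. *)
have -> : \sum_(p <- s) \sum_(q <- s) p.1 * q.1 *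
      nprod (fun j => if (j \notin p.2) && (j \notin q.2) then ghat j else 0) n =
    \sum_(w <- fpowerset (fiota n)) (\prod_(j <- w) ghat j) *
     (\sum_(p <- s) p.1 * \prod_(j <- w) (j \notin p.2)%:R) ^+ 2.
  transitivity (\sum_(p <- s) \sum_(q <- s) \sum_(w <- fpowerset (fiota n))
    (\prod_(j <- w) ghat j) * ((p.1 * \prod_(j <- w) (j \notin p.2)%:R) *
      (q.1 * \prod_(j <- w) (j \notin q.2)%:R))).
    apply: eq_bigr => p _; apply: eq_bigr => q _.
    rewrite (nprod_tail (fun j => (j \notin p.2) && (j \notin q.2))) mulr_sumr.
    apply: eq_bigr => w _.
    have -> : \prod_(j <- w) ((j \notin p.2) && (j \notin q.2))%:R =
        (\prod_(j <- w) (j \notin p.2)%:R) * (\prod_(j <- w) (j \notin q.2)%:R) :> R.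
      by rewrite -big_split /=; apply: eq_bigr => j _; rewrite -natrM mulnb.
    by ring.
  rewrite (eq_bigr _ (fun p _ => exchange_big _ _ _ _ _ _)) exchange_big /=.
  apply: eq_bigr => w _; rewrite expr2 mulr_suml mulr_sumr.
  apply: eq_bigr => p _; rewrite -!mulr_sumr.
  by [].
(* The empty set contributes the square of the sum of the coefficients, which is the [1] to be split
   off. *)
rewrite (big_fsetD1 fset0) /= ?fpowersetE ?fsub0set//.
rewrite big_seq_fset0 mul1r; under eq_bigr do rewrite big_seq_fset0 mulr1.
rewrite s1 expr1n lerD2l; apply: le_trans (sb n); rewrite le_eqVlt.
apply/orP; left; apply/eqP; rewrite [RHS]big_mkcond [RHS](big_fsetD1 fset0) /= ?fpowersetE ?fsub0set//.
rewrite ?eqxx /= add0r; apply: eq_big_seq => w.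
by rewrite !inE => /andP[-> _].
Qed.

End bias.

(** * The anchored decomposition *)

Section anchored.
Context (R : realType) d (D : measurableType d) (S : setting R D).
Local Notation k := (k S).
Local Notation g := (g S).
Local Notation a := (a S).
Local Notation HK := (HK S).
Local Notation H := (H S).
Local Notation XX := (XX S).
Local Notation ip := (rkhs_ip HK).

Definition ftrunc (v : {fset nat}) (x : nat -> D) := trunc S (fun j => j \in v) x.

(** For [v] contained in [u] this is [-1] to the power [|u \ v|]; the product form lets alternating
    sums over [v] factor by [prod_fpowerset]. *)
Definition sgn (u v : {fset nat}) : R := \prod_(j <- u) (if j \in v then 1 else -1).

(* The component indexed by [u] of the anchored decomposition of [f]. *)
Definition anch (f : XX -> R) (u : {fset nat}) (x : nat -> D) : R :=
  \sum_(v <- fpowerset u) sgn u v * f (pt S (ftrunc v x)).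

Lemma sgn_prod_sum (u : {fset nat}) (phi : nat -> D -> R) x :
  \sum_(v <- fpowerset u) sgn u v * \prod_(j <- u) phi j (ftrunc v x j) =
  \prod_(j <- u) (phi j (x j) - phi j a).
Proof.
rewrite -(prod_fpowerset u (fun j => phi j (x j)) (fun j => - phi j a)).
apply: eq_bigr => v _; rewrite -big_split /=; apply: eq_bigr => j _.
by rewrite /ftrunc /trunc; case: ifP; rewrite ?mul1r ?mulN1r.
Qed.

Lemma sgn_prod_sum2 (u : {fset nat}) (phi : nat -> D -> D -> R) x y :
  \sum_(v <- fpowerset u) \sum_(w <- fpowerset u) sgn u v * sgn u w *
    \prod_(j <- u) phi j (ftrunc v x j) (ftrunc w y j) =
  \prod_(j <- u) (phi j (x j) (y j) - phi j (x j) a - (phi j a (y j) - phi j a a)).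
Proof.
rewrite -(sgn_prod_sum u (fun j z => phi j z (y j) - phi j z a)).
apply: eq_bigr => v _; rewrite -(sgn_prod_sum u (fun j z => phi j (ftrunc v x j) z)).
by rewrite mulr_sumr; apply: eq_bigr => w _; rewrite mulrA.
Qed.

Definition tailC (u : {fset nat}) : R := tail S (fun j => j \notin u).

Lemma XX_ftrunc v x : XX (ftrunc v x). Proof. exact: XX_trunc_fin. Qed.

Lemma Kkern_ftrunc (u v w : {fset nat}) x y : (v `<=` u)%fset -> (w `<=` u)%fset ->
  Kkern (pt S (ftrunc v x)) (pt S (ftrunc w y)) =
  (\prod_(j <- u) (1 + g j * k (ftrunc v x j) (ftrunc w y j))) * tailC u.
Proof.
move=> vu wu; rewrite KkernE !pt_id; [|exact: XX_ftrunc..].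
have [N uN] := fset_sub_fiota u.
pose c j := g j * k (ftrunc v x j) (ftrunc w y j).
apply/cvg_lim => //.
have cv : (fun n => (\prod_(j <- u) (1 + c j)) *
    nprod (fun j => if j \notin u then ghat S j else 0) n) @ \oo -->
    (\prod_(j <- u) (1 + c j)) * tailC u.
  by apply: cvgM; [exact: cvg_cst|exact: cvg_tail].
apply: cvg_trans cv; apply: near_eq_cvg; exists N => // n Nn.
have -> : \prod_(j <- u) (1 + c j) = nprod (fun j => if j \in u then c j else 0) n.
  have un : (u `<=` fiota n)%fset by apply: fsubset_trans uN (fiotaS Nn).
  rewrite /nprod -big_fiota -(prod_fsubset _ un); apply: eq_bigr => j _.
  by case: ifP; rewrite ?addr0.
rewrite /nprod -big_split /=; apply: eq_bigr => j _; rewrite /kseq /=.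
case: ifPn => ju /=; first by rewrite addr0 mulr1.
rewrite addr0 mul1r /ftrunc /trunc !ifN//.
- by apply: contra ju; exact: (fsubsetP wu).
- by apply: contra ju; exact: (fsubsetP vu).
Qed.

(** The coefficients and points with which a linear combination of values of [f_u] becomes one of
    values of [f]. *)
Definition expand (u : {fset nat}) (s : seq (R * (nat -> D))) :=
  [seq (p.1 * sgn u v, ftrunc v p.2) | p <- s, v <- fpowerset u].

Lemma sum_expand (u : {fset nat}) s (F : (nat -> D) -> R) :
  \sum_(p <- expand u s) p.1 * F p.2 =
  \sum_(p <- s) p.1 * \sum_(v <- fpowerset u) sgn u v * F (ftrunc v p.2).
Proof.
rewrite big_allpairs_dep /=; apply: eq_bigr => p _; rewrite mulr_sumr.
by apply: eq_bigr => v _; rewrite mulrA.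
Qed.

Lemma sum_expand2 (u : {fset nat}) s (F : (nat -> D) -> (nat -> D) -> R) :
  \sum_(p <- expand u s) \sum_(q <- expand u s) p.1 * q.1 * F p.2 q.2 =
  \sum_(p <- s) \sum_(q <- s) p.1 * q.1 *
    \sum_(v <- fpowerset u) \sum_(w <- fpowerset u) sgn u v * sgn u w *
      F (ftrunc v p.2) (ftrunc w q.2).
Proof.
rewrite [LHS](_ : _ = \sum_(p <- expand u s) p.1 * \sum_(q <- expand u s) q.1 * F p.2 q.2).
  rewrite (sum_expand u s (fun x => \sum_(q <- expand u s) q.1 * F x q.2)).
  apply: eq_bigr => p _.
  under eq_bigr => v _ do rewrite (sum_expand u s (F _)) mulr_sumr.
  rewrite exchange_big mulr_sumr; apply: eq_bigr => q _ /=.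
  rewrite -mulrA; congr (_ * _); rewrite mulr_sumr; apply: eq_bigr => v _.
  rewrite mulrCA; congr (_ * _); rewrite mulr_sumr; apply: eq_bigr => w _.
  by rewrite mulrA.
by apply: eq_bigr => p _; rewrite mulr_sumr; apply: eq_bigr => q _; rewrite mulrA.
Qed.

(** In each coordinate of [u] the mixed second difference removes the [1] from [1 + g_j k] and
    leaves [g_j] times that of [k]; outside [u] both arguments are anchored. So on alternating
    combinations [K] and [k_u] are proportional. *)
Lemma anchored_gram u x y :
  \sum_(v <- fpowerset u) \sum_(w <- fpowerset u) sgn u v * sgn u w *
    Kkern (pt S (ftrunc v x)) (pt S (ftrunc w y)) =
  gam S u * tailC u *
  \sum_(v <- fpowerset u) \sum_(w <- fpowerset u) sgn u v * sgn u w *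
    kern k u (ftrunc v x) (ftrunc w y).
Proof.
rewrite (sgn_prod_sum2 u (fun=> k)) mulrAC /gam -big_split /=.
transitivity ((\sum_(v <- fpowerset u) \sum_(w <- fpowerset u) sgn u v * sgn u w *
    \prod_(j <- u) (1 + g j * k (ftrunc v x j) (ftrunc w y j))) * tailC u).
  rewrite mulr_suml; apply: eq_big_seq => v; rewrite fpowersetE => vu.
  rewrite mulr_suml; apply: eq_big_seq => w; rewrite fpowersetE => wu.
  by rewrite (Kkern_ftrunc x y vu wu) mulrA.
rewrite (sgn_prod_sum2 u (fun j y z => 1 + g j * k y z)).
by congr (_ * _); apply: eq_bigr => j _; ring.
Qed.

Lemma tailC_ge0 u : 0 <= tailC u.
Proof.
apply: limr_ge; first by apply/cvg_ex; eexists; exact: cvg_tail.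
apply: nearW => n; apply: le_trans (nprod_ge1 _ _) => // j.
by case: ifP => // _; exact: ghat_ge0.
Qed.

Lemma tailC_le u : tailC u <= tail S predT.
Proof.
apply: ler_lim.
- by apply/cvg_ex; eexists; exact: (@cvg_tail _ _ _ S (fun j => j \notin u)).
- by apply/cvg_ex; eexists; exact: (@cvg_tail _ _ _ S predT).
apply: nearW => n; apply: le_nprod => j /=.
by case: ifP => // _; rewrite ?lexx ghat_ge0.
Qed.

Lemma gam_ge0 u : 0 <= gam S u.
Proof. by apply: prodr_ge0 => j _; exact: g_ge0. Qed.

(** The functional sends an alternating kernel combination in [H u] to the same combination of
    values of [f]. By [anchored_gram] it is bounded with the stated constant, and [F] is its Riesz
    representer. *)
Lemma anchored_rep u f : HK f -> exists F, [/\ H u F,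
  rkhs_ip (H u) F F <= gam S u * tailC u * ip f f &
  forall x, anch f u x = \sum_(v <- fpowerset u) sgn u v * F (ftrunc v x)].
Proof.
move=> Hf; have f0 := rkhs_ip_ge0 Hf.
have c0 : 0 <= gam S u * tailC u * ip f f.
  by rewrite !mulr_ge0 ?gam_ge0 ?tailC_ge0.
(* A relation, since one function may come from several lists [s]; that [r] is independent of the
   list follows from the bound. *)
pose G phi r := exists s : seq (R * (nat -> D)), phi = kernel_span (kern k u) (expand u s) /\
  r = \sum_(p <- expand u s) p.1 * f (pt S p.2).
have expand_cat b s t : expand u ([seq (b * p.1, p.2) | p <- s] ++ t) =
    [seq (b * p.1, p.2) | p <- expand u s] ++ expand u t.
  rewrite /expand allpairs_cat; congr (_ ++ _).
  rewrite allpairs_mapl map_allpairs; apply: eq_allpairs => p v.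
  by rewrite mulrA.
have [|||F [HF Fc FG _]] := @riesz _ _ _ (H u) G _ c0.
- exists [::]; split; last by rewrite big_nil.
  by apply/funext => x; rewrite /kernel_span big_nil.
- move=> b _ _ _ _ [s [-> ->]] [t [-> ->]].
  exists ([seq (b * p.1, p.2) | p <- s] ++ t); rewrite expand_cat; split.
    by rewrite kernel_span_lin.
  rewrite big_cat big_map mulr_sumr /=; congr (_ + _).
  by apply: eq_bigr => p _; rewrite mulrA.
- move=> _ _ [s [-> ->]]; split; first exact: (kernel_span_mem (H u)).
  pose e : seq (R * XX) := [seq (p.1, pt S p.2) | p <- expand u s].
  have -> : \sum_(p <- expand u s) p.1 * f (pt S p.2) = ip (kernel_span (@Kkern R D k _) e) f.
    by rewrite ip_kernel_span// big_map.
  rewrite -mulrA mulrCA mulrC.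
  have -> : gam S u * tailC u * rkhs_ip (H u) (kernel_span (kern k u) (expand u s))
      (kernel_span (kern k u) (expand u s)) =
      ip (kernel_span (@Kkern R D k _) e) (kernel_span (@Kkern R D k _) e).
    rewrite !ip_kernel_span2 (sum_expand2 u s (kern k u)) big_map.
    under [RHS]eq_bigr do rewrite big_map.
    rewrite (sum_expand2 u s (fun x y => Kkern (pt S x) (pt S y))).
    rewrite mulr_sumr; apply: eq_bigr => p _; rewrite mulr_sumr; apply: eq_bigr => q _.
    by rewrite anchored_gram mulrCA.
  exact: (rkhs_CS (kernel_span_mem HK e) Hf).
exists F; split => // x.
have /FG : G (kernel_span (kern k u) (expand u [:: (1, x)]))
  (\sum_(p <- expand u [:: (1, x)]) p.1 * f (pt S p.2)) by exists [:: (1, x)].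
rewrite (sum_expand u _ (fun x => f (pt S x))) big_seq1 mul1r /=.
rewrite -/(anch f u x) => <-; rewrite rkhs_ip_sym ?ip_kernel_span//; last exact: (kernel_span_mem (H u)).
by rewrite sum_expand big_seq1 mul1r.
Qed.

Definition kpow (u v : {fset nat}) : R := \prod_(j <- u) (if j \in v then 1 else k a a).

Lemma kpow_ge0 u v : 0 <= kpow u v.
Proof. by apply: prodr_ge0 => j _; case: ifP => // _; exact: k_ge0. Qed.

Lemma kern_ftrunc (u v : {fset nat}) x y : (v `<=` u)%fset ->
  kern k u (ftrunc v x) (ftrunc v y) = kpow u v * kern k v x y.
Proof.
move=> vu; rewrite /kern -(prod_fsubset _ vu) -big_split /=; apply: eq_bigr => j _.
by rewrite /ftrunc /trunc; case: ifP; rewrite ?mul1r ?mulr1.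
Qed.

(** On points truncated to [v] the kernel [k_u] equals [k_v] times a power of [k(a, a)], the source
    of the factor [kpow]; the criterion [rkhs_mem] then applies. *)
Lemma trunc_rep (u v : {fset nat}) F : (v `<=` u)%fset -> H u F ->
  H v (F \o ftrunc v) /\
  rkhs_ip (H v) (F \o ftrunc v) (F \o ftrunc v) <= kpow u v * rkhs_ip (H u) F F.
Proof.
move=> vu HF; apply: rkhs_mem; first by rewrite mulr_ge0 ?kpow_ge0 ?rkhs_ip_ge0.
move=> s; pose e := [seq (p.1, ftrunc v p.2) | p <- s].
have -> : \sum_(p <- s) p.1 * (F \o ftrunc v) p.2 = rkhs_ip (H u) (kernel_span (kern k u) e) F.
  by rewrite ip_kernel_span// big_map.
apply: le_trans (rkhs_CS (kernel_span_mem (H u) e) HF) _.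
rewrite ip_kernel_span2 big_map le_eqVlt; apply/orP; left; apply/eqP.
rewrite [RHS]mulrAC; congr (_ * _).
rewrite mulr_sumr; apply: eq_bigr => p _; rewrite big_map mulr_sumr.
by apply: eq_bigr => q _; rewrite (kern_ftrunc _ _ vu) mulrCA.
Qed.

(** The form in which (Q) can be used: each term lies in the space of its own index [v], while the
    whole sum need not lie in [H u]. Zero terms make the family total. *)
Lemma anchored_decomp u f : HK f ->
  exists h : {fset nat} -> (nat -> D) -> R,
  [/\ forall v, H v (h v), forall v, ~~ (v `<=` u)%fset -> h v = (fun=> 0),
    forall v, rkhs_ip (H v) (h v) (h v) <= kpow u v * (gam S u * tail S predT * ip f f) &
    forall x, anch f u x = \sum_(v <- fpowerset u) sgn u v * h v x].
Proof.
move=> Hf; have [F [HF Fc FE]] := anchored_rep u Hf.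
pose h (v : {fset nat}) := if (v `<=` u)%fset then F \o ftrunc v else fun=> 0.
exists h; split => [v|v|v|x]; rewrite /h.
- by case: ifP => [vu|_]; [exact: (trunc_rep vu HF).1|exact: rkhs_zero].
- by move=> /negbTE ->.
- case: ifP => [vu|_].
    apply: le_trans (trunc_rep vu HF).2 _.
    rewrite ler_wpM2l ?kpow_ge0//; apply: le_trans Fc _.
    by rewrite ler_wpM2r ?rkhs_ip_ge0// ler_wpM2l ?gam_ge0 ?tailC_le.
  rewrite rkhs_ip0l; last exact: rkhs_zero.
  rewrite !mulr_ge0 ?kpow_ge0 ?gam_ge0 ?rkhs_ip_ge0//.
  by apply: le_trans (tailC_le fset0); exact: tailC_ge0.
- by rewrite FE; apply: eq_big_seq => v; rewrite fpowersetE => ->.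
Qed.

End anchored.

Lemma sqr_sum_le (R : realType) (I : Type) (s : seq I) (F : I -> R) :
  (\sum_(i <- s) F i) ^+ 2 <= (size s)%:R * \sum_(i <- s) F i ^+ 2.
Proof.
have sub_sq t x : \sum_(j <- t) (x - F j) ^+ 2 =
    (size t)%:R * x ^+ 2 + \sum_(j <- t) F j ^+ 2 - 2 * x * \sum_(j <- t) F j.
  elim: t => [|j t IH]; first by rewrite !big_nil /=; ring.
  by rewrite !big_cons IH /= -natr1; ring.
elim: s => [|i s IH]; first by rewrite !big_nil expr0n mulr0.
have : 0 <= \sum_(j <- s) (F i - F j) ^+ 2 by apply: sumr_ge0 => j _; exact: sqr_ge0.
by rewrite sub_sq !big_cons /= -natr1; nra.
Qed.

(** * Square-integrable random variables and their variances *)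

Section L2.
Local Open Scope ereal_scope.
Context d (T : measurableType d) (R : realType) (P : probability T R).

Lemma Lfun2P (X : T -> R) : X \in Lfun P 2%:E <->
  measurable_fun setT X /\ \int[P]_w ((X w) ^+ 2)%:E < +oo.
Proof.
split=> [X2|[mX Xoo]].
  split; first by move: X2; rewrite inE => /andP[]; rewrite inE.
  have /integrableP[_] := Lfun2_integrable_sqr X2.
  by under eq_integral do rewrite gee0_abs ?lee_fin ?sqr_ge0//.
rewrite inE; apply/andP; split; rewrite inE//=.
rewrite /finite_norm unlock /Lnorm/= poweR_lty//.
rewrite (eq_integral (fun w => ((X w) ^+ 2)%:E))// => x _.
by rewrite powR_mulrn ?normr_ge0// real_normK ?num_real.
Qed.

Lemma Lfun2_integrable (X : T -> R) : X \in Lfun P 2%:E ->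
  P.-integrable setT (EFin \o X).
Proof. by move=> X2; apply/Lfun1_integrable/Lfun_subset12 => //; exact: fin_num_measure. Qed.

Lemma Lfun2_sum (I : Type) (s : seq I) (c : I -> R) (X : I -> T -> R) :
  (forall i, X i \in Lfun P 2%:E) ->
  (fun w => \sum_(i <- s) c i * X i w)%R \in Lfun P 2%:E.
Proof.
move=> X2; apply/Lfun2P; elim: s => [|i s [mS Soo]].
  split; first by under eq_fun do rewrite big_nil; exact: measurable_cst.
  by rewrite integral0_eq// => x _; rewrite big_nil expr0n.
have /Lfun2P[mX Xoo] := X2 i.
under eq_fun do rewrite big_cons.
have m1 : measurable_fun setT (fun x => c i * X i x + \sum_(j <- s) c j * X j x)%R.
  by apply: measurable_funD => //; apply: measurable_funM => //; exact: measurable_cst.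
split=> //; under eq_integral do rewrite big_cons.
apply: (@le_lt_trans _ _ (\int[P]_w ((2 * c i ^+ 2)%:E * ((X i w) ^+ 2)%:E +
    2%:E * ((\sum_(j <- s) c j * X j w) ^+ 2)%:E))).
  apply: ge0_le_integral => //.
  - by move=> x _; rewrite lee_fin sqr_ge0.
  - by apply/measurable_EFinP; exact: measurable_funX.
  - apply: emeasurable_funD; apply/measurable_EFinP; apply: measurable_funM => //.
      exact: measurable_funX.
    exact: measurable_funX.
  - move=> x _; rewrite -!EFinM -EFinD lee_fin.
    have := sqr_ge0 (c i * X i x - \sum_(j <- s) c j * X j x); nra.
have c2 : (0 <= 2 * c i ^+ 2)%R by rewrite mulr_ge0 ?sqr_ge0.
have msq (f : T -> R) : measurable_fun setT f -> measurable_fun setT (fun x => ((f x) ^+ 2)%:E).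
  by move=> mf; apply/measurable_EFinP; exact: measurable_funX.
have mS2 := msq _ mS; have mX2 := msq _ mX.
rewrite ge0_integralD//; first last.
- exact: emeasurable_funM.
- by move=> x _; rewrite mule_ge0 ?lee_fin ?sqr_ge0.
- exact: emeasurable_funM.
- by move=> x _; rewrite mule_ge0 ?lee_fin ?sqr_ge0.
rewrite !ge0_integralZl//; try by [move=> x _; rewrite lee_fin sqr_ge0|rewrite lee_fin].
by apply: lte_add_pinfty; apply: lte_mul_pinfty => //; rewrite lee_fin.
Qed.

Lemma variance_int (X : T -> R) : 'V_P[X] = \int[P]_w ((X w - \int[P]_x X x)%R ^+ 2)%:E.
Proof.
rewrite /variance !unlock; apply: eq_integral => w _ /=.
by rewrite /Rintegral.
Qed.

Lemma Rintegral_sum (A : set T) (I : Type) (s : seq I) (c : I -> R) (X : I -> T -> R) :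
  measurable A -> (forall i, P.-integrable A (EFin \o X i)) ->
  (\int[P]_(w in A) (\sum_(i <- s) c i * X i w) =
   \sum_(i <- s) c i * \int[P]_(w in A) X i w)%R.
Proof.
move=> mA iX.
have iS (t : seq I) : P.-integrable A (EFin \o (fun w => \sum_(i <- t) c i * X i w)%R).
  rewrite (_ : _ \o _ = (fun w => \sum_(i <- t) ((c i)%:E * (X i w)%:E))); last first.
    by apply/funext => w; rewrite /= -sumEFin.
  by apply: integrable_sum => // i _; apply: integrableZl => //; exact: iX.
elim: s => [|i s IH].
  by rewrite big_nil; under eq_Rintegral do rewrite big_nil; rewrite Rintegral_cst// mul0r.
rewrite big_cons -IH; under eq_Rintegral do rewrite big_cons.
rewrite RintegralD//; last first.
  rewrite (_ : _ \o _ = (fun w => (c i)%:E * (X i w)%:E))//.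
  by apply: integrableZl => //; exact: iX.
by rewrite RintegralZl//; exact: iX.
Qed.

(** The summands may be dependent, as they will be evaluations of one quadrature on several
    functions; Cauchy-Schwarz then costs their number. *)
Lemma variance_sum_le (I : Type) (s : seq I) (c : I -> R) (X : I -> T -> R) :
  (forall i, X i \in Lfun P 2%:E) -> (forall i, (c i ^+ 2 <= 1)%R) ->
  'V_P[(fun w => \sum_(i <- s) c i * X i w)%R] <=
  (size s)%:R%:E * \sum_(i <- s) 'V_P[X i].
Proof.
move=> X2 c1; rewrite variance_int Rintegral_sum//; last by move=> i; exact: Lfun2_integrable.
have mX i : measurable_fun setT (X i) by have /Lfun2P[] := X2 i.
under [X in _ <= _ * X]eq_bigr do rewrite variance_int.
have mY i : measurable_fun setT (fun w => ((X i w - \int[P]_x X i x)%R ^+ 2)%:E).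
  by apply/measurable_EFinP; apply: measurable_funX; exact: measurable_funB.
rewrite -ge0_integral_sum//; last by move=> i x _; rewrite lee_fin sqr_ge0.
rewrite -ge0_integralZl//; first last.
- by move=> x _; apply: sume_ge0 => i _; rewrite lee_fin sqr_ge0.
- by apply: emeasurable_sum => i.
apply: ge0_le_integral => //.
- by move=> x _; rewrite lee_fin sqr_ge0.
- apply/measurable_EFinP; apply: measurable_funX; apply: measurable_funB => //.
  by apply: measurable_sum => i; apply: measurable_funM => //.
- by apply: emeasurable_funM => //; apply: emeasurable_sum => i.
move=> w _; rewrite sumEFin -EFinM lee_fin -sumrB.
apply: (@le_trans _ _ ((size s)%:R * \sum_(i <- s) (c i * (X i w - \int[P]_x X i x)) ^+ 2)%R).
  by under eq_bigr do rewrite -mulrBr; exact: sqr_sum_le.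
rewrite ler_wpM2l//; apply: ler_sum => i _; rewrite exprMn.
by rewrite ler_piMl// sqr_ge0.
Qed.

End L2.

Lemma ge0_integral_law d d' (T : measurableType d) (T' : measurableType d')
    (R : realType) (P : {measure set T -> \bar R}) (Q : {measure set T' -> \bar R})
    (X : T -> T') (f : T' -> \bar R) :
  measurable_fun setT X -> (forall A, measurable A -> P (X @^-1` A) = Q A) ->
  measurable_fun setT f -> (forall y, 0 <= f y)%E ->
  (\int[P]_x f (X x) = \int[Q]_y f y)%E.
Proof.
move=> mX PX mf f0; rewrite -[LHS](@ge0_integral_pushforward _ _ _ _ _ X mX P setT)//.
by apply: eq_measure_integral => A mA _; exact: PX.
Qed.

(** * Quadratures applied to the anchored components *)

Section quadrature_anchored.
Context (R : realType) d (D : measurableType d) (S : setting R D).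
Local Notation rho := (rho S).
Local Notation mu := (mu S).
Local Notation k := (k S).
Local Notation a := (a S).
Local Notation HK := (HK S).
Local Notation H := (H S).
Local Notation XX := (XX S).
Local Notation ip := (rkhs_ip HK).
Local Notation Omega := (prod_space nat D).

Lemma extendE (u : {fset nat}) (z : u -> D) (j : u) : extend a z (val j) = z j.
Proof. by rewrite /extend valK. Qed.

Lemma extend_in (u : {fset nat}) (z : u -> D) j (ju : j \in u) :
  extend a z j = z [` ju]%fset.
Proof. by rewrite -(extendE z [` ju]%fset). Qed.

Lemma measurable_extend (u : {fset nat}) j :
  measurable_fun setT (fun z : prod_space u D => extend a z j).
Proof.
rewrite /extend; case: insubP => [i _ _|_]; last exact: measurable_cst.
exact: measurable_coord.
Qed.

Lemma measurable_H v d' (T : measurableType d') (Z : T -> nat -> D) h :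
  (forall j, measurable_fun setT (fun w => Z w j)) -> H v h ->
  measurable_fun setT (fun w => h (Z w)).
Proof.
move=> mZ Hh; apply: (@rkhs_measurable _ _ _ (H v) _ _ Z) => // y.
rewrite /kern; elim: (enum_fset v) => [|j s IH].
  by under eq_fun do rewrite big_nil; exact: measurable_cst.
under eq_fun do rewrite big_cons; apply: measurable_funM => //.
exact: measurableT_comp (measurable_ksec S (y j)) (mZ j).
Qed.

Lemma measurable_kern v d' (T : measurableType d') (Z : T -> nat -> D) :
  (forall j, measurable_fun setT (fun w => Z w j)) ->
  measurable_fun setT (fun w => kern k v (Z w) (Z w)).
Proof.
move=> mZ; rewrite /kern; elim: (enum_fset v) => [|j s IH].
  by under eq_fun do rewrite big_nil; exact: measurable_cst.
under eq_fun do rewrite big_cons; apply: measurable_funM => //.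
exact: measurableT_comp (measurable_kdiag S) (mZ j).
Qed.

Lemma kern_diag_ge0 v x : 0 <= kern k v x x.
Proof. by apply: prodr_ge0 => j _; exact: k_ge0. Qed.

Lemma Lfun2_H v d' (T : measurableType d') (P : probability T R) (Z : T -> nat -> D) h :
  (forall j, measurable_fun setT (fun w => Z w j)) ->
  (\int[P]_w (kern k v (Z w) (Z w))%:E < +oo)%E -> H v h ->
  (fun w => h (Z w)) \in Lfun P 2%:E.
Proof.
move=> mZ koo Hh; apply/Lfun2P; split; first exact: measurable_H Hh.
have h0 := rkhs_ip_ge0 Hh.
apply: (@le_lt_trans _ _ (\int[P]_w ((rkhs_ip (H v) h h)%:E * (kern k v (Z w) (Z w))%:E))%E).
  apply: ge0_le_integral => //.
  - by move=> w _; rewrite lee_fin sqr_ge0.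
  - by apply/measurable_EFinP; apply: measurable_funX; exact: measurable_H Hh.
  - by apply: emeasurable_funM => //; apply/measurable_EFinP; exact: measurable_kern.
  - by move=> w _; rewrite -EFinM lee_fin; exact: rkhs_eval_bound.
rewrite ge0_integralZl//.
- by rewrite lte_mul_pinfty.
- by apply/measurable_EFinP; exact: measurable_kern.
- by move=> w _; rewrite lee_fin kern_diag_ge0.
Qed.

Lemma kern_integral_lty (u v : {fset nat}) d' (T : measurableType d') (P : probability T R)
    (Pu : probability (prod_space u T) R) (xi : u -> T -> D) :
  is_product_measure P Pu -> (v `<=` u)%fset ->
  (forall j, measurable_fun setT (xi j)) ->
  (forall j A, measurable A -> P (xi j @^-1` A) = rho A) ->
  (\int[Pu]_w (kern k v (extend a (fun j => xi j (w j)))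
     (extend a (fun j => xi j (w j))))%:E < +oo)%E.
Proof.
move=> PuP vu mxi lxi.
pose gg (j : u) t : R := if val j \in v then k (xi j t) (xi j t) else 1.
have mg j : measurable_fun setT (gg j).
  rewrite /gg; case: (val j \in v); last exact: measurable_cst.
  exact: measurableT_comp (measurable_kdiag S) (mxi j).
have g0 j t : 0 <= gg j t by rewrite /gg; case: ifP => // _; exact: k_ge0.
have goo j : (\int[P]_t (gg j t)%:E < +oo)%E.
  rewrite /gg; case: (val j \in v).
    rewrite (ge0_integral_law (mxi j) (lxi j) (f := fun y => (k y y)%:E)).
    - exact: k_int.
    - by apply/measurable_EFinP; exact: measurable_kdiag.
    - by move=> y; rewrite lee_fin k_ge0.
  by rewrite (integral_cst P measurableT) mul1e ltey_eq fin_num_measure.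
rewrite (eq_integral (fun w : prod_space u T => (\prod_(j <- index_enum u) gg j (w j))%:E)).
  rewrite (ge0_integral_prod PuP _ mg g0 goo) ?index_enum_uniq//.
  rewrite -ge0_fin_numE; last first.
    by apply: prode_ge0 => j _; apply: integral_ge0 => t _; rewrite lee_fin.
  apply: prode_fin_num => j _; rewrite ge0_fin_numE//.
  by apply: integral_ge0 => t _; rewrite lee_fin.
move=> w _; congr (_%:E); rewrite /kern -(prod_fsubset _ vu) big_seq_fsetE /=.
by apply: eq_bigr => j _; rewrite extendE.
Qed.

Definition restr (u : {fset nat}) (x : Omega) : prod_space u D := fun j => x (val j).

Lemma measurable_restr u : measurable_fun setT (@restr u).
Proof. by apply: measurable_prod_space => j; exact: measurable_coord. Qed.

Let restr_mixin (u : {fset nat}) := isMeasurableFun.Build _ _ _ _ _ (@measurable_restr u).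
Let restr_pack (u : {fset nat}) : {mfun Omega >-> prod_space u D} := HB.pack (@restr u) (restr_mixin u).

(** The unbiasedness in (Q) is stated relative to a product measure on [D^u]; the marginal of [mu]
    is one. *)
Definition rhou (u : {fset nat}) : probability (prod_space u D) R := distribution mu (restr_pack u).

Lemma rhou_prod u : is_product_measure rho (rhou u).
Proof.
move=> J A mA.
pose A' i : set D := if insub i is Some j then A j else setT.
have A'E (j : u) : A' (val j) = A j by rewrite /A' valK.
have := mu_prod S (J := [fset val j | j in J]%fset) (A := A').
rewrite big_imfset/=; last by move=> i j _ _; exact: val_inj.
under [in RHS]eq_bigr do rewrite A'E.
move=> <-; last by move=> _ /imfsetP[j /= jJ ->]; rewrite A'E; exact: mA.
congr (mu _); apply/seteqP; split => x /= xA j.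
  by move=> /imfsetP[i /= iJ ->]; rewrite A'E; exact: xA.
by move=> jJ; rewrite -A'E; apply: xA; apply/imfsetP; exists j.
Qed.

Lemma ftrunc_extend (u v : {fset nat}) x : (v `<=` u)%fset ->
  ftrunc S v (extend a (restr (u := u) x)) = ftrunc S v x.
Proof.
move=> vu; apply/funext => j; rewrite /ftrunc /trunc; case: ifP => // jv.
by rewrite (extend_in _ (fsubsetP vu _ jv)).
Qed.

Section one_quadrature.
Context (u : {fset nat}) d' (T : measurableType d') (P : probability T R)
  (Pu : probability (prod_space u T) R) (n : nat) (t : 'I_n -> R)
  (xi : 'I_n -> u -> T -> D).
Hypothesis PuP : is_product_measure P Pu.
Hypothesis mxi : forall i j, measurable_fun setT (xi i j) /\
        forall A, measurable A -> P (xi i j @^-1` A) = rho A.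
Hypothesis unbiased : forall rhou : probability (prod_space u D) R,
        is_product_measure rho rhou ->
        forall f : prod_space u D -> R, f \in Lfun rhou 2%:E ->
        ('E_Pu[quad t xi f] = \int[rhou]_z (f z)%:E)%E.
Context (f : XX -> R) (Hf : HK f).

Definition aquad : prod_space u T -> R := quad t xi (fun z => anch f u (extend a z)).

Lemma Lfun2_quad v h : (v `<=` u)%fset -> H v h ->
  quad t xi (fun z => h (extend a z)) \in Lfun Pu 2%:E.
Proof.
move=> vu Hh; apply: Lfun2_sum => i; apply: (Lfun2_H (v := v)) => //.
  move=> j; rewrite /extend; case: insubP => [l _ _|_]; last exact: measurable_cst.
  by apply: measurableT_comp (measurable_coord l); exact: (mxi i l).1.
exact: (kern_integral_lty PuP vu (fun j => (mxi i j).1) (fun j => (mxi i j).2)).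
Qed.

Lemma aquad_decomp (h : {fset nat} -> (nat -> D) -> R) :
  (forall x, anch f u x = \sum_(v <- fpowerset u) sgn R u v * h v x) ->
  aquad = fun w => \sum_(v <- fpowerset u) sgn R u v *
    quad t xi (fun z => h v (extend a z)) w.
Proof.
move=> hE; apply/funext => w; rewrite /aquad /quad.
under eq_bigr do rewrite hE mulr_sumr.
rewrite exchange_big; apply: eq_bigr => v _; rewrite mulr_sumr.
by apply: eq_bigr => i _; rewrite mulrCA.
Qed.

Lemma sgn_sqr v : sgn R u v ^+ 2 <= 1.
Proof.
rewrite /sgn -prodrXl big1// => j _; case: ifP => _; ring.
Qed.

Lemma Lfun2_anch_extend :
  (fun z : prod_space u D => anch f u (extend a z)) \in Lfun (rhou u) 2%:E.
Proof.
have [h [Hh h0 _ hE]] := anchored_decomp u Hf.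
rewrite (_ : (fun z => _) = fun z : prod_space u D =>
    \sum_(v <- fpowerset u) sgn R u v * h v (extend a z)); last first.
  by apply/funext => z; exact: hE.
apply: Lfun2_sum => v; have [vu|/h0 ->] := boolP (v `<=` u)%fset; last exact: Lfun_cst.
apply: (Lfun2_H (v := v)) => //; first exact: measurable_extend.
exact: (kern_integral_lty (@rhou_prod u) vu (xi := fun j x => x)).
Qed.

(** Unbiasedness gives an integral over [D^u]; pulled back to the sequence space, its terms are the
    integrals defining the [L v f]. *)
Lemma mean_aquad : \int[Pu]_w aquad w =
  \sum_(v <- fpowerset u) sgn R u v * L (fun j => j \in v) f.
Proof.
have F2 := Lfun2_anch_extend; have mX := measurable_XX S.
have /Lfun2P[mF Foo] := F2.
rewrite /Rintegral; have := unbiased (@rhou_prod u) F2; rewrite unlock => ->.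
have restrE x : anch f u (extend a (restr (u := u) x)) = anch f u x.
  by apply: eq_big_seq => v; rewrite fpowersetE => vu; rewrite ftrunc_extend.
have iF : mu.-integrable setT (EFin \o (fun x => anch f u (extend a (restr (u := u) x)))).
  apply: Lfun2_integrable; apply/Lfun2P; split.
    exact: (measurableT_comp mF (@measurable_restr u)).
  rewrite (ge0_integral_law (@measurable_restr u) (Q := rhou u)
    (f := fun z => ((anch f u (extend a z)) ^+ 2)%:E))//.
    by apply/measurable_EFinP; exact: measurable_funX.
  by move=> z; rewrite lee_fin sqr_ge0.
have -> : (\int[rhou u]_z (anch f u (extend a z))%:E =
    \int[mu]_x (anch f u (extend a (restr (u := u) x)))%:E)%E.
  apply: (@integral_pushforward _ _ _ _ _ (@restr u) _ mu setT
    (fun z => (anch f u (extend a z))%:E)) => //.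
  - exact: measurable_restr.
  - exact/measurable_EFinP.
rewrite -(integral_XX iF).
under eq_integral do rewrite /= restrE.
rewrite -[LHS]/(\int[mu]_(x in XX) (anch f u x)) /anch Rintegral_sum//.
by move=> v; exact: integrable_HK.
Qed.

Lemma aquad_Lfun2_var : aquad \in Lfun Pu 2%:E /\
  forall b : {fset nat} -> R,
  (forall v h, (v `<=` u)%fset -> H v h ->
    ('V_Pu[quad t xi (fun z => h (extend a z))] <= (b v * rkhs_ip (H v) h h)%:E)%E) ->
  (forall v, (v `<=` u)%fset -> 0 <= b v) ->
  ('V_Pu[aquad] <= ((2 ^ #|` u|)%:R * \sum_(v <- fpowerset u)
    b v * (kpow S u v * (gam S u * tail S predT * ip f f)))%:E)%E.
Proof.
have [h [Hh h0 hc hE]] := anchored_decomp u Hf.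
have X2 v : quad t xi (fun z => h v (extend a z)) \in Lfun Pu 2%:E.
  have [vu|/h0 ->] := boolP (v `<=` u)%fset; first exact: (Lfun2_quad vu (Hh v)).
  rewrite (_ : quad _ _ _ = cst 0); first exact: Lfun_cst.
  by apply/funext => w; rewrite /quad big1// => i _; rewrite mulr0.
rewrite (aquad_decomp hE); split; first exact: Lfun2_sum.
move=> b Vb b0; apply: (le_trans (variance_sum_le (fpowerset u) X2 sgn_sqr)).
rewrite card_fpowerset EFinM lee_wpmul2l ?lee_fin//.
rewrite -sumEFin big_seq [leRHS]big_seq; apply: lee_sum => v; rewrite fpowersetE => vu.
apply: le_trans (Vb v (h v) vu (Hh v)) _; rewrite lee_fin ler_wpM2l//.
exact: b0.
Qed.

End one_quadrature.
End quadrature_anchored.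

(** * Algorithms with deterministic cost *)

Section linear_strategy.
Context (R : realType) (E : Type).

Fixpoint linear_strategy (s : seq (R * E)) (acc : R) : strategy R E :=
  match s with
  | [::] => Output E acc
  | p :: s' => Query p.2 (fun y => linear_strategy s' (acc + p.1 * y))
  end.

Lemma run_linear_strategy s acc f :
  run (linear_strategy s acc) f = acc + \sum_(p <- s) p.1 * f p.2.
Proof.
elim: s acc => [|p s IH] acc /=; first by rewrite big_nil addr0.
by rewrite IH big_cons addrA.
Qed.

Lemma sample_points_linear_strategy s acc f :
  sample_points (linear_strategy s acc) f = map snd s.
Proof. by elim: s acc => [|p s IH] acc //=; rewrite IH. Qed.

End linear_strategy.

Lemma integral_law d d' (T : measurableType d) (T' : measurableType d')
    (R : realType) (P : {measure set T -> \bar R}) (Q : {measure set T' -> \bar R})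
    (X : T -> T') (f : T' -> R) :
  measurable_fun setT X -> (forall A, measurable A -> P (X @^-1` A) = Q A) ->
  measurable_fun setT f -> P.-integrable setT (EFin \o (f \o X)) ->
  \int[P]_x f (X x) = \int[Q]_y f y.
Proof.
move=> mX PX mf If; rewrite /Rintegral; congr fine.
have mf' : measurable_fun setT (EFin \o f) by exact/measurable_EFinP.
rewrite -[LHS](@integral_pushforward _ _ _ _ _ X mX P setT (EFin \o f) mf' If)//.
by apply: eq_measure_integral => A mA _; exact: PX.
Qed.

Lemma Lfun2_sub_cst d (T : measurableType d) (R : realType) (P : probability T R)
    (X : T -> R) c : X \in Lfun P 2%:E -> (X \- cst c) \in Lfun P 2%:E.
Proof.
move=> X2.
have := @Lfun2_sum _ _ _ P bool [:: true; false] (fun b => if b then 1 else - c)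
  (fun b => if b then X else cst 1) (fun b => if b as b' return ((if b' then X else cst 1) \in Lfun P 2%:E) then X2 else Lfun_cst P 1 2).
rewrite (_ : (fun w => \sum_(i <- _) _) = X \- cst c)//.
by apply/funext => w; rewrite big_cons big_seq1 mul1r mulr1.
Qed.

Section independent_sum.
Context d1 d2 (T1 : measurableType d1) (T2 : measurableType d2) (R : realType).
Context (P1 : probability T1 R) (P2 : probability T2 R).
Local Notation P := (P1 \x P2)%E.

Let fst_law A : measurable A -> P (fst @^-1` A) = P1 A.
Proof.
move=> mA; rewrite (_ : fst @^-1` A = A `*` setT); last first.
  by apply/seteqP; split => -[x y] //= [].
rewrite product_measure1E//; rewrite [X in (_ * X)%E](_ : _ = 1%E) ?mule1//.
exact: probability_setT.
Qed.

Let snd_law A : measurable A -> P (snd @^-1` A) = P2 A.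
Proof.
move=> mA; rewrite (_ : snd @^-1` A = setT `*` A); last first.
  by apply/seteqP; split => -[x y] //= [].
rewrite product_measure1E//; rewrite [X in (X * _)%E](_ : _ = 1%E) ?mul1e//.
exact: probability_setT.
Qed.

Context (X1 : T1 -> R) (X2 : T2 -> R).
Hypotheses (L1 : X1 \in Lfun P1 2%:E) (L2 : X2 \in Lfun P2 2%:E).

Let Y1 := X1 \o fst : T1 * T2 -> R.
Let Y2 := X2 \o snd : T1 * T2 -> R.

Let LY1 : Y1 \in Lfun P 2%:E.
Proof.
have /Lfun2P[mX Xoo] := L1; apply/Lfun2P; split; first exact: measurableT_comp.
rewrite (ge0_integral_law measurable_fst fst_law (f := fun x => ((X1 x) ^+ 2)%:E))//.
  by apply/measurable_EFinP; exact: measurable_funX.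
by move=> x; rewrite lee_fin sqr_ge0.
Qed.

Let LY2 : Y2 \in Lfun P 2%:E.
Proof.
have /Lfun2P[mX Xoo] := L2; apply/Lfun2P; split; first exact: measurableT_comp.
rewrite (ge0_integral_law measurable_snd snd_law (f := fun x => ((X2 x) ^+ 2)%:E))//.
  by apply/measurable_EFinP; exact: measurable_funX.
by move=> x; rewrite lee_fin sqr_ge0.
Qed.

Let mean1 : \int[P]_w Y1 w = \int[P1]_x X1 x.
Proof.
have /Lfun2P[mX _] := L1.
exact: (integral_law measurable_fst fst_law mX (Lfun2_integrable LY1)).
Qed.

Let mean2 : \int[P]_w Y2 w = \int[P2]_x X2 x.
Proof.
have /Lfun2P[mX _] := L2.
exact: (integral_law measurable_snd snd_law mX (Lfun2_integrable LY2)).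
Qed.

Lemma Lfun2_indep_sum : (fun w => X1 w.1 + X2 w.2) \in Lfun P 2%:E.
Proof.
have := @Lfun2_sum _ _ _ P bool [:: true; false] (fun=> 1)
  (fun b => if b then Y1 else Y2) (fun b => if b as b' return ((if b' then Y1 else Y2) \in Lfun P 2%:E) then LY1 else LY2).
rewrite (_ : (fun w => \sum_(i <- _) _) = (fun w => X1 w.1 + X2 w.2))//.
by apply/funext => w; rewrite big_cons big_seq1 !mul1r.
Qed.

Lemma mean_indep_sum : \int[P]_w (X1 w.1 + X2 w.2) = \int[P1]_x X1 x + \int[P2]_x X2 x.
Proof. by rewrite -mean1 -mean2 RintegralD//; exact: Lfun2_integrable. Qed.

(** Fubini: for a fixed first component the centred second factor integrates to zero. *)
Let cov0 : covariance P Y1 Y2 = 0%E.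
Proof.
rewrite unlock !unlock.
set m1 := fine _; set m2 := fine _.
have m2E : m2 = \int[P2]_x X2 x by rewrite -mean2.
have /Lfun2P[mX1 _] := L1; have /Lfun2P[mX2 _] := L2.
have Lc1 : (Y1 \- cst m1) \in Lfun P 2%:E by exact: Lfun2_sub_cst.
have Lc2 : (Y2 \- cst m2) \in Lfun P 2%:E by exact: Lfun2_sub_cst.
have /Lfun1_integrable icc := Lfun2_mul_Lfun1 Lc1 Lc2.
rewrite -(integral12_prod_meas1 icc).
rewrite integral0_eq// => x _; rewrite /fubini_F.
have i2 : P2.-integrable setT (EFin \o (fun y => X2 y - m2)).
  apply: Lfun2_integrable; rewrite (_ : (fun y => _) = X2 \- cst m2)//.
  exact: Lfun2_sub_cst.
rewrite (eq_integral (fun y => ((X1 x - m1)%:E * (X2 y - m2)%:E)%E))//.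
rewrite integralZl// [X in (_ * X)%E](_ : _ = 0%E) ?mule0//.
rewrite -[LHS]fineK; last exact: integrable_fin_num i2.
rewrite -[fine _]/(\int[P2]_y (X2 y - m2)) RintegralB//; last 2 first.
- exact: Lfun2_integrable.
- exact: finite_measure_integrable_cst.
rewrite Rintegral_cst// [X in fine X](_ : _ = 1%E); last exact: probability_setT.
by rewrite mulr1 m2E subrr.
Qed.

Let variance_law d' (T : measurableType d') (Q : probability T R)
    (p : T1 * T2 -> T) (X : T -> R) :
  measurable_fun setT p -> (forall A, measurable A -> P (p @^-1` A) = Q A) ->
  measurable_fun setT X -> \int[P]_w X (p w) = \int[Q]_x X x ->
  'V_P[X \o p] = 'V_Q[X].
Proof.
move=> mp lp mX meanX; rewrite !variance_int [\int[P]_x _]meanX.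
apply: (ge0_integral_law mp lp (f := fun x => ((X x - \int[Q]_x X x) ^+ 2)%:E)).
  by apply/measurable_EFinP; apply: measurable_funX; exact: measurable_funB.
by move=> x; rewrite lee_fin sqr_ge0.
Qed.

Lemma variance_indep_sum :
  ('V_P[(fun w => X1 w.1 + X2 w.2)%R] = 'V_P1[X1] + 'V_P2[X2])%E.
Proof.
have /Lfun2P[mX1 _] := L1; have /Lfun2P[mX2 _] := L2.
rewrite -[X in 'V_P[X]]/(Y1 \+ Y2) varianceD// cov0 mule0 adde0.
by rewrite (variance_law measurable_fst fst_law)// (variance_law measurable_snd snd_law).
Qed.

End independent_sum.

Section achievable.
Context (R : realType) d (D : measurableType d) (S : setting R D).
Local Notation rho := (rho S).
Local Notation a := (a S).
Local Notation HK := (HK S).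
Local Notation XX := (XX S).
Local Notation ip := (rkhs_ip HK).

Definition exact_support (v : {fset nat}) (x : nat -> D) : Prop :=
  forall j, j \in v <-> x j <> a.

(* A linear unbiased estimator of [m f] with variance at most [V |f|^2], whose
   [i]-th sample point has [nth fset0 vs i] as its exact set of coordinates
   different from the anchor; exactness makes the cost deterministic. *)
Definition achievable (vs : seq {fset nat}) (m : (XX -> R) -> R) (V : R) : Prop :=
  exists d' (T : measurableType d') (P : probability T R) (pts : T -> seq (R * XX)),
  [/\ forall w, size (pts w) = size vs,
      forall w i, (i < size vs)%N ->
        exact_support (nth fset0 vs i) (\val (nth (0, apt S) (pts w) i).2) &
      forall f, HK f -> let X w := \sum_(p <- pts w) p.1 * f p.2 in
        [/\ X \in Lfun P 2%:E, \int[P]_w X w = m f &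
            ('V_P[X] <= (V * ip f f)%:E)%E]].

Lemma achievable_nil : achievable [::] (fun=> 0) 0.
Proof.
exists d, D, rho, (fun=> [::]); split => // f Hf X.
have -> : X = cst 0 by apply/funext => w; rewrite /X big_nil.
split; first exact: Lfun_cst.
  by rewrite Rintegral_cst// mul0r.
by rewrite variance_cst mul0r.
Qed.

Lemma exact_support0 : exact_support fset0 (fun=> a).
Proof. by move=> j; rewrite inE; split. Qed.

(** (Q) excludes the empty set; its component is the constant value of [f] at the anchor, obtained
    exactly from one evaluation. *)
Lemma achievable_empty : achievable [:: fset0] (L (fun j => j \in fset0)) 0.
Proof.
exists d, D, rho, (fun=> [:: (1, apt S)]); split => // [w [|//] _|f Hf X].
  exact: exact_support0.
have -> : X = cst (f (apt S)) by apply/funext => w; rewrite /X big_seq1 mul1r.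
split; first exact: Lfun_cst.
  rewrite Rintegral_cst// [X in fine X](_ : _ = 1%E); last exact: probability_setT.
  rewrite mulr1 /L (@eq_Rintegral _ _ _ _ _ (cst (f (apt S)))).
    rewrite Rintegral_cst; last exact: (measurable_XX S).
    by rewrite [X in fine X](_ : _ = 1%E) ?mulr1//; exact: mu_XX.
  move=> x _ /=; congr f; apply: val_inj; rewrite pt_id//.
  have -> : trunc S (fun j => j \in fset0) x = fun=> a.
    by apply/funext => j; rewrite /trunc inE.
  exact: aXX.
by rewrite variance_cst mul0r.
Qed.

(** The two estimators run independently on the product space, so variances add with no factor for
    the number of summands. *)
Lemma achievableD vs1 vs2 m1 m2 V1 V2 :
  achievable vs1 m1 V1 -> achievable vs2 m2 V2 ->
  achievable (vs1 ++ vs2) (fun f => m1 f + m2 f) (V1 + V2).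
Proof.
move=> [d1 [T1 [P1 [p1 [s1 e1 X1]]]]] [d2 [T2 [P2 [p2 [s2 e2 X2]]]]].
exists _, (T1 * T2)%type, (P1 \x P2)%E, (fun w => p1 w.1 ++ p2 w.2); split.
- by move=> w; rewrite !size_cat s1 s2.
- move=> w i; rewrite size_cat !nth_cat s1 => il; case: ltnP => i1; first exact: e1.
  by apply: e2; rewrite ltn_subLR.
move=> f Hf X.
have [L1 M1 V1f] := X1 f Hf; have [L2 M2 V2f] := X2 f Hf.
have -> : X = fun w => (\sum_(p <- p1 w.1) p.1 * f p.2) + \sum_(p <- p2 w.2) p.1 * f p.2.
  by apply/funext => w; rewrite /X big_cat.
split; first exact: (Lfun2_indep_sum L1 L2).
  by rewrite (mean_indep_sum L1 L2) M1 M2.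
by rewrite (variance_indep_sum L1 L2) mulrDl EFinD leeD.
Qed.

End achievable.

Section quadrature_algorithm.
Context (R : realType) d (D : measurableType d) (S : setting R D).
Local Notation rho := (rho S).
Local Notation a := (a S).
Local Notation H := (H S).
Local Notation XX := (XX S).

(** Each set without [j] is paired with the set obtained by adding [j]: the truncations agree
    because [x j = a], and the signs are opposite. *)
Lemma anch_eq0 (f : XX -> R) (u : {fset nat}) x j : j \in u -> x j = a -> anch f u x = 0.
Proof.
move=> ju xja; rewrite /anch -(fsetD1K ju).
have ju' : j \notin (u `\ j)%fset by rewrite !inE eqxx.
rewrite sum_fpowerset1U// -big_split big_seq big1//= => v; rewrite fpowersetE => vu.
have jv : j \notin v by apply: contra ju'; exact: (fsubsetP vu).
have -> : ftrunc S (j |` v)%fset x = ftrunc S v x.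
  apply/funext => i; rewrite /ftrunc /trunc !inE.
  by case: eqP => [->|//] /=; rewrite xja; case: ifP.
have E : \prod_(i <- (u `\ j)%fset) (if i \in (j |` v)%fset then 1 else -1) =
    \prod_(i <- (u `\ j)%fset) (if i \in v then 1 else -1) :> R.
  by apply: eq_big_seq => i; rewrite !inE; case: eqP.
rewrite -mulrDl /sgn !big_fsetU1//= (negbTE jv) !inE eqxx /= E.
by rewrite mul1r mulN1r addNr mul0r.
Qed.

Section points.
Context (u : {fset nat}) d' (T : measurableType d') (n : nat) (t : 'I_n -> R)
  (xi : 'I_n -> u -> T -> D) (b : D).
Hypothesis ba : b <> a.

Let xt i (w : prod_space u T) : nat -> D := extend a (fun j => xi i j (w j)).

(* A sampled coordinate may hit the anchor by chance; such a point is replaced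
   by one avoiding the anchor, with weight 0, as [anch f u] vanishes there. *)
Let xt' i w : nat -> D := fun j => if xt i w j == a then b else xt i w j.
Let ind i w : R := \prod_(j <- u) (xt i w j != a)%:R.

Let pairs := [seq (i, v) | i <- enum 'I_n, v <- fpowerset u].

(* Each quadrature point is used at its [2 ^ #|u|] truncations, as required by [anch]. *)
Definition qsets : seq {fset nat} := [seq p.2 | p <- pairs].

Definition qpts (w : prod_space u T) : seq (R * XX) :=
  [seq (t p.1 * ind p.1 w * sgn R u p.2, pt S (ftrunc S p.2 (xt' p.1 w))) | p <- pairs].

Lemma size_qpts w : size (qpts w) = size qsets.
Proof. by rewrite !size_map. Qed.

Lemma size_qsets : size qsets = (n * 2 ^ #|` u|)%N.
Proof. by rewrite size_map size_allpairs size_enum_ord card_fpowerset. Qed.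

Lemma qsets_sub v : v \in qsets -> (v `<=` u)%fset.
Proof.
by move=> /mapP[_ /allpairsP[[i v'] /= [_ + ->]] ->]; rewrite fpowersetE.
Qed.

Lemma qpts_support w i : (i < size qsets)%N ->
  exact_support S (nth fset0 qsets i) (\val (nth (0, apt S) (qpts w) i).2).
Proof.
rewrite /qsets /qpts size_map; case E : pairs => [//|p0 ps]; rewrite -E => ip'.
rewrite !(nth_map p0)//=; have := mem_nth p0 ip'; set p := nth p0 pairs i.
move=> /allpairsP[[l v] /= [_ + ->]] /=; rewrite fpowersetE => vu.
rewrite pt_id; last exact: XX_ftrunc.
move=> j; rewrite /ftrunc /trunc /xt'; case: ifP => // jv.
by split => // _; case: eqP.
Qed.

Lemma sum_qpts (f : XX -> R) w :
  \sum_(p <- qpts w) p.1 * f p.2 = aquad (S := S) t xi f w.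
Proof.
rewrite big_map big_allpairs_dep /= /aquad /quad big_enum/=; apply: eq_bigr => i _.
transitivity (t i * ind i w * anch f u (xt' i w)).
  by rewrite /anch mulr_sumr; apply: eq_bigr => v _; rewrite mulrA.
rewrite -mulrA; congr (_ * _).
have [/allP xa|/allPn[j ju]] := boolP (all (fun j => xt i w j != a) u).
  rewrite /ind big_seq big1 => [|j ju]; last by rewrite xa.
  rewrite mul1r -/(xt i w); apply: eq_big_seq => v; rewrite fpowersetE => vu.
  congr (_ * f (pt S _)); apply/funext => j; rewrite /ftrunc /trunc /xt'.
  by case: ifP => // jv; rewrite (negbTE (xa j (fsubsetP vu _ jv))).
rewrite negbK => /eqP xja; rewrite -/(xt i w) (anch_eq0 f ju xja).
by rewrite /ind (big_rem j) //= xja eqxx !mul0r.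
Qed.

End points.

Lemma quad_achievable (u : {fset nat}) (n : nat) d' (T : measurableType d') (P : probability T R)
  (Pu : probability (prod_space u T) R) (t : 'I_n -> R) (xi : 'I_n -> u -> T -> D)
  (b : {fset nat} -> R) :
  is_product_measure P Pu ->
  (forall i j, measurable_fun setT (xi i j) /\
        forall A, measurable A -> P (xi i j @^-1` A) = rho A) ->
  (forall rhou : probability (prod_space u D) R,
        is_product_measure rho rhou ->
        forall f : prod_space u D -> R, f \in Lfun rhou 2%:E ->
        ('E_Pu[quad t xi f] = \int[rhou]_z (f z)%:E)%E) ->
  (forall v h, (v `<=` u)%fset -> H v h ->
    ('V_Pu[quad t xi (fun z => h (extend a z))] <= (b v * rkhs_ip (H v) h h)%:E)%E) ->
  (forall v, (v `<=` u)%fset -> 0 <= b v) ->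
  achievable (S := S) (qsets u n)
    (fun f => \sum_(v <- fpowerset u) sgn R u v * L (fun j => j \in v) f)
    ((2 ^ #|` u|)%:R * (gam S u * tail S predT) * \sum_(v <- fpowerset u) b v * kpow S u v).
Proof.
move=> PuP mxi unb Vb b0; have [c ca] := exists_neq_a S.
exists _, (prod_space u T), Pu, (qpts t xi c); split.
- by move=> w; exact: size_qpts.
- by move=> w i; exact: qpts_support.
move=> f Hf X; have -> : X = aquad (S := S) t xi f.
  by apply/funext => w; exact: sum_qpts.
have [X2 V2] := aquad_Lfun2_var t PuP mxi Hf; split => //.
  exact: (mean_aquad unb Hf).
apply: le_trans (V2 b Vb b0) _; rewrite lee_fin -!mulrA ler_wpM2l//.
rewrite le_eqVlt; apply/orP; left; apply/eqP.
rewrite mulr_suml !mulr_sumr; apply: eq_bigr => v _.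
by ring.
Qed.

End quadrature_algorithm.

Lemma mean_square_error d (T : measurableType d) (R : realType) (P : probability T R)
    (X : T -> R) c : X \in Lfun P 2%:E ->
  (\int[P]_w ((c - X w) ^+ 2)%:E = ((c - \int[P]_w X w) ^+ 2)%:E + 'V_P[X])%E.
Proof.
move=> X2; set m := \int[P]_w X w; rewrite variance_int -/m.
have iX := Lfun2_integrable X2.
pose B := - 2 * (c - m); pose A := (c - m) ^+ 2 - B * m.
have iA : P.-integrable setT (EFin \o cst A) by exact: finite_measure_integrable_cst.
have iB : P.-integrable setT (fun w => (B%:E * (X w)%:E)%E) by exact: integrableZl.
have iAB : P.-integrable setT (fun w => ((cst A w)%:E + (B%:E * (X w)%:E))%E) by exact: integrableD.
have iV : P.-integrable setT (fun w => ((X w - m) ^+ 2)%:E).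
  exact: (Lfun2_integrable_sqr (Lfun2_sub_cst m X2)).
transitivity (\int[P]_w (((cst A w)%:E + B%:E * (X w)%:E) + ((X w - m) ^+ 2)%:E))%E.
  apply: eq_integral => w _; rewrite -EFinM -!EFinD; congr (_%:E).
  by rewrite /A /B /=; ring.
rewrite integralD//; congr (_ + _)%E.
have IA : (\int[P]_w (cst A w)%:E = A%:E)%E.
  rewrite -[LHS]/(\int[P]_w (cst A%:E w))%E (integral_cst P measurableT).
  by rewrite [X in (_ * X)%E](_ : _ = 1%E) ?mule1; last exact: probability_setT.
rewrite integralD// integralZl// IA.
rewrite -(fineK (integrable_fin_num measurableT iX)) -[fine _]/m -EFinM -EFinD.
by congr (_%:E); rewrite /A; ring.
Qed.

Section to_A_res.
Context (R : realType) d (D : measurableType d) (S : setting R D).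
Local Notation mu := (mu S).
Local Notation a := (a S).
Local Notation HK := (HK S).
Local Notation ip := (rkhs_ip HK).
Context (cost : nat -> \bar R).
Hypothesis cost_mono : forall nu nu', (nu <= nu')%N -> (cost nu <= cost nu')%E.

Lemma point_cost_exact v x : exact_support S v x -> point_cost a cost x = cost #|` v|.
Proof.
move=> vx; apply/eqP; rewrite eq_le; apply/andP; split.
  apply: ereal_inf_lbound; exists v => // j jv.
  by apply: contrapT => xja; move/negP: jv; apply; apply/vx.
apply: le_ereal_inf_tmp => _ [w wx <-]; apply: cost_mono; apply: fsubset_leq_card.
apply/fsubsetP => j /vx xja; apply: contrapT => /negP jw; exact/xja/wx.
Qed.

Lemma achievable_A_res (vs : seq {fset nat}) m V (e : R) : achievable (S := S) vs m V ->
  0 <= V -> 0 <= e ->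
  (forall f, HK f -> (I_mu mu f - m f) ^+ 2 <= e * ip f f) ->
  exists Q, [/\ A_res HK a cost Q,
    (cost_on a cost Q (rkhs_ball HK) <= \sum_(v <- vs) cost #|` v|)%E &
    (error_on mu Q (rkhs_ball HK) <= (Num.sqrt (e + V))%:E)%E].
Proof.
move=> [d' [T [P [pts [szE supE XE]]]]] V0 e0 bias.
pose Q := RandomizedAlgorithm P (fun w => linear_strategy (pts w) 0).
have runE f w : run (ra_strategy (r := Q) w) f = \sum_(p <- pts w) p.1 * f p.2.
  by rewrite run_linear_strategy add0r.
(* With exact supports the cost depends neither on [f] nor on [w], as the equality of costs in
   [A_res] demands. *)
have costE f w : run_cost a cost (Q := Q) f w = (\sum_(v <- vs) cost #|` v|)%E.
  rewrite /run_cost sample_points_linear_strategy big_map.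
  rewrite -(big_map (fun p : R * _ => point_cost a cost (\val p.2)) predT id).
  rewrite -[RHS](big_map (fun v : {fset nat} => cost #|` v|) predT id).
  congr (\big[_/_]_(_ <- _) _); apply: (@eq_from_nth _ 0%E).
    by rewrite !size_map.
  move=> i; rewrite size_map => iw.
  rewrite (nth_map (0, apt S))// (nth_map fset0) -?(szE w)//.
  by apply: point_cost_exact; apply: supE; rewrite -(szE w).
have ecostE f : expected_cost a cost Q f = (\sum_(v <- vs) cost #|` v|)%E.
  rewrite /expected_cost (eq_integral (cst (\sum_(v <- vs) cost #|` v|)%E)); last first.
    by move=> w _; rewrite costE.
  rewrite (integral_cst P measurableT).
  by rewrite [X in (_ * X)%E](_ : _ = 1%E) ?mule1; last exact: probability_setT.
exists Q; split.
- split.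
    move=> f Hf; split.
      rewrite (_ : (fun w => _) = fun w => \sum_(p <- pts w) p.1 * f p.2).
        by have [] := XE f Hf.
      by apply/funext => w; rewrite runE.
    by rewrite (_ : run_cost a cost f = cst (\sum_(v <- vs) cost #|` v|)%E)//; apply/funext => w; rewrite costE.
  exists vs => f Hf; split; last exact: ecostE.
  move=> w /=; rewrite sample_points_linear_strategy !size_map szE; split => // i iw.
  rewrite -map_comp (nth_map (0, apt S)) ?szE//= => j jv.
  by apply: contrapT => /(supE w i iw j).2; apply/negP.
- by apply: ge_ereal_sup => _ [f _ <-]; rewrite ecostE.
rewrite /error_on -powR12_sqrt; last by rewrite addr_ge0.
rewrite -poweR_EFin; apply: gt0_ler_poweR.
- by rewrite invr_ge0.
- rewrite in_itv/= leey andbT.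
  have ball0 : rkhs_ball HK (fun=> 0).
    split; first exact: (rkhs_zero HK).
    by rewrite /rkhs_norm rkhs_ip0l ?sqrtr0//; exact: (rkhs_zero HK).
  apply: (le_trans _ (ereal_sup_ubound (ex_intro2 _ _ _ ball0 erefl))).
  by apply: integral_ge0 => w _; rewrite lee_fin sqr_ge0.
- by rewrite in_itv/= leey lee_fin addr_ge0.
apply: ge_ereal_sup => _ [f [Hf f1] <-].
have [X2 mX VX] := XE f Hf.
have f1' : ip f f <= 1.
  rewrite -(sqr_sqrtr (rkhs_ip_ge0 Hf)); apply: exprn_ile1; first exact: sqrtr_ge0.
  exact: f1.
under eq_integral do rewrite runE.
rewrite (mean_square_error _ X2) mX.
have ip0 := rkhs_ip_ge0 Hf.
apply: (le_trans (leeD (lexx _) VX)); rewrite -EFinD lee_fin lerD//.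
  by apply: le_trans (bias f Hf) _; rewrite ler_piMr.
by rewrite ler_piMr.
Qed.

End to_A_res.

(** * The quadrature assumption *)

(** This is [ln z <= z - 1] at [z = (1 + t) * e]: the slope can be made arbitrarily small at the
    price of a constant. *)
Lemma ln_1D_le (R : realType) (e t : R) : 0 < e -> 0 <= t ->
  ln (1 + t) <= e * t + (e - 1 - ln e).
Proof.
move=> e0 t0; have t1 : 0 < 1 + t by lra.
have : ln ((1 + t) * e) <= (1 + t) * e - 1.
  have := @le_ln1Dx R ((1 + t) * e - 1); rewrite [X in ln X](addrC 1) subrK; apply.
  by rewrite ltrBrDr addNr mulr_gt0.
by rewrite lnM ?posrE//; lra.
Qed.

(* The logarithmic factor costs an arbitrarily small power of [n] and a
   factor exponential in the number of coordinates. *)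
Lemma Ffactor_bound (R : realType) (alpha1 alpha2 eta : R) : 0 <= alpha1 ->
  0 <= alpha2 <= 1 -> 0 < eta -> exists2 K : R, 1 <= K &
  forall m n N, (m <= N)%N -> 0 <= Ffactor alpha1 alpha2 m n <= K ^+ N * n.+1%:R `^ eta.
Proof.
move=> a1 /andP[a20 a21] eta0.
(* Chosen so that [alpha1 * e <= eta]; the [+ 1] covers [alpha1 = 0]. *)
pose e := eta / (alpha1 + 1); have e0 : 0 < e by rewrite divr_gt0// ltr_wpDl.
pose c := e - 1 - ln e.
have c0 : 0 <= c by have := ln_1D_le e0 (lexx 0); rewrite addr0 ln1 mulr0 add0r.
have K1 : 1 <= expR (alpha1 * c) by rewrite -expR0 ler_expR mulr_ge0.
exists (expR (alpha1 * c)) => // m n N mN.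
have n1 : 1 <= n.+1%:R :> R by rewrite ler1n.
have L0 : 0 <= ln n.+1%:R :> R by exact: ln_ge0.
have n1e : 1 <= n.+1%:R `^ eta by rewrite -[leLHS](powRr0 n.+1%:R) ler_powR// ltW.
rewrite /Ffactor; case: leqP => m1.
  by rewrite ler01 /=; have := ler_pM ler01 ler01 (exprn_ege1 N K1) n1e; rewrite mulr1.
rewrite powR_ge0 /=; set x := m.-1%:R `^ alpha2.
have m1R : 1 <= m.-1%:R :> R by rewrite ler1n -ltnS prednK// ltnW.
have x1 : 1 <= x by rewrite -[leLHS](powRr0 m.-1%:R) ler_powR.
have xm : x <= N%:R.
  apply: (@le_trans _ _ m.-1%:R).
    by rewrite -[leRHS]powRr1 ?ler_powR// (le_trans ler01).
  by rewrite ler_nat (leq_trans (leq_pred m)).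
have x0 : 0 < x by lra.
have t0 : 0 <= ln n.+1%:R / x by rewrite divr_ge0// ltW.
rewrite /powR ifF; last by apply/negbTE; rewrite gt_eqF// ltr_wpDr.
rewrite (_ : n.+1%:R == 0 = false); last by apply/negbTE; rewrite gt_eqF//; lra.
rewrite -expRM_natl -expRD ler_expR.
apply: le_trans (_ : alpha1 * x * (e * (ln n.+1%:R / x) + c) <= _).
  apply: ler_wpM2l; first by rewrite mulr_ge0// ltW.
  exact: ln_1D_le.
(* The exponent [x] cancels against the denominator inside the logarithm. The remaining [x] is at
   most [N] because [alpha2 <= 1]. *)
have -> : alpha1 * x * (e * (ln n.+1%:R / x) + c) = alpha1 * e * ln n.+1%:R + x * (alpha1 * c).
  by field; rewrite gt_eqF.
rewrite addrC; apply: lerD.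
  by apply: ler_wpM2r => //; rewrite mulr_ge0.
rewrite ler_wpM2r// /e mulrA ler_pdivrMr ?ltr_wpDl//; nra.
Qed.

Section sums.
Context (R : realType) d (D : measurableType d) (S : setting R D).
Local Notation rho := (rho S).
Local Notation mu := (mu S).
Local Notation a := (a S).
Local Notation HK := (HK S).
Local Notation H := (H S).
Local Notation XX := (XX S).
Local Notation ip := (rkhs_ip HK).

(** The integral of the anchored component with index [u]. *)
Definition anch_mean (u : {fset nat}) (f : XX -> R) : R :=
  \sum_(v <- fpowerset u) sgn R u v * L (fun j => j \in v) f.

Lemma achievable_le vs m (V V' : R) : V <= V' -> achievable (S := S) vs m V ->
  achievable (S := S) vs m V'.
Proof.
move=> VV' [d' [T [P [pts [szE supE XE]]]]]; exists d', T, P, pts; split => // f Hf X.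
have [X2 mX VX] := XE f Hf; split => //; apply: le_trans VX _.
by rewrite lee_fin ler_wpM2r// rkhs_ip_ge0.
Qed.

Lemma achievable_eq vs m m' (V : R) : m =1 m' -> achievable (S := S) vs m V ->
  achievable (S := S) vs m' V.
Proof. by move=> /funext ->. Qed.

Lemma sum_kpow (u : {fset nat}) : \sum_(v <- fpowerset u) kpow S u v = (1 + kap S) ^+ #|` u|.
Proof.
by rewrite prod_fpowerset big_const_seq count_predT iter_mulr_1.
Qed.

Lemma tail_ge0 w : 0 <= tail S w.
Proof.
apply: limr_ge; first by apply/cvg_ex; eexists; exact: (@cvg_tail _ _ _ S w).
apply: nearW => n; apply: le_trans (nprod_ge1 _ _) => // j.
by case: ifP => // _; exact: ghat_ge0.
Qed.

Lemma gam_sub (u v : {fset nat}) : (v `<=` u)%fset -> 0 < gam S u -> 0 < gam S v.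
Proof.
move=> vu; rewrite !lt_def !gam_ge0 !andbT; apply: contraNN.
rewrite /gam !prodf_seq_eq0 => /hasP[j jv gj]; apply/hasP; exists j => //.
exact: (fsubsetP vu).
Qed.

Lemma quadrature_achievable tau eta : quadrature_assumption rho (gam S) H a tau -> 0 < eta ->
  exists c1 B : R, [/\ 0 <= c1, 0 <= B & forall (u : {fset nat}) n,
    u != fset0 -> 0 < gam S u -> (0 < n)%N ->
    achievable (qsets u n) (anch_mean u)
      (c1 * (B ^+ #|` u| * gam S u) * n.+1%:R `^ (- tau + eta))].
Proof.
move=> [c [C [alpha1 [alpha2 [[c0 C0 tau0 a1 a2] hQ]]]]] eta0.
have [K K1 FK] := Ffactor_bound a1 a2 eta0.
have K0 : 0 <= K by lra.
have kap0 := kap_gt0 S; have t0 := tail_ge0 predT.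
(* In the base, [2] counts the truncations, [C] comes from (Q), [K] from the logarithmic factor, and
   [1 + kap S] from summing [kpow] over the subsets. *)
exists (c * tail S predT), (2 * C * K * (1 + kap S)); split.
- by rewrite mulr_ge0// ltW.
- by rewrite !mulr_ge0//; lra.
move=> u n u0 gu n0.
have [d' [T [P [Pu [t [xi [PuP t1 mxi unb Vb]]]]]]] := hQ u n u0 gu n0.
pose b (v : {fset nat}) := c * C ^+ #|` u| * n.+1%:R `^ (- tau) * Ffactor alpha1 alpha2 #|` v| n.
have cC0 : 0 <= c * C ^+ #|` u| * n.+1%:R `^ (- tau).
  by rewrite !mulr_ge0 ?powR_ge0 ?exprn_ge0 ?ltW.
have bK (v : {fset nat}) : (v `<=` u)%fset -> 0 <= b v <=
    c * C ^+ #|` u| * n.+1%:R `^ (- tau) * (K ^+ #|` u| * n.+1%:R `^ eta).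
  move=> vu; have /andP[F0 FKv] := FK _ n _ (fsubset_leq_card vu).
  by rewrite /b mulr_ge0//= ler_wpM2l.
apply: (@achievable_le _ _ _ _ _ (@quad_achievable _ _ _ S u n _ T P Pu t xi b PuP mxi unb _ _)).
- rewrite powRD; last by rewrite pnatr_eq0 implybT.
  apply: (@le_trans _ _ ((2 ^ #|` u|)%:R * (gam S u * tail S predT) *
    \sum_(v <- fpowerset u) c * C ^+ #|` u| * n.+1%:R `^ (- tau) *
      (K ^+ #|` u| * n.+1%:R `^ eta) * kpow S u v)).
    rewrite ler_wpM2l ?mulr_ge0 ?gam_ge0//.
    rewrite big_seq [leRHS]big_seq; apply: ler_sum => v; rewrite fpowersetE => vu.
    by rewrite ler_wpM2r ?kpow_ge0//; have /andP[] := bK v vu.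
  rewrite -mulr_sumr sum_kpow natrX !exprMn le_eqVlt; apply/orP; left; apply/eqP.
  by ring.
- move=> v h vu Hh; have := Vb v vu (gam_sub vu gu) h Hh.
  by rewrite /rkhs_norm sqr_sqrtr// rkhs_ip_ge0.
- by move=> v vu; have /andP[] := bK v vu.
Qed.

Lemma achievable_sum (s : seq {fset nat}) (nn : {fset nat} -> nat) (V : {fset nat} -> R) :
  (forall u, u \in s -> achievable (qsets u (nn u)) (anch_mean u) (V u)) ->
  achievable (S := S) (flatten [seq qsets u (nn u) | u <- s])
    (fun f => \sum_(u <- s) anch_mean u f) (\sum_(u <- s) V u).
Proof.
elim: s => [|u s IH] sA.
  rewrite big_nil; apply: achievable_eq (achievable_nil S) => f.
  by rewrite big_nil.
rewrite big_cons /=.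
have sA' u' : u' \in s -> achievable (qsets u' (nn u')) (anch_mean u') (V u').
  by move=> us; apply: sA; rewrite inE us orbT.
apply: achievable_eq (achievableD (sA u (mem_head _ _)) (IH sA')) => f.
by rewrite big_cons.
Qed.

Definition downset (A : {fset {fset nat}}) : Prop :=
  fset0 \in A /\ forall u v : {fset nat}, u \in A -> (v `<=` u)%fset -> v \in A.

Lemma prod_notin_sym (u v : {fset nat}) :
  \prod_(j <- u) (j \notin v)%:R = \prod_(j <- v) (j \notin u)%:R :> R.
Proof.
have dis (x y : {fset nat}) : \prod_(j <- x) (j \notin y)%:R = [disjoint x & y]%fset%:R :> R.
  have [/fdisjointP xy|] := boolP [disjoint x & y]%fset.
    by rewrite big_seq big1// => j jx; rewrite xy.
  move=> /fset0Pn[j]; rewrite in_fsetI => /andP[jx jy].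
  by rewrite (big_rem j) //= jy mul0r.
by rewrite !dis fdisjoint_sym.
Qed.

Lemma sgn_prod_notin (u w : {fset nat}) :
  \sum_(v <- fpowerset u) sgn R u v * \prod_(j <- w) (j \notin v)%:R =
  \prod_(j <- u) (- (j \in w)%:R).
Proof.
transitivity (\prod_(j <- u) ((j \notin w)%:R + (-1)) : R); last first.
  by apply: eq_bigr => j _; case: (j \in w) => /=; ring.
rewrite -prod_fpowerset; apply: eq_big_seq => v; rewrite fpowersetE => vu.
rewrite prod_notin_sym -(prod_fsubset _ vu) /sgn -big_split /=.
by apply: eq_bigr => j _; case: ifP; rewrite ?mul1r ?mulr1.
Qed.

(** The coefficient of [w] is the sum of [(-1)^|u|] over the [u] in [A] contained in [w]. If [w] is
    nonempty and in [A], all its subsets occur and the sum vanishes; otherwise it is at most [2^|w|]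
    in absolute value, whence [4^|w|] after squaring. *)
Lemma bias_downset (A : {fset {fset nat}}) (b : R) : downset A ->
  (forall n, \sum_(w <- fpowerset (fiota n) | w \notin A) \prod_(j <- w) (4 * ghat S j) <= b) ->
  forall f, HK f ->
    (I_mu mu f - \sum_(u <- A) anch_mean u f) ^+ 2 <= b * ip f f.
Proof.
move=> [A0 Ad] Ab f Hf.
pose s : seq (R * {fset nat}) := [seq (sgn R u v, v) | u <- A, v <- fpowerset u].
have sumE (F : {fset nat} -> R) : \sum_(p <- s) p.1 * F p.2 =
    \sum_(u <- A) \sum_(v <- fpowerset u) sgn R u v * F v.
  by rewrite big_allpairs_dep.
rewrite -[X in I_mu mu f - X](sumE (fun v => L (fun j => j \in v) f)).
apply: bias_bound => //.
  have := sumE (fun=> 1); under eq_bigr do rewrite mulr1; move=> ->.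
  rewrite (big_fsetD1 fset0)//= fpowerset0 big_seq_fset1 /sgn big_seq_fset0 mulr1.
  rewrite big_seq big1 ?addr0// => u; rewrite !inE => /andP[u0 _].
  rewrite (eq_bigr (fun v : {fset nat} => sgn R u v * \prod_(j <- fset0) (j \notin v)%:R)); last first.
    by move=> v _; rewrite big_seq_fset0.
  rewrite sgn_prod_notin; have [//|[j ju]] := fset_0Vmem u; first by move=> ue; rewrite ue eqxx in u0.
  by rewrite (big_rem j)//= oppr0 mul0r.
move=> n; apply: le_trans (Ab n).
rewrite big_mkcond [leRHS]big_mkcond; apply: ler_sum => w _.
have ghw : 0 <= \prod_(j <- w) ghat S j by apply: prodr_ge0 => j _; exact: ghat_ge0.
case: eqVneq => [->|w0] /=.
  by case: ifP => // _; apply: prodr_ge0 => j _; rewrite mulr_ge0// ghat_ge0.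
rewrite (sumE (fun v => \prod_(j <- w) (j \notin v)%:R)) /=.
rewrite [X in X ^+ 2](eq_bigr _ (fun u _ => sgn_prod_notin u w)).
have vanish (u : {fset nat}) : ~~ (u `<=` w)%fset -> \prod_(j <- u) (- (j \in w)%:R) = 0 :> R.
  by move=> /fsubsetPn[j ju /negbTE jw]; rewrite (big_rem j)//= jw oppr0 mul0r.
have [wA|wA] := boolP (w \in A).
  rewrite (_ : \sum_(u <- A) _ = 0) ?expr0n ?mulr0//.
  rewrite (_ : \sum_(u <- A) _ = \sum_(u <- fpowerset w) \prod_(j <- u) (- (j \in w)%:R)).
    rewrite sum_fpowerset_prod; have [we|[j jw]] := fset_0Vmem w.
      by rewrite we eqxx in w0.
    by rewrite (big_rem j)//= jw subrr mul0r.
  rewrite [RHS](big_fset_incl _ (_ : (fpowerset w `<=` A)%fset)) //.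
    by apply/fsubsetP => u; rewrite fpowersetE; exact: Ad.
  by move=> u uA; rewrite fpowersetE => /vanish.
rewrite [leRHS]big_split /= [X in _ <= X * _]big_const_seq count_predT iter_mulr_1 [leRHS]mulrC ler_wpM2l//.
have -> : 4 ^+ #|` w| = (2 ^+ #|` w|) ^+ 2 :> R by rewrite -exprM mulnC exprM; congr (_ ^+ _); ring.
rewrite -real_normK ?num_real// ler_pXn2r ?nnegrE ?exprn_ge0//.
apply: le_trans (ler_norm_sum _ _ _) _.
apply: (@le_trans _ _ (\sum_(u <- A) (u `<=` w)%fset%:R)).
  apply: ler_sum => u _; have [uw|/vanish ->] := boolP (u `<=` w)%fset; last by rewrite normr0.
  rewrite normr_prod; apply: Num.Theory.prodr_ile1 => j _; rewrite normrN normr_ge0 /=.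
  by case: (j \in w); rewrite ?normr1 ?normr0.
rewrite -natr_sum -natrX ler_nat -card_fpowerset.
rewrite (eq_bigr (fun u => if (u `<=` w)%fset then 1%N else 0%N)); last by move=> u _; case: ifP.
rewrite -big_mkcond sum1_count -size_filter; apply: uniq_leq_size; first exact: filter_uniq (fset_uniq A).
by move=> u; rewrite mem_filter fpowersetE => /andP[].
Qed.

End sums.

(** * The upper bound *)

Section allocation.
Context (R : realType).

Lemma powRV (x r : R) : 0 <= x -> x^-1 `^ r = (x `^ r)^-1.
Proof. by move=> x0; rewrite -!powR_inv1 ?powR_ge0// powRAC. Qed.

Lemma prod_powR (T : eqType) (s : seq T) (y : T -> R) p : (forall j, 0 <= y j) ->
  \prod_(j <- s) y j `^ p = (\prod_(j <- s) y j) `^ p.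
Proof.
move=> y0; elim: s => [|j s IH]; first by rewrite !big_nil powR1.
by rewrite !big_cons IH powRM// prodr_ge0.
Qed.

Lemma sum_expR_bound (y : nat -> R) (S : R) n : (forall j, 0 <= y j) ->
  \sum_(0 <= j < n) y j <= S ->
  \sum_(u <- fpowerset (fiota n)) \prod_(j <- u) y j <= expR S.
Proof.
move=> y0 yS; rewrite -/(subset_sum (fun u => \prod_(j <- u) y j) n) subset_sum_prod.
by apply: le_trans (nprod_expR n y0) _; rewrite ler_expR.
Qed.

Lemma bounded_sum_eventually_lt (y : nat -> R) (S e : R) : (forall j, 0 <= y j) ->
  (forall n, \sum_(0 <= j < n) y j <= S) -> 0 < e -> exists n0, forall j, (n0 <= j)%N -> y j < e.
Proof.
move=> y0 yS e0.
have /cvg_series_cvg_0 /cvgrPdist_lt /(_ e e0) [n0 _ n0P] : cvgn (series y).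
  apply: nondecreasing_is_cvgn.
    by apply/nondecreasing_seqP => n; rewrite !seriesEnat/= big_nat_recr//= lerDl.
  by exists S => _ [n _ <-]; rewrite seriesEnat/=.
by exists n0 => j /n0P /=; rewrite sub0r normrN ger0_norm.
Qed.

(* [A] collects the coordinate sets with [X * \prod_u y >= 1], and [u] gets about
   that many sample points. *)
Lemma allocation (y x : nat -> R) (S A0 beta B1 : R) :
  (forall j, 0 <= y j <= 1) -> (forall n, \sum_(0 <= j < n) y j <= S) ->
  0 <= A0 -> 0 < beta -> 0 <= B1 -> (forall j, 0 <= x j) ->
  (forall u : {fset nat}, \prod_(j <- u) x j <= A0 * (\prod_(j <- u) y j) `^ (1 + beta)) ->
  exists2 K : R, 0 < K & forall X : R, 1 <= X ->
  exists (A : {fset {fset nat}}) (nn : {fset nat} -> nat),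
  [/\ downset A,
      forall u, u \in A -> (0 < nn u)%N /\ 0 < \prod_(j <- u) y j,
      \sum_(u <- A) B1 ^+ #|` u| * (nn u)%:R <= K * X,
      forall n, \sum_(w <- fpowerset (fiota n) | w \notin A) \prod_(j <- w) x j <=
        K * X `^ (- beta) &
      \sum_(u <- A) \prod_(j <- u) x j * (nn u)%:R `^ (- beta) <= K * X `^ (- beta)].
Proof.
move=> y01 yS A00 b0 B10 x0 xy.
have y0 j : 0 <= y j by have /andP[] := y01 j.
pose Y (u : {fset nat}) := \prod_(j <- u) y j.
have Y0 u : 0 <= Y u by exact: prodr_ge0.
have Y1 u : Y u <= 1 by apply: Num.Theory.prodr_ile1.
have Ysub (u v : {fset nat}) : (v `<=` u)%fset -> Y u <= Y v.
  move=> vu; rewrite /Y (big_fsetID _ (fun j => j \in v)) /=.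
  rewrite (_ : [fset j in u | j \in v]%fset = v); last first.
    by apply/fsetP => j; rewrite !inE andbC; case: (boolP (j \in v)) => // /(fsubsetP vu) ->.
  by rewrite ler_piMr ?prodr_ge0//; apply: Num.Theory.prodr_ile1.
have YD u : Y u `^ (1 + beta) = Y u * Y u `^ beta.
  rewrite powRD ?powRr1//; first by rewrite (_ : 1 + beta == 0 = false)//; apply/negbTE; lra.
have Xb0 (X : R) : 0 <= X `^ (- beta) by exact: powR_ge0.
have S0 : 0 <= S by apply: le_trans (yS 0%N); rewrite big_nil.
pose K := expR (B1 * S) + A0 * expR S * (1 + 2 `^ beta).
have K0 : 0 < K.
  by rewrite ltr_pwDl ?expR_gt0// !mulr_ge0 ?expR_ge0 ?addr_ge0 ?powR_ge0.
exists K => // X X1.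
have X0 : 0 < X by lra.
(* A coordinate from [n0] on already forces [X * Y u < 1], so the restriction to [fiota n0] makes
   [A] finite without excluding any set. *)
have [n0 n0P] := @bounded_sum_eventually_lt y S X^-1 y0 yS (eq_ind_r is_true X0 (invr_gt0 X)).
pose A := [fset u in fpowerset (fiota n0) | 1 <= X * Y u]%fset.
have AE u : (u \in A) = (u `<=` fiota n0)%fset && (1 <= X * Y u).
  by rewrite !inE fpowersetE.
have notA w : w \notin A -> X * Y w < 1.
  rewrite AE negb_and -ltNge => /orP[/fsubsetPn[j jw]|//].
  rewrite in_fiota -leqNgt => /n0P yj.
  have : Y w <= y j by have := @Ysub w [fset j]%fset; rewrite /Y big_seq_fset1; apply; rewrite fsub1set.
  by move=> /le_lt_trans/(_ yj); rewrite -[X^-1]mul1r ltr_pdivlMr// mulrC.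
pose nn u := Num.trunc (X * Y u).
have XY0 u : 0 <= X * Y u by rewrite mulr_ge0// ltW.
have nnX u : (nn u)%:R <= X * Y u by rewrite truncn_le.
have Xnn u : X * Y u < (nn u).+1%:R by exact: truncnS_gt.
have nn0 u : u \in A -> (0 < nn u)%N.
  rewrite AE => /andP[_ XY]; rewrite lt0n; apply: contraTneq (Xnn u) => ->.
  by rewrite -leNgt.
have Apos u : u \in A -> 0 < Y u.
  by rewrite AE lt_def Y0 andbT => /andP[_]; apply: contraTneq => ->; rewrite mulr0 -ltNge.
have sumA (F G : {fset nat} -> R) : (forall u, 0 <= G u) -> (forall u, u \in A -> F u <= G u) ->
    \sum_(u <- A) F u <= \sum_(u <- fpowerset (fiota n0)) G u.
  move=> G0 FG; apply: (@le_trans _ _ (\sum_(u <- A) G u)).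
    by rewrite big_seq [leRHS]big_seq; exact: ler_sum.
  have -> : \sum_(u <- A) G u = \sum_(u <- fpowerset (fiota n0)) if u \in A then G u else 0.
    rewrite -(big_fset_incl _ (_ : (A `<=` fpowerset (fiota n0))%fset)).
    - by apply: eq_big_seq => u ->.
    - by apply/fsubsetP => u; rewrite AE fpowersetE => /andP[].
    - by move=> u _ /negbTE ->.
  by apply: ler_sum => u _; case: ifP.
exists A, nn; split.
- split; first by rewrite AE fsub0set /Y big_seq_fset0 mulr1.
  move=> u v; rewrite !AE => /andP[un Yu] vu; rewrite (fsubset_trans vu un) /=.
  by apply: le_trans Yu _; rewrite ler_wpM2l ?Ysub// ltW.
- by move=> u uA; split; [exact: nn0|exact: Apos].
- apply: (@le_trans _ _ (\sum_(u <- fpowerset (fiota n0)) X * \prod_(j <- u) (B1 * y j))).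
    apply: sumA => [u|u _].
      by apply: mulr_ge0; [exact: ltW|apply: prodr_ge0 => j _; exact: mulr_ge0].
    rewrite big_split /= big_const_seq count_predT iter_mulr_1 mulrCA.
    by rewrite ler_wpM2l ?exprn_ge0.
  rewrite -mulr_sumr [leRHS]mulrC; apply: ler_wpM2l; first exact: ltW.
  apply: le_trans (_ : _ <= expR (B1 * S)) _.
    apply: sum_expR_bound => [j|]; first by rewrite mulr_ge0.
    by rewrite -mulr_sumr ler_wpM2l.
  by rewrite lerDl !mulr_ge0 ?expR_ge0 ?addr_ge0 ?powR_ge0.
- move=> n.
  (* Outside [A] one has [Y w < 1 / X]: the power [beta] of [Y w] yields the rate, and the remaining
     first power is summable. *)
  apply: (@le_trans _ _ (\sum_(w <- fpowerset (fiota n)) A0 * X `^ (- beta) * Y w)).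
    rewrite big_mkcond; apply: ler_sum => w _; case: ifPn => [/notA XY|_]; last first.
      by rewrite !mulr_ge0.
    apply: le_trans (xy w) _; rewrite -mulrA ler_wpM2l// YD mulrC ler_wpM2r//.
    have YX : Y w <= X^-1 by rewrite -[X^-1]mul1r ler_pdivlMr// mulrC ltW.
    rewrite powRN -powRV; last exact: ltW.
    by apply: ge0_ler_powR => //; rewrite ?nnegrE ?invr_ge0// ltW.
  rewrite -mulr_sumr -mulrA mulrCA mulrC ler_wpM2r// -/(Y _).
  apply: (@le_trans _ _ (A0 * expR S)); first by rewrite ler_wpM2l// sum_expR_bound.
  rewrite /K mulrDr mulr1; have := expR_gt0 (B1 * S); have : 0 <= A0 * expR S * 2 `^ beta.
    by rewrite !mulr_ge0 ?expR_ge0 ?powR_ge0.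
  lra.
- apply: (@le_trans _ _ (\sum_(w <- fpowerset (fiota n0)) A0 * 2 `^ beta * X `^ (- beta) * Y w)).
    apply: sumA => [u|u uA]; first by rewrite !mulr_ge0 ?powR_ge0.
    have Yp := Apos u uA; have np : 0 < (nn u)%:R :> R by rewrite ltr0n nn0.
    apply: (@le_trans _ _ (A0 * (Y u * Y u `^ beta) * (2 `^ beta * X `^ (- beta) * Y u `^ (- beta)))).
      rewrite -YD; apply: ler_pM; rewrite ?powR_ge0 ?prodr_ge0//.
      have -> : 2 `^ beta * X `^ (- beta) * Y u `^ (- beta) = (X * Y u / 2) `^ (- beta).
        rewrite (powRM _ (XY0 u)) ?invr_ge0// (powRM _ (ltW X0) (Y0 u)).
        by rewrite [2^-1 `^ _]powRN (powRV _ (ler0n R 2)) invrK -mulrA mulrC.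
      rewrite !powRN lef_pV2 ?posrE ?powR_gt0 ?divr_gt0 ?mulr_gt0//.
      apply: ge0_ler_powR; rewrite ?nnegrE// ?divr_ge0//; first exact: ltW.
      apply: ltW.
      rewrite ltr_pdivrMr//; apply: lt_le_trans (Xnn u) _.
      by rewrite -natrM ler_nat muln2 -addnn -addn1 leq_add2l nn0.
    rewrite le_eqVlt; apply/orP; left; apply/eqP.
    rewrite [Y u `^ (- beta)]powRN; field; by rewrite gt_eqF// powR_gt0.
  rewrite -mulr_sumr -mulrA mulrCA mulrC ler_wpM2r//.
  apply: (@le_trans _ _ (A0 * 2 `^ beta * expR S)).
    by rewrite ler_wpM2l ?sum_expR_bound// mulr_ge0 ?powR_ge0.
  rewrite /K mulrDr mulr1; have := expR_gt0 (B1 * S); have : 0 <= A0 * expR S.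
    by rewrite !mulr_ge0 ?expR_ge0.
  lra.
Qed.

End allocation.

Section upper_bound.
Context (R : realType) d (D : measurableType d) (S : setting R D).
Local Notation rho := (rho S).
Local Notation mu := (mu S).
Local Notation a := (a S).
Local Notation HK := (HK S).
Local Notation H := (H S).
Local Notation ip := (rkhs_ip HK).
Context (cost : nat -> \bar R).
Hypothesis cost_ge1 : forall nu, (1 <= cost nu)%E.
Hypothesis cost_mono : forall nu nu', (nu <= nu')%N -> (cost nu <= cost nu')%E.

Lemma prod_le_nprod (x : nat -> R) (u : {fset nat}) : (forall j, 0 <= x j) ->
  exists n, \prod_(j <- u) (1 + x j) <= nprod x n.
Proof.
move=> x0; have [n un] := fset_sub_fiota u; exists n.
rewrite /nprod -big_fiota -(prod_fsubset (fun j => 1 + x j) un).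
apply: ler_prod => j _; have := x0 j; case: ifP => _; lra.
Qed.

Lemma sum_ghat_bound : exists2 C, 0 <= C & forall n, \sum_(0 <= j < n) ghat S j <= C.
Proof.
have [C CP] := ghat_bound S; exists C.
  by apply: le_trans (CP 0%N); rewrite /nprod big_nil.
by move=> n; have := sum_le_nprod n (ghat_ge0 S); have := CP n; lra.
Qed.

(** The slack [tau - beta] pays for the logarithmic factor in (Q). The exponent [p'] is one for
    which the powers [1 / p'] of the weights are summable, and [1 + beta <= p'] lets them control
    the weights in [allocation]. *)
Lemma upper_rate tau beta p' T C3 sigma :
  quadrature_assumption rho (gam S) H a tau -> 0 < beta < tau -> 1 + beta <= p' ->
  (forall n, \sum_(0 <= j < n) ghat S j `^ (1 / p') <= T) ->
  (forall nu, (cost nu <= (C3 * expR (sigma * nu%:R))%:E)%E) -> 0 <= sigma ->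
  exists2 C, 0 < C & forall X : R, 1 <= X ->
  exists Q, [/\ A_res HK a cost Q,
    (cost_on a cost Q (rkhs_ball HK) <= (C * X)%:E)%E &
    (error_on mu Q (rkhs_ball HK) <= (Num.sqrt (C * X `^ (- beta)))%:E)%E].
Proof.
move=> hQ /andP[b0 bt] bp Tb costC s0.
have C30 : 0 < C3.
  have := le_trans (cost_ge1 0%N) (costC 0%N); rewrite mulr0 expR0 mulr1 lee_fin; lra.
have eta0 : 0 < tau - beta by lra.
have [c1 [B [c10 B0 qa]]] := quadrature_achievable hQ eta0.
have k0 := kap_gt0 S.
(* With this constant [x j = B * g j + 4 * ghat S j], which dominates both the variance factor
   [B * g j] and the bias factor [4 * ghat S j]. *)
pose c := B / kap S + 4; have c0 : 0 < c by rewrite ltr_wpDl// divr_ge0// ltW.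
pose q := 1 / p'; have p0 : 0 < p' by lra.
have q0 : 0 < q by rewrite divr_gt0.
pose x j := c * ghat S j; have gh0 := ghat_ge0 S.
have x0 j : 0 <= x j by rewrite mulr_ge0// ltW.
pose y j := Num.min 1 (x j `^ q).
have y01 j : 0 <= y j <= 1 by rewrite /y le_min ler01 powR_ge0 ge_min lexx.
have yS n : \sum_(0 <= j < n) y j <= c `^ q * T.
  apply: (@le_trans _ _ (c `^ q * \sum_(0 <= j < n) ghat S j `^ q)).
    rewrite mulr_sumr; apply: ler_sum => j _.
    by rewrite -(powRM _ (ltW c0) (gh0 j)) /y /x ge_min lexx orbT.
  by rewrite ler_wpM2l ?powR_ge0// Tb.
have [Cg Cg0 CgP] := sum_ghat_bound.
have xn n : nprod x n <= expR (c * Cg).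
  apply: le_trans (nprod_expR n x0) _; rewrite ler_expR -mulr_sumr ler_wpM2l ?CgP//.
  exact: ltW.
(* Where [x j <= 1], the exponent [(1 + beta) / p' <= 1] only enlarges it. Where [x j > 1] the cap
   gives [y j = 1], and the excess is absorbed by the bounded product of the [1 + x j]. *)
have xy (u : {fset nat}) : \prod_(j <- u) x j <= expR (c * Cg) * (\prod_(j <- u) y j) `^ (1 + beta).
  have [n un] := prod_le_nprod u x0.
  apply: (@le_trans _ _ (\prod_(j <- u) (1 + x j) * (\prod_(j <- u) y j) `^ (1 + beta))); last first.
    by rewrite ler_wpM2r ?powR_ge0// (le_trans un).
  rewrite -prod_powR; last by move=> j; have /andP[] := y01 j.
  rewrite -big_split; apply: ler_prod => j _; rewrite x0 /=.
  have [x1|x1] := leP (x j) 1.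
    apply: (@le_trans _ _ (y j `^ (1 + beta))); last first.
      by rewrite ler_peMl ?powR_ge0// lerDl.
    have [->|xj] := eqVneq (x j) 0; first exact: powR_ge0.
    have xj0 : 0 < x j <= 1 by rewrite x1 lt_def xj x0.
    have -> : y j = x j `^ q.
      by apply/min_idPr; rewrite -[leRHS](powRr0 (x j)); apply: ger_powR => //; exact: ltW.
    rewrite -powRrM; apply: ger1_powR => //.
    by rewrite /q mulrAC mul1r ler_pdivrMr// mul1r.
  have -> : y j = 1.
    by apply/min_idPl; rewrite -[leLHS](powRr0 (x j)); apply: ler_powR; exact: ltW.
  by rewrite powR1; lra.
(* The cost per quadrature node: [2^|u|] truncations, each of cost at most
   [C3 * expR (sigma * |u|)]. *)
have B10 : 0 <= 2 * expR sigma by rewrite mulr_ge0 ?expR_ge0.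
have [K K0 KP] := allocation y01 yS (expR_ge0 _) b0 B10 x0 xy.
pose C := C3 * K + C3 + K + c1 * K.
exists C; first by rewrite /C; have := mulr_gt0 C30 K0; have := mulr_ge0 c10 (ltW K0); lra.
move=> X X1; have [A [nn [Ad AP A1 A2 A3]]] := KP X X1.
have gpos u : u \in A -> 0 < gam S u.
  move=> /AP[_ yu]; rewrite lt_def gam_ge0 andbT; apply: contraTneq yu => g0.
  suff -> : \prod_(j <- u) y j = 0 by rewrite ltxx.
  move/eqP: g0; rewrite /gam prodf_seq_eq0 => /hasP[j ju /= /eqP gj].
  rewrite (big_rem j)//= /y /x /ghat gj mul0r mulr0 powR0 ?gt_eqF//.
  by rewrite (min_idPr _) ?mul0r.
pose vs := [:: fset0] ++ flatten [seq qsets u (nn u) | u <- (A `\ fset0)%fset].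
pose V := \sum_(u <- (A `\ fset0)%fset) c1 * (B ^+ #|` u| * gam S u) * (nn u).+1%:R `^ (- beta).
have achV : achievable (S := S) vs (fun f => \sum_(u <- A) anch_mean u f) V.
  rewrite -[V]add0r; apply: (achievable_eq (m := fun f => L (S := S) (fun j => j \in fset0) f +
      \sum_(u <- (A `\ fset0)%fset) anch_mean u f)).
    move=> f; rewrite [RHS](big_fsetD1 fset0) ?Ad.1//=; congr (_ + _).
    by rewrite /anch_mean fpowerset0 big_seq_fset1 /sgn big_seq_fset0 mul1r.
  apply: achievableD; first exact: achievable_empty.
  apply: achievable_sum => u; rewrite !inE => /andP[u0 uA].
  have := qa u (nn u) u0 (gpos u uA) (AP u uA).1.
  by rewrite (_ : - tau + (tau - beta) = - beta)//; ring.
have V0 : 0 <= V.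
  by apply: sumr_ge0 => u _; rewrite !mulr_ge0 ?powR_ge0 ?exprn_ge0 ?gam_ge0.
have Xb0 : 0 <= X `^ (- beta) by exact: powR_ge0.
have VK : V <= c1 * (K * X `^ (- beta)).
  apply: (@le_trans _ _ (c1 * \sum_(u <- A) \prod_(j <- u) x j * (nn u)%:R `^ (- beta))); last first.
    by rewrite ler_wpM2l.
  rewrite [X in c1 * X](big_fsetD1 fset0) ?Ad.1//= mulrDr -[leLHS]add0r lerD//.
    by rewrite !mulr_ge0 ?powR_ge0// prodr_ge0.
  rewrite /V mulr_sumr big_seq [leRHS]big_seq; apply: ler_sum => u.
  rewrite !inE => /andP[u0 uA]; have [n0 _] := AP u uA.
  rewrite -mulrA ler_wpM2l//; apply: ler_pM; rewrite ?powR_ge0// ?mulr_ge0 ?exprn_ge0 ?gam_ge0//.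
    rewrite -iter_mulr_1 -(count_predT u) -big_const_seq /gam -big_split /=.
    apply: ler_prod => j _; rewrite mulr_ge0 ?g_ge0//= /x /ghat /c mulrDl -/(kap S).
    rewrite mulrCA divfK ?gt_eqF// mulrC lerDl !mulr_ge0 ?g_ge0//; exact: ltW.
  rewrite !powRN lef_pV2 ?posrE ?powR_gt0 ?ltr0n//.
  by apply: ge0_ler_powR; rewrite ?nnegrE ?ler0n ?ler_nat//; exact: ltW.
have bias f : HK f -> (I_mu mu f - \sum_(u <- A) anch_mean u f) ^+ 2 <=
    (K * X `^ (- beta)) * ip f f.
  apply: bias_downset => // n; apply: le_trans (A2 n).
  apply: ler_sum => w _; apply: ler_prod => j _; rewrite mulr_ge0//=.
  by rewrite /x ler_wpM2r// /c lerDr divr_ge0// ltW.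
have e0 : 0 <= K * X `^ (- beta) by rewrite mulr_ge0// ltW.
have [Q [QA Qc Qe]] := achievable_A_res cost_mono achV V0 e0 bias.
exists Q; split => //.
  apply: le_trans Qc _; rewrite /vs big_cat big_seq1 big_flatten /= big_map.
  apply: (@le_trans _ _ (C3%:E + (\sum_(u <- A) C3 * ((2 * expR sigma) ^+ #|` u| * (nn u)%:R))%:E)%E).
    apply: leeD; first by have := costC 0%N; rewrite mulr0 expR0 mulr1.
    apply: (@le_trans _ _ (\sum_(u <- (A `\ fset0)%fset) (C3 * ((2 * expR sigma) ^+ #|` u| * (nn u)%:R))%:E)%E).
      apply: lee_sum => u _.
      apply: (@le_trans _ _ (\sum_(v <- qsets u (nn u)) (C3 * expR (sigma * #|` u|%:R))%:E)%E).
        rewrite big_seq [leRHS]big_seq; apply: lee_sum => v vu.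
        apply: le_trans (costC _); apply: cost_mono; apply: fsubset_leq_card.
        exact: qsets_sub vu.
      rewrite sumEFin lee_fin big_const_seq count_predT iter_addr_0 size_qsets -[leLHS]mulr_natl.
      rewrite natrM natrX [sigma * _]mulrC expRM_natl exprMn le_eqVlt.
      by apply/orP; left; apply/eqP; ring.
    rewrite sumEFin lee_fin [leRHS](big_fsetD1 fset0) ?Ad.1//= lerDr.
    by rewrite !mulr_ge0 ?exprn_ge0// ltW.
  rewrite -EFinD lee_fin -mulr_sumr /C.
  have := ler_wpM2l (ltW C30) A1; have := mulr_ge0 c10 (ltW K0).
  have := mulr_gt0 C30 K0.
  nra.
apply: le_trans Qe _; rewrite lee_fin ler_wsqrtr//.
rewrite /C; have := mulr_ge0 (ltW (mulr_gt0 C30 K0)) Xb0; have := mulr_ge0 (ltW C30) Xb0; nra.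
Qed.

End upper_bound.

(** * The decay of the weights and the resulting rates *)

Section decay.
Context (R : realType) d (D : measurableType d) (S : setting R D).
Local Notation k := (k S).
Local Notation a := (a S).
Local Notation dec := (decay k (gam S) a).

Lemma hat_gamma_powR (u : {fset nat}) r :
  hat_gamma k (gam S) a u `^ r = \prod_(j <- u) ghat S j `^ r.
Proof. by rewrite prod_powR; [rewrite /hat_gamma gam_kern|exact: ghat_ge0]. Qed.

Lemma decay_setP p : (\esum_(u in [set: {fset nat}]) (hat_gamma k (gam S) a u `^ (1 / p))%:E < +oo)%E <->
  exists T, forall n, nprod (fun j => ghat S j `^ (1 / p)) n <= T.
Proof.
under eq_esum do rewrite hat_gamma_powR.
by apply: esum_prod_lty => j; exact: powR_ge0.
Qed.

Lemma decay_gt b : (b%:E < dec)%E -> exists2 p, b < p &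
  exists T, forall n, \sum_(0 <= j < n) ghat S j `^ (1 / p) <= T.
Proof.
move=> /ereal_sup_gt[_ [p /decay_setP[T TP] <-]]; rewrite lte_fin => bp.
exists p => //; exists T => n; have := TP n.
have := @sum_le_nprod R (fun j => ghat S j `^ (1 / p)) n (fun j => powR_ge0 _ _); lra.
Qed.

(* [M] is min(tau, decay - 1). *)
Lemma min_max_decay tau : 0 < tau -> (1 < dec)%E -> exists M : R,
  [/\ 0 < M <= tau, mine tau%:E (dec - 1)%E = M%:E,
      maxe (2 / tau)%:E (2%:E / (dec - 1))%E = (2 / M)%:E &
      forall b, b < M -> ((1 + b)%:E < dec)%E].
Proof.
case: dec => [x| |//] tau0 dec1; last first.
  exists tau; rewrite tau0 lexx; split => //.
  - by rewrite addye// min_l ?leey.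
  - by rewrite addye// invey mule0 max_l// lee_fin divr_ge0// ltW.
  - by move=> b _; rewrite ltry.
rewrite lte_fin in dec1.
exists (Num.min tau (x - 1)); split.
- by rewrite lt_min tau0 subr_gt0 dec1 ge_min lexx.
- by rewrite -EFinB -EFin_min.
- have x1 : 0 < x - 1 by lra.
  rewrite -EFinB inver gt_eqF// -EFinM; have [h|h] := leP tau (x - 1).
    by rewrite max_l// lee_fin ler_pM2l// lef_pV2.
  by rewrite max_r// lee_fin ler_pM2l// lef_pV2// ltW.
- by move=> b; rewrite lt_min lte_fin => /andP[_]; lra.
Qed.

End decay.

Section rates.
Context (R : realType) d (D : measurableType d) (S : setting R D).
Local Notation rho := (rho S).
Local Notation mu := (mu S).
Local Notation k := (k S).
Local Notation a := (a S).
Local Notation HK := (HK S).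
Local Notation H := (H S).
Local Notation ip := (rkhs_ip HK).
Local Notation B := (rkhs_ball HK).
Context (cost : nat -> \bar R).
Hypothesis cost_ge1 : forall nu, (1 <= cost nu)%E.
Hypothesis cost_mono : forall nu nu', (nu <= nu')%N -> (cost nu <= cost nu')%E.

(** Monotonicity gives [cost nu <= cost (n0 + nu)], so the eventual bound holds everywhere with a
    larger constant. *)
Lemma ebigO_exp_bound sigma : 0 < sigma ->
  ebigO cost (fun nu => (expR (sigma * nu%:R))%:E) ->
  exists C, forall nu, (cost nu <= (C * expR (sigma * nu%:R))%:E)%E.
Proof.
move=> s0 [C C0 [n0 _ n0P]]; exists (C * expR (sigma * n0%:R)) => nu.
apply: le_trans (cost_mono (leq_addr n0 nu)) _.
apply: le_trans (n0P _ _) _; first by rewrite /= leq_addl.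
by rewrite -EFinM lee_fin natrD mulrDr expRD mulrCA mulrA [leRHS]mulrC mulrA (mulrC (expR _)).
Qed.

(** The real parameter [X] is later chosen from an integer budget or from an accuracy, which yields
    both forms of the upper bound. *)
Definition achieves_rate beta := exists2 C : R, 1 <= C & forall X : R, 1 <= X ->
  exists Q, [/\ A_res HK a cost Q, (cost_on a cost Q B <= (C * X)%:E)%E &
    (error_on mu Q B <= (Num.sqrt (C * X `^ (- beta)))%:E)%E].

Lemma achieves_rate_decay tau beta sigma : quadrature_assumption rho (gam S) H a tau ->
  0 < sigma -> ebigO cost (fun nu => (expR (sigma * nu%:R))%:E) ->
  0 < beta < tau -> ((1 + beta)%:E < decay k (gam S) a)%E -> achieves_rate beta.
Proof.
move=> hQ s0 costO bt /decay_gt[p bp [T TP]].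
have [C3 CP] := ebigO_exp_bound s0 costO.
have [C C0 rate] := upper_rate cost_ge1 cost_mono hQ bt (ltW bp) TP CP (ltW s0).
exists (C + 1); first by lra.
move=> X X1; have [Q [QA Qc Qe]] := rate X X1; exists Q; split => //.
  by apply: le_trans Qc _; rewrite lee_fin ler_wpM2r//; lra.
by apply: le_trans Qe _; rewrite lee_fin ler_wsqrtr// ler_wpM2r ?powR_ge0//; lra.
Qed.

Lemma error_on_ge0 Q : (0 <= error_on mu Q B)%E.
Proof. exact: poweR_ge0. Qed.

Lemma min_error_ge0 N : (0 <= min_error mu HK a cost N B)%E.
Proof. by apply: le_ereal_inf_tmp => _ [Q [_ _ ->]]; exact: error_on_ge0. Qed.

Lemma min_error_rate beta M delta : achieves_rate beta -> 0 < beta -> M - delta <= beta ->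
  ebigO (fun N => (min_error mu HK a cost N B ^+ 2)%E) (fun N => (N%:R `^ (- M + delta))%:E).
Proof.
move=> [C C1 rate] b0 Mb; have C0 : 0 < C by lra.
exists (C * C `^ beta); first by rewrite mulr_ge0 ?powR_ge0// ltW.
near=> N; have NC : C <= N%:R by near: N; exact: nbhs_infty_ger.
have N1 : 1 <= N%:R :> R by lra.
have X1 : 1 <= N%:R / C by rewrite ler_pdivlMr// mul1r.
have [Q [QA Qc Qe]] := rate _ X1.
have eN : (min_error mu HK a cost N B <= (Num.sqrt (C * (N%:R / C) `^ (- beta)))%:E)%E.
  apply: le_trans Qe; apply: ereal_inf_lbound; exists Q; split => //.
  by apply: le_trans Qc _; rewrite mulrC divfK// gt_eqF.
have := min_error_ge0 N; move: eN; case: (min_error _ _ _ _ _ _) => [e| |]//.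
rewrite !lee_fin -[e * e]/(e ^+ 2) => eN e0.
apply: (@le_trans _ _ (C * (N%:R / C) `^ (- beta))).
  rewrite -(@sqr_sqrtr _ (C * _)) ?mulr_ge0 ?powR_ge0//; last exact: ltW.
  by rewrite ler_pXn2r// nnegrE sqrtr_ge0.
rewrite -mulrA ler_wpM2l//; first exact: ltW.
have -> : (N%:R / C) `^ (- beta) = C `^ beta * N%:R `^ (- beta).
  rewrite powRM ?invr_ge0//; last exact: ltW.
  by rewrite (powRN C^-1) powRV ?invrK 1?mulrC// ltW.
by rewrite ler_wpM2l ?powR_ge0// ler_powR//; lra.
Unshelve. all: by end_near. Qed.

Lemma zero_algorithm : exists Q, [/\ A_res HK a cost Q, (cost_on a cost Q B <= 0)%E &
  (error_on mu Q B <= 1)%E].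
Proof.
have rr : ip (rep (S := S) predT) (rep (S := S) predT) = 1.
  by rewrite ip_rep2 -[RHS](tail_pred0 S); apply: eq_tail.
have [f Hf|Q [QA Qc Qe]] := @achievable_A_res _ _ _ S cost cost_mono _ _ _ 1 (achievable_nil S) (lexx 0) ler01.
  rewrite subr0 mul1r I_muE -ip_rep//; apply: le_trans (rkhs_CS Hf (HK_rep S _)) _.
  by rewrite rr mulr1.
exists Q; split => //; first by rewrite big_nil in Qc.
by move: Qe; rewrite addr0 sqrtr1.
Qed.

Lemma comp_res_rate beta : achieves_rate beta -> 0 < beta ->
  exists2 C, 0 <= C & forall eps : R, 0 < eps ->
    (comp_res mu HK a cost eps <= (C * eps `^ (- (2 / beta)))%:E)%E.
Proof.
move=> [C C1 rate] b0; have C0 : 0 < C by lra.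
exists (C * C `^ beta^-1); first by rewrite mulr_ge0 ?powR_ge0// ltW.
move=> eps eps0; have [eps1|eps1] := leP 1 eps.
  have [Q [QA Qc Qe]] := zero_algorithm.
  apply: (@le_trans _ _ (cost_on a cost Q B)).
    apply: ereal_inf_lbound; exists Q; split => //.
    by apply: le_trans Qe _; rewrite lee_fin.
  by apply: le_trans Qc _; rewrite lee_fin !mulr_ge0 ?powR_ge0// ltW.
pose X := (C / eps ^+ 2) `^ beta^-1.
have e2 : 0 < eps ^+ 2 by rewrite exprn_gt0.
have Ce : 1 <= C / eps ^+ 2.
  rewrite ler_pdivlMr// mul1r; apply: le_trans C1.
  by rewrite exprn_ile1// ltW.
have X1 : 1 <= X.
  by rewrite /X -[leLHS](powRr0 (C / eps ^+ 2)) ler_powR// invr_ge0 ltW.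
have [Q [QA Qc Qe]] := rate X X1.
apply: (@le_trans _ _ (cost_on a cost Q B)).
  apply: ereal_inf_lbound; exists Q; split => //.
  apply: le_trans Qe _; rewrite lee_fin /X -powRrM mulrN mulVf ?gt_eqF//.
  rewrite powR_inv1; last by rewrite divr_ge0 ?ltW.
  by rewrite invf_div mulrCA mulfV ?gt_eqF// mulr1 sqrtr_sqr ger0_norm// ltW.
apply: le_trans Qc _; rewrite lee_fin -mulrA ler_pM2l// /X.
have ie0 : 0 <= (eps ^+ 2)^-1 by rewrite invr_ge0 ltW.
rewrite (powRM _ (ltW C0) ie0) (powRV _ (ltW e2)) -(powR_mulrn 2 (ltW eps0)) -powRrM.
by rewrite -powRN.
Qed.

Lemma p_res_le p : 0 <= p -> (exists2 C : R, 0 <= C & forall eps : R, 0 < eps ->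
    (comp_res mu HK a cost eps <= (C * eps `^ (- p))%:E)%E) ->
  (p_res mu HK a cost <= p%:E)%E.
Proof. by move=> p0 pC; apply: ereal_inf_lbound; exists p. Qed.

Lemma p_res_rate M : 0 < M -> (forall beta, 0 < beta < M -> achieves_rate beta) ->
  (p_res mu HK a cost <= (2 / M)%:E)%E.
Proof.
move=> M0 rate; apply/lee_addgt0Pr => e e0; rewrite -EFinD.
have p0 : 0 < 2 / M + e by rewrite addr_gt0// divr_gt0.
have b0 : 0 < 2 / (2 / M + e) by rewrite divr_gt0.
have -> : 2 / M + e = 2 / (2 / (2 / M + e)) by rewrite invf_div mulrCA mulfV// mulr1.
apply: p_res_le; first by rewrite divr_ge0 ?ltW.
apply: comp_res_rate => //; apply: rate; rewrite b0 /=.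
by rewrite ltr_pdivrMr// mulrDr mulrCA mulfV ?gt_eqF// mulr1 ltrDl mulr_gt0.
Qed.

End rates.

(** * The lower bound *)

(** Adaptive choices depend only on values already seen, so agreement at the points visited for [f]
    suffices. *)
Lemma run_eq (R E : Type) (s : strategy R E) (f h : E -> R) :
  (forall n x0, (n < size (sample_points s f))%N ->
    f (nth x0 (sample_points s f) n) = h (nth x0 (sample_points s f) n)) ->
  run s f = run s h.
Proof.
elim: s => [r|x s IH] //= fh; rewrite -(fh 0%N x)//=.
by apply: IH => n x0 ns; exact: (fh n.+1 x0).
Qed.

Lemma poweR_half_le (R : realType) (y : \bar R) (e : R) : (0 <= y)%E ->
  (y `^ 2^-1 <= e%:E)%E -> (y <= (e ^+ 2)%:E)%E.
Proof.
case: y => [r| |]//; rewrite ?lee_fin => r0.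
  rewrite powR12_sqrt// => re.
  rewrite -(sqr_sqrtr r0) ler_pXn2r// nnegrE ?sqrtr_ge0//.
  exact: le_trans (sqrtr_ge0 r) re.
by rewrite poweRyr// invr_eq0.
Qed.

(** With the variance dropped, averaging [(c - m)^2] and [(- c - m)^2] gives [c^2 + m^2]: one output
    cannot be close to both values. *)
Lemma mean_square_sum d (T : measurableType d) (R : realType) (P : probability T R)
    (X : T -> R) c b : X \in Lfun P 2%:E ->
  (\int[P]_w ((c - X w) ^+ 2)%:E <= b%:E)%E ->
  (\int[P]_w ((- c - X w) ^+ 2)%:E <= b%:E)%E -> c ^+ 2 <= b.
Proof.
move=> X2; rewrite !mean_square_error//; set m := \int[P]_w X w.
have V0 := variance_ge0 P X.
move=> h1 h2.
have h1' : (c - m) ^+ 2 <= b by rewrite -lee_fin; apply: le_trans h1; exact: leeDl.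
have h2' : (- c - m) ^+ 2 <= b by rewrite -lee_fin; apply: le_trans h2; exact: leeDl.
nra.
Qed.

Section lower_bound.
Context (R : realType) d (D : measurableType d) (S : setting R D).
Local Notation mu := (mu S).
Local Notation a := (a S).
Local Notation HK := (HK S).
Local Notation ip := (rkhs_ip HK).
Local Notation B := (rkhs_ball HK).
Context (cost : nat -> \bar R).
Hypothesis cost_ge1 : forall nu, (1 <= cost nu)%E.

Lemma tail_ge w n : 1 + \sum_(0 <= j < n) (if w j then ghat S j else 0) <= tail S w.
Proof.
have [C CP] := ghat_bound S; have gh0 := ghat_ge0 S.
have w0 j : 0 <= (if w j then ghat S j else 0) by case: ifP.
apply: le_trans (sum_le_nprod n w0) _; apply: (@iprod_ge _ _ C) => // m.
by apply: le_trans (CP m); apply: le_nprod => j; rewrite w0 /=; case: ifP.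
Qed.

(* The integrand [P - \prod_(j in J) (1 + g_j k(a, x_j))], with [P] the value of
   the product at [x = a], vanishes at every point anchored outside a set
   disjoint from [J]. *)
Lemma fooling Q (vs : seq {fset nat}) (J : {fset nat}) (e : R) n :
  admissible HK a cost Q ->
  (forall f, HK f -> forall w : ra_space Q,
    let xs := [seq \val x | x <- sample_points (ra_strategy w) f] in
    size xs = size vs /\ forall i, (i < size vs)%N ->
      anchored a (nth fset0 vs i) (nth (fun=> a) xs i)) ->
  (forall v, v \in vs -> [disjoint v & J]%fset) ->
  (error_on mu Q B <= e%:E)%E ->
  forall s, s = \sum_(0 <= j < n) (if j \in J then ghat S j else 0) ->
  s <= e ^+ 2 * (1 + s).
Proof.
move=> adm supp disJ Qe s sE.
pose w := [pred j | j \in J]; pose vJ := [pred j | j \notin J].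
pose P := tail S w.
have Ps : 1 + s <= P by rewrite sE; exact: (tail_ge w n).
have s0 : 0 <= s by rewrite sE; apply: sumr_ge0 => j _; case: ifP => // _; exact: ghat_ge0.
pose r1 := rep (S := S) predT; pose rJ := rep (S := S) vJ.
have H1 : HK r1 by exact: HK_rep.
have HJ : HK rJ by exact: HK_rep.
have ip11 : ip r1 r1 = 1.
  by rewrite ip_rep2 -[RHS](tail_pred0 S); apply: eq_tail.
have ipJ1 : ip rJ r1 = 1.
  by rewrite ip_rep2 -[RHS](tail_pred0 S); apply: eq_tail => j /=; rewrite andbF.
have ipJJ : ip rJ rJ = P.
  by rewrite ip_rep2; apply: eq_tail => j /=; rewrite negbK andbb.
have HP : HK (fun x => P * r1 x) by exact: rkhs_scale.
pose f := (fun x => P * r1 x) \- rJ.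
have Hf : HK f by exact: rkhs_sub.
have ipf1 : ip f r1 = P - 1 by rewrite rkhs_ipBl// rkhs_ipZl// ip11 ipJ1 mulr1.
have ipff : ip f f = P * (P - 1).
  rewrite rkhs_sq_sub// rkhs_ipZl// (rkhs_ip_sym H1 HP) rkhs_ipZl// ip11 rkhs_ipZl//.
  by rewrite (rkhs_ip_sym H1 HJ) ipJ1 ipJJ; ring.
have r1E x : r1 x = 1.
  by rewrite /r1 repE -[RHS](tail_pred0 S) /tprod /tail; congr iprod; apply/funext.
have f0 x : (forall j, j \in J -> \val x j = a) -> f x = 0.
  move=> xJ; rewrite /f /= r1E mulr1 /rJ repE /tprod /P /tail; apply/eqP; rewrite subr_eq0.
  apply/eqP; congr iprod; apply/funext => j /=; rewrite negbK.
  by case: ifP => // /xJ ->.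
have [P1|P1] := leP P 1.
  have -> : s = 0 by apply/eqP; rewrite eq_le s0 andbT; lra.
  by rewrite addr0 mulr1 sqr_ge0.
have ff0 : 0 < ip f f by rewrite ipff mulr_gt0//; lra.
pose c := (Num.sqrt (ip f f))^-1.
have c0 : c != 0 by rewrite invr_eq0 gt_eqF// sqrtr_gt0.
have c2 : c ^+ 2 = (ip f f)^-1 by rewrite /c exprVn sqr_sqrtr// ltW.
pose h b x := b * c * f x.
have Hh b : HK (h b) by exact: rkhs_scale.
have Bh b : b ^+ 2 = 1 -> B (h b).
  move=> b1; split => //; rewrite /rkhs_norm rkhs_ipZl// (rkhs_ip_sym Hf (Hh b)) rkhs_ipZl//.
  rewrite mulrA -expr2 exprMn b1 c2 mul1r mulVf ?sqrtr1//; exact: lt0r_neq0.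
have Ih b : I_mu mu (h b) = b * c * (P - 1).
  by rewrite I_muE -ip_rep// rkhs_ipZl// ipf1.
(* Every multiple of [f] vanishes at all sampled points, so the output does not depend on the sign
   [b]. *)
have runh b v : run (ra_strategy (r := Q) v) (h b) = run (ra_strategy v) (h 1).
  apply: run_eq => i x0 ix.
  have [sz sp] := supp _ (Hh b) v; rewrite size_map in sz.
  rewrite /h f0 ?mulr0// => j jJ.
  have ivs : (i < size vs)%N by rewrite -sz.
  have := sp i ivs; rewrite (nth_map x0)//; apply.
  have := disJ _ (mem_nth fset0 ivs) => /fdisjointP dJ.
  by apply: contraL jJ => /dJ.
have err b : b ^+ 2 = 1 ->
    (\int[ra_prob Q]_v ((b * c * (P - 1) - run (ra_strategy v) (h 1)) ^+ 2)%:E <= (e ^+ 2)%:E)%E.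
  move=> b1; apply: le_trans (poweR_half_le _ Qe); last first.
    apply: (le_trans _ (ereal_sup_ubound (ex_intro2 _ _ _ (Bh 1 (expr1n _ 2)) erefl))).
    by apply: integral_ge0 => v _; rewrite lee_fin sqr_ge0.
  apply: ereal_sup_ubound; exists (h b); first exact: Bh.
  by apply: eq_integral => v _; rewrite Ih runh.
have [X2 _] := adm _ (Hh 1).
have le1 : (c * (P - 1)) ^+ 2 <= e ^+ 2.
  apply: (mean_square_sum X2); first by have := err 1 (expr1n _ 2); rewrite mul1r.
  by have := err (-1) (etrans (sqrrN 1) (expr1n _ 2)); rewrite mulN1r mulNr.
rewrite exprMn c2 ipff in le1.
have P0 : 0 < P by lra.
have {}le1 : P - 1 <= e ^+ 2 * P.
  rewrite -ler_pdivrMr//; apply: le_trans le1; rewrite le_eqVlt; apply/orP; left; apply/eqP.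
  have Pn0 : P != 0 by rewrite gt_eqF.
  have P1n0 : P - 1 != 0 by rewrite gt_eqF// subr_gt0.
  by field; rewrite ?Pn0 ?P1n0.
(* [1 - 1 / P] increases with [P], so [P] may be replaced by its lower bound [1 + s]. *)
have : s * P <= e ^+ 2 * (1 + s) * P.
  by have := ler_wpM2r (_ : 0 <= 1 + s) le1; nra.
by rewrite ler_pM2r.
Qed.

Lemma Omega_bound : ebigOmega cost (fun nu => nu%:R%:E) ->
  exists2 C, 0 < C & forall nu, (nu%:R%:E <= C%:E * cost nu)%E.
Proof.
move=> [C C0 [n0 _ n0P]]; exists (C + n0%:R + 1); first by rewrite ltr_wpDl// addr_ge0.
move=> nu; have cost0 : (0 <= cost nu)%E by apply: le_trans (cost_ge1 nu).
have [n0nu|nun0] := leqP n0 nu.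
  apply: le_trans (n0P nu n0nu) _; rewrite lee_wpmul2r// lee_fin.
  by rewrite -addrA lerDl addr_ge0.
apply: (@le_trans _ _ ((C + n0%:R + 1)%:E * 1)%E); last first.
  by rewrite lee_wpmul2l// lee_fin !addr_ge0.
rewrite mule1 lee_fin; have : nu%:R <= n0%:R :> R by rewrite ler_nat ltnW.
lra.
Qed.

Lemma lower_support : ebigOmega cost (fun nu => nu%:R%:E) ->
  exists2 C, 0 < C & forall Q x e, A_res HK a cost Q -> (cost_on a cost Q B <= x%:E)%E ->
    (error_on mu Q B <= e%:E)%E ->
    exists2 V : {fset nat}, #|` V|%:R <= C * x & forall J n, [disjoint V & J]%fset ->
      forall s, s = \sum_(0 <= j < n) (if j \in J then ghat S j else 0) ->
      s <= e ^+ 2 * (1 + s).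
Proof.
move=> /Omega_bound[C C0 CP]; exists C => // Q x e [adm [vs vsP]] Qc Qe.
exists (\bigcup_(v <- vs) v)%fset.
  have ball0 : B (fun=> 0).
    split; first exact: (rkhs_zero HK).
    by rewrite /rkhs_norm rkhs_ip0l ?sqrtr0//; exact: (rkhs_zero HK).
  have vsx : (\sum_(v <- vs) cost #|` v| <= x%:E)%E.
    apply: le_trans Qc; rewrite -(vsP _ (rkhs_zero HK)).2.
    by apply: ereal_sup_ubound; exists (fun=> 0).
  apply: (@le_trans _ _ (\sum_(v <- vs) #|` v|%:R)).
    rewrite -natr_sum ler_nat; elim: (vs) => [|v s IH]; first by rewrite !big_nil.
    by rewrite !big_cons (leq_trans (leq_card_fsetU _ _).1)// leq_add2l.
  rewrite -lee_fin EFinM -sumEFin; apply: le_trans (lee_wpmul2l _ vsx); last by rewrite lee_fin ltW.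
  rewrite ge0_sume_distrr; last by move=> v _; exact: le_trans (cost_ge1 _).
  by apply: lee_sum => v _; exact: CP.
move=> J n VJ; apply: (@fooling Q vs) => //.
- by move=> f Hf w; exact: ((vsP f Hf).1 w).
- move=> v vvs; apply: fdisjointWl VJ; exact: (bigfcup_sup _ vvs).
Qed.

End lower_bound.

Lemma condensation (R : realType) (y : nat -> R) (C s : R) : (forall j, 0 <= y j) ->
  (forall i j, (i <= j)%N -> y j <= y i) -> 1 < s ->
  (forall m, (0 < m)%N -> y (2 * m)%N <= C * m%:R `^ (- s)) ->
  exists T, forall n, \sum_(0 <= j < n) y j <= T.
Proof.
move=> y0 ymono s1 yC.
have C0 : 0 <= C by have := yC 1%N isT; rewrite powR1 mulr1; exact: le_trans.
pose th : R := 2 `^ (1 - s).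
have th0 : 0 < th by rewrite powR_gt0.
have th1 : th < 1.
  rewrite /th -[ltRHS](powRr0 2) /powR gt_eqF// ltr_expR mul0r pmulr_llt0; last by rewrite ln_gt0// ltr1n.
  by rewrite subr_lt0.
have block N : \sum_(2 ^ N.+1 <= j < 2 ^ N.+2) y j <= 2 * C * th ^+ N.
  apply: (@le_trans _ _ (\sum_(2 ^ N.+1 <= j < 2 ^ N.+2) y (2 ^ N.+1)%N)).
    by rewrite big_nat [leRHS]big_nat; apply: ler_sum => j /andP[? _]; exact: ymono.
  rewrite sumr_const_nat (_ : 2 ^ N.+2 - 2 ^ N.+1 = 2 ^ N.+1)%N; last first.
    by rewrite [X in (X - _)%N]expnS mul2n -addnn addnK.
  rewrite expnS -[leLHS]mulr_natl natrM -mulrA -[leRHS]mulrA ler_wpM2l//.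
  apply: (@le_trans _ _ ((2 ^ N)%:R * (C * (2 ^ N)%:R `^ (- s)))).
    by rewrite ler_wpM2l// yC// expn_gt0.
  rewrite mulrCA ler_wpM2l// le_eqVlt; apply/orP; left; apply/eqP.
  rewrite natrX -powR_mulrn// -[_ ^+ N]powR_mulrn ?ltW// /th -!powRrM -powRD; last by rewrite pnatr_eq0 implybT.
  by congr (_ `^ _); ring.
pose W : R := \sum_(0 <= j < 2) y j.
have WN N : \sum_(0 <= j < 2 ^ N.+1) y j <= W + 2 * C * ((1 - th ^+ N) / (1 - th)).
  elim: N => [|N IH]; first by rewrite expr0 subrr mul0r mulr0 addr0 /W expn1.
  rewrite (big_cat_nat _ (_ : 2 ^ N.+1 <= 2 ^ N.+2)%N)//=; last by rewrite leq_exp2l.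
  apply: le_trans (lerD IH (block N)) _; rewrite -addrA lerD2l -mulrDr ler_wpM2l//.
    by rewrite mulr_ge0.
  rewrite le_eqVlt; apply/orP; left; apply/eqP; rewrite exprS.
  by field; rewrite subr_eq0 gt_eqF.
exists (W + 2 * C * (1 / (1 - th))) => n.
apply: (@le_trans _ _ (\sum_(0 <= j < 2 ^ n.+1) y j)).
  have n2 : (n <= 2 ^ n.+1)%N by rewrite (leq_trans (ltnW (ltn_expl n (ltnSn 1))))// leq_exp2l.
  by rewrite [leRHS](big_cat_nat _ n2)//= lerDl sumr_ge0.
apply: le_trans (WN n) _; rewrite lerD2l ler_wpM2l ?mulr_ge0// ler_pM2r ?invr_gt0 ?subr_gt0//.
by rewrite lerBlDr lerDl exprn_ge0 ?ltW.
Qed.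

(** * Lower bounds for the exponent of the complexity *)

Section necessary.
Context (R : realType) d (D : measurableType d) (S : setting R D).
Local Notation mu := (mu S).
Local Notation k := (k S).
Local Notation g := (g S).
Local Notation a := (a S).
Local Notation HK := (HK S).
Local Notation B := (rkhs_ball HK).
Local Notation dec := (decay k (gam S) a).
Context (cost : nat -> \bar R).
Hypothesis cost_ge1 : forall nu, (1 <= cost nu)%E.
Hypothesis g_mono : forall i j, (i <= j)%N -> g j <= g i.

Definition comp_bound C p := forall eps : R, 0 < eps <= 1 ->
  (comp_res mu HK a cost eps <= (C * eps `^ (- p))%:E)%E.

Lemma comp_boundW C p p' : 0 <= C -> p <= p' -> comp_bound C p -> comp_bound C p'.
Proof.
move=> C0 pp' bd eps e01; apply: le_trans (bd eps e01) _.
by rewrite lee_fin ler_wpM2l// ger_powR// lerN2.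
Qed.

Lemma comp_algorithm C p x : 0 <= C -> 0 < p -> comp_bound C p -> C + 1 <= x ->
  exists Q, [/\ A_res HK a cost Q, (cost_on a cost Q B <= x%:E)%E &
    (error_on mu Q B <= (((C + 1) / x) `^ (1 / p))%:E)%E].
Proof.
move=> C0 p0 bd Cx.
have C1 : 0 < C + 1 by lra.
have x0 : 0 < x by lra.
pose y := (C + 1) / x; have y0 : 0 < y by rewrite divr_gt0.
have y1 : y <= 1 by rewrite ler_pdivrMr// mul1r.
pose eps := y `^ (1 / p).
have eps01 : 0 < eps <= 1.
  rewrite powR_gt0//= -[leRHS](powRr0 y); apply: ger_powR; first by rewrite y0.
  by rewrite divr_ge0// ltW.
(* For this [eps] the bound is [C * x / (C + 1)]. Being strictly below [x], it yields an actual
   algorithm although the complexity is an infimum. *)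
have : (comp_res mu HK a cost eps < x%:E)%E.
  apply: le_lt_trans (bd eps eps01) _; rewrite lte_fin /eps -powRrM.
  rewrite mulrN div1r mulVf ?gt_eqF// powR_inv1 ?ltW// invf_div mulrA ltr_pdivrMr// mulrC.
  by rewrite ltr_pM2l//; lra.
move=> /ereal_inf_lt[_ [Q [QA Qe ->]] Qc]; exists Q; split => //; exact: ltW.
Qed.

Lemma ghat_mono i j : (i <= j)%N -> ghat S j <= ghat S i.
Proof. by move=> ij; rewrite ler_wpM2r ?g_mono//; exact: ltW (kap_gt0 S). Qed.

Lemma ghat_decay C p : ebigOmega cost (fun nu => nu%:R%:E) -> 0 <= C -> 0 < p -> comp_bound C p ->
  exists C', forall m, (0 < m)%N -> ghat S (2 * m)%N <= C' * m%:R `^ (- (1 + 2 / p)).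
Proof.
move=> Om C0 p0 bd; have [C2 C20 lo] := lower_support S cost_ge1 Om.
have [Cg Cg0 CgP] := sum_ghat_bound S; have gh0 := ghat_ge0 S.
pose m0 := C2 * (C + 1); have m00 : 0 < m0 by rewrite mulr_gt0//; lra.
pose s := 1 + 2 / p.
pose K1 := m0 `^ (2 / p) * (1 + Cg); pose K2 := ghat S 0 * m0 `^ s.
have K10 : 0 <= K1 by rewrite mulr_ge0 ?powR_ge0 ?addr_ge0.
have K20 : 0 <= K2 by rewrite mulr_ge0 ?powR_ge0.
exists (K1 + K2) => m mp; rewrite -/s.
have mp' : 0 < m%:R :> R by rewrite ltr0n.
have ms0 : 0 < m%:R `^ (- s) by rewrite powR_gt0.
(* Below [m0] the budget is too small for [comp_algorithm]; the constant [K2] covers these finitely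
   many [m]. *)
have [mm0|mm0] := leP m0 m%:R; last first.
  apply: (@le_trans _ _ (K2 * m%:R `^ (- s))); last by rewrite ler_wpM2r ?(ltW ms0)// lerDr.
  apply: (le_trans (ghat_mono (leq0n _))); rewrite /K2 -mulrA ler_peMr//.
  rewrite powRN ler_pdivlMr ?powR_gt0// mul1r.
  apply: ge0_ler_powR; rewrite ?nnegrE ?ltW//.
  by rewrite /s; have := divr_gt0 (ltr0n R 2) p0; lra.
apply: (@le_trans _ _ (K1 * m%:R `^ (- s))); last by rewrite ler_wpM2r ?(ltW ms0)// lerDl.
have Cx : C + 1 <= m%:R / C2 by rewrite ler_pdivlMr// mulrC.
have [Q [QA Qc Qe]] := comp_algorithm C0 p0 bd Cx.
have [V Vm VP] := lo _ _ _ QA Qc Qe.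
have {}Vm : (#|` V| <= m)%N by rewrite -(ler_nat R) (le_trans Vm)// mulrC divfK// gt_eqF.
pose J := (fiota (2 * m) `\` V)%fset.
have VJ : [disjoint V & J]%fset.
  by apply/fdisjointP => j jV; rewrite !inE jV.
have := VP J (2 * m)%N VJ _ erefl; set t := \sum_(_ <= _ < _) _ => tP.
have tge : m%:R * ghat S (2 * m)%N <= t.
  have -> : t = \sum_(j <- J) ghat S j.
    rewrite /t -big_fiota -(big_fset_incl _ (fsubsetDl _ V)) /=.
      by apply: eq_big_seq => j ->.
    by move=> j _ /negbTE ->.
  apply: (@le_trans _ _ (\sum_(j <- J) ghat S (2 * m)%N)); last first.
    rewrite big_seq [leRHS]big_seq; apply: ler_sum => j.
    by rewrite in_fsetD in_fiota => /andP[_ /ltnW]; exact: ghat_mono.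
  rewrite big_const_seq count_predT iter_addr_0 -[leRHS]mulr_natl ler_wpM2r// ler_nat.
  rewrite cardfsD.
  have -> : #|` fiota (2 * m)| = (2 * m)%N.
    by rewrite -sum1_size big_fiota sum_nat_const_nat subn0 muln1.
  have : (#|` (fiota (2 * m) `&` V)%fset| <= m)%N.
    by apply: leq_trans Vm; apply: fsubset_leq_card; exact: fsubsetIr.
  move=> h; have m2 : (m + m = 2 * m)%N by rewrite mul2n addnn.
  rewrite leq_subRL; first by rewrite -[leqRHS]m2 leq_add2r.
  by rewrite (leq_trans h)// -m2 leq_addl.
have tle : t <= Cg.
  by apply: le_trans (CgP (2 * m)%N); apply: ler_sum => j _; case: ifP.
have eE : (((C + 1) / (m%:R / C2)) `^ (1 / p)) ^+ 2 = m0 `^ (2 / p) * m%:R `^ (- (2 / p)).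
  rewrite -powR_mulrn ?powR_ge0// -powRrM.
  have -> : (C + 1) / (m%:R / C2) = m0 * m%:R^-1 by rewrite /m0 invf_div; ring.
  rewrite (_ : 1 / p * 2 = 2 / p); last by ring.
  by rewrite powRM ?powRV ?invr_ge0 ?ltW// powRN.
rewrite eE in tP.
have : m%:R * ghat S (2 * m)%N <= K1 * m%:R `^ (- (2 / p)).
  apply: le_trans tge _; apply: le_trans tP _; rewrite /K1 mulrAC ler_wpM2r ?powR_ge0//.
  by rewrite ler_wpM2l ?powR_ge0// lerD2l.
rewrite mulrC -ler_pdivlMr// => /le_trans; apply.
rewrite -mulrA ler_wpM2l// /s opprD powRD; last by rewrite (lt0r_neq0 mp') implybT.
by rewrite mulrC powR_inv1// ltW.
Qed.

Lemma decay_ge C p : ebigOmega cost (fun nu => nu%:R%:E) -> (1 < dec)%E ->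
  0 <= C -> 0 < p -> comp_bound C p -> ((1 + 2 / p)%:E <= dec)%E.
Proof.
move=> Om dec1 C0 p0 bd; apply/lee_subgt0Pr => e e0; rewrite -EFinB.
set r := _ - e; have [r1|r1] := leP r 1.
  by apply: le_trans (ltW dec1); rewrite lee_fin.
have r0 : 0 < r by lra.
apply: ereal_sup_ubound; exists r => //; apply/decay_setP.
have gh0 := ghat_ge0 S.
have [C' CP] := ghat_decay Om C0 p0 bd.
have C'0 : 0 <= C' by have := CP 1%N isT; rewrite powR1 mulr1; exact: le_trans.
(* For [r < 1 + 2 / p] the powers [1 / r] of the weights decay with an exponent larger than [1], so
   they are summable and [r] is admissible in the decay. *)
have [|||m mp|T TP] := @condensation R (fun j => ghat S j `^ (1 / r)) (C' `^ (1 / r)) ((1 + 2 / p) / r).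
- by move=> j; exact: powR_ge0.
- move=> i j ij; apply: ge0_ler_powR; rewrite ?nnegrE ?ghat_mono//.
  by rewrite divr_ge0// ltW.
- by rewrite ltr_pdivlMr// mul1r /r; lra.
- apply: (@le_trans _ _ ((C' * m%:R `^ (- (1 + 2 / p))) `^ (1 / r))).
    apply: ge0_ler_powR; rewrite ?nnegrE ?gh0 ?CP//; first by rewrite divr_ge0// ltW.
    by rewrite mulr_ge0 ?powR_ge0.
  by rewrite powRM ?powR_ge0// -powRrM div1r mulNr.
exists (expR T) => n; apply: le_trans (nprod_expR n (fun j => powR_ge0 _ _)) _.
by rewrite ler_expR.
Qed.

Lemma p_res_ge_decay : ebigOmega cost (fun nu => nu%:R%:E) -> (1 < dec)%E ->
  (2%:E / (dec - 1) <= p_res mu HK a cost)%E.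
Proof.
move=> Om dec1; apply: le_ereal_inf_tmp => _ [p [p0 [C C0 bd]] <-].
apply/lee_addgt0Pr => e e0; rewrite -EFinD.
(* The exponent [p] may be [0], whereas [decay_ge] needs a positive one. *)
have pe0 : 0 < p + e by lra.
have bd' : comp_bound C (p + e).
  apply: (@comp_boundW _ p) => //; first by lra.
  by move=> eps /andP[eps0 _]; exact: bd.
have := decay_ge Om dec1 C0 pe0 bd'; move: dec1; case: dec => [x| |]//.
  rewrite !lee_fin lte_fin => x1 h; rewrite -EFinB inver gt_eqF ?subr_gt0// -EFinM lee_fin.
  rewrite ler_pdivrMr ?subr_gt0// -ler_pdivrMl//.
  by rewrite mulrC; lra.
by move=> _ _; rewrite addye// invey mule0 lee_fin ltW.
Qed.

Lemma p_res_ge_alpha alpha : 0 < alpha ->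
  ebigOmega (fun N => min_error mu HK a cost N B) (fun N => (N%:R `^ (- (alpha / 2)))%:E) ->
  ((2 / alpha)%:E <= p_res mu HK a cost)%E.
Proof.
move=> al0 [C1 C10 Om]; apply: le_ereal_inf_tmp => _ [p [p0 [C C0 bd]] <-].
rewrite lee_fin leNgt; apply/negP => pal.
(* Strictly between [p] and [2 / alpha]: positive even for [p = 0], and with [1 / q > alpha / 2], so
   the error bound from the complexity beats the assumed lower bound for large [N]. *)
pose q := (p + 2 / alpha) / 2.
have q0 : 0 < q by rewrite /q; lra.
have bd' : comp_bound C q.
  apply: (@comp_boundW _ p) => //; first by rewrite /q; lra.
  by move=> eps /andP[eps0 _]; exact: bd.
pose e := 1 / q - alpha / 2; pose K := C1 * (C + 1) `^ (1 / q).
have K0 : 0 <= K by rewrite mulr_ge0 ?powR_ge0.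
have [N [NO NC NK N1]] : exists N, [/\
    ((N%:R `^ (- (alpha / 2)))%:E <= C1%:E * min_error mu HK a cost N B)%E,
    C + 1 <= N%:R, (K + 1) `^ (1 / e) <= N%:R & 1 <= N%:R :> R].
  apply: (@filter_ex _ \oo); near=> N; split.
  - by near: N.
  - by near: N; exact: nbhs_infty_ger.
  - by near: N; exact: nbhs_infty_ger.
  - by near: N; exact: nbhs_infty_ger.
have N0 : 0 < N%:R :> R by lra.
have [Q [QA Qc Qe]] := comp_algorithm C0 q0 bd' NC.
have : (C1%:E * min_error mu HK a cost N B <= (C1 * ((C + 1) / N%:R) `^ (1 / q))%:E)%E.
  rewrite EFinM lee_wpmul2l//; apply: le_trans Qe; apply: ereal_inf_lbound.
  by exists Q.
move=> /(le_trans NO); rewrite lee_fin.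
have C1' : 0 <= C + 1 by lra.
have iN : 0 <= N%:R^-1 :> R by rewrite invr_ge0.
rewrite (powRM _ C1' iN) (powRV _ (ltW N0)) mulrA -/K ler_pdivlMr ?powR_gt0// -powRD; last by rewrite (lt0r_neq0 N0) implybT.
rewrite addrC -/e => NeK.
have ep : 0 < e.
  rewrite /e subr_gt0 -[ltLHS]invf_div div1r ltf_pV2 ?posrE ?divr_gt0//.
    by rewrite /q; lra.
  by have := divr_gt0 (ltr0n R 2) al0; lra.
have : K + 1 <= N%:R `^ e.
  apply: le_trans (ge0_ler_powR (ltW ep) _ _ NK); rewrite ?nnegrE ?powR_ge0 ?(ltW N0)//.
  by rewrite -powRrM div1r mulVf ?gt_eqF// powRr1//; lra.
lra.
Unshelve. all: by end_near. Qed.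

End necessary.

Theorem theorem4p3 (R : realType) (D : set R) (D0 : D !=set0)
  (rho : probability (dom D0) R)
  (mu : probability (prod_space nat (dom D0)) R)
  (hmu : is_product_measure rho mu)
  (k : dom D0 -> dom D0 -> R)
  (Hk : rkhs k)
  (k_neq0 : k <> (fun _ _ => 0))
  (k_meas : measurable_fun setT (fun p : dom D0 * dom D0 => k p.1 p.2))
  (k_noconst : forall c : R, Hk (fun=> c) -> c = 0)
  (k_int : (\int[rho]_x (k x x)%:E < +oo)%E)
  (k_mean0 : forall y, (\int[rho]_x (k x y)%:E = 0)%E)
  (k_diag : forall x, 0 < k x x)
  (gamma : {fset nat} -> R)
  (gamma_ge0 : forall u, 0 <= gamma u)
  (gamma0 : gamma fset0 = 1)
  (gamma_sum : (\esum_(u in [set: {fset nat}])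
     ((gamma u)%:E * (\int[rho]_x (k x x)%:E) ^+ #|` u|) < +oo)%E)
  (gamma_sub : forall u v : {fset nat}, (u `<=` v)%fset -> 0 < gamma v -> 0 < gamma u)
  (gamma_prod : product_weights gamma)
  (H : forall u : {fset nat}, rkhs (kern k u))
  (HK : rkhs (@Kkern R (dom D0) k gamma))
  (a : dom D0)
  (a_sum : (\esum_(u in [set: {fset nat}])
     (gamma u * k a a ^+ #|` u|)%:E < +oo)%E)
  (cost : nat -> \bar R)
  (cost_ge1 : forall nu, (1 <= cost nu)%E)
  (cost_mono : forall nu nu', (nu <= nu')%N -> (cost nu <= cost nu')%E)
  (cost_exp : exists2 sigma : R, 0 < sigma &
     ebigO cost (fun nu => (expR (sigma * nu%:R))%:E))
  (decay_gt1 : (1 < decay k gamma a)%E)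
  (tau : R)
  (hQ : quadrature_assumption rho gamma H a tau) :
  let e N := min_error mu HK a cost N (rkhs_ball HK) in
  let dec := decay k gamma a in
  [/\ forall delta : R, 0 < delta ->
        ebigO (fun N => (e N ^+ 2)%E)
          (fun N => (N%:R `^ (- fine (mine tau%:E (dec - 1))%E + delta))%:E),
      (p_res mu HK a cost <= maxe (2 / tau)%:E (2%:E / (dec - 1)))%E &
      forall alpha : R, alpha = tau ->
        ebigOmega e (fun N => (N%:R `^ (- (alpha / 2)))%:E) ->
        ebigOmega cost (fun nu => nu%:R%:E) ->
        p_res mu HK a cost = maxe (2 / alpha)%:E (2%:E / (dec - 1))%E].
Proof.
move: gamma_prod => [g [g_ge0 g_mono gE]].
have {}gE : gamma = fun u => \prod_(j <- u) g j by apply/funext.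
subst gamma; move=> e dec.
pose S := Setting hmu Hk k_meas k_int k_mean0 k_diag g_ge0 gamma_sum a_sum H HK.
have tau0 : 0 < tau by have [? [? [? [? [[]]]]]] := hQ.
have [M [/andP[M0 Mtau] minE maxE decM]] := min_max_decay (S := S) tau0 decay_gt1.
have [sigma sigma0 costO] := cost_exp.
have rate beta : 0 < beta < M -> achieves_rate S cost beta.
  move=> /andP[b0 bM]; apply: (achieves_rate_decay (S := S) cost_ge1 cost_mono hQ sigma0 costO).
    by rewrite b0 (lt_le_trans bM).
  exact: decM.
have upper : (p_res mu HK a cost <= maxe (2 / tau)%:E (2%:E / (dec - 1)))%E.
  rewrite maxE; exact: (p_res_rate cost_mono M0 rate).
split => //.
- move=> delta delta0; rewrite minE /=.
  (* The term [M / 2] keeps [beta] positive when [delta] is large, and both terms are below [M]. *)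
  pose beta := Num.max (M / 2) (M - delta).
  have b0 : 0 < beta by rewrite lt_max divr_gt0.
  apply: (min_error_rate (S := S) (beta := beta)) => //; last by rewrite le_max lexx orbT.
  by apply: rate; rewrite b0 gt_max; lra.
- move=> alpha -> Oe Ocost; apply/eqP; rewrite eq_le upper ge_max /=; apply/andP; split.
    exact: (p_res_ge_alpha (S := S) tau0 Oe).
  exact: (p_res_ge_decay (S := S) cost_ge1 g_mono Ocost decay_gt1).
Qed.
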